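(* Consider the HL-model $$\omega_t+u\,\omega_x=\theta_x,\qquad \theta_t+u\,\theta_x=0,$$ with initial data $(\theta,\omega)|_{t=0}=(\theta_0,\omega_0)$, where $u$ is determined from $\omega$ by the Biot–Savart law given in the context. (Periodic case, $x\in {\bf S}^1=\mathbb{R}/L\mathbb{Z}$, $L>0$.) There exist smooth $L$-periodic initial data $(\theta_0,\omega_0)$ for which the HL-model has no smooth global solution, i.e. no smooth solution $(\theta,\omega)$ defined for all $t\ge 0$ with these initial data. (Real-line case, $x\in\mathbb{R}$.) There exist smooth initial data $(\theta_0,\omega_0)$ on $\mathbb{R}$ with $\theta_{0x}$ and $\omega_0$ compactly supported for which the HL-model has no smooth global solution, i.e. no smooth solution $(\theta,\omega)$ defined for all $t\ge 0$ with these initial data.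
   Context: The unknowns are real-valued functions $\omega(x,t)$, $\theta(x,t)$; subscripts $x,t$ denote partial derivatives, and $\theta_{0x}=\partial_x\theta_0$. The velocity $u$ satisfies $u_x=H\omega$, with $H$ the Hilbert transform (periodic Hilbert transform in the periodic case), and is given explicitly as follows. Real-line case: $u(x,t)=\frac1\pi\int_{\mathbb{R}}\omega(y,t)\log|x-y|\,dy$, so that $u_x(x,t)=\frac1\pi\,\mathrm{P.V.}\int_{\mathbb{R}}\frac{\omega(y,t)}{x-y}\,dy$. Periodic case (period $L$, $\mu=\pi/L$): $u(x,t)=\frac1\pi\int_0^L\omega(y,t)\log\bigl|\sin[\mu(x-y)]\bigr|\,dy$, so that $u_x(x,t)=\frac1L\,\mathrm{P.V.}\int_0^L\omega(y,t)\cot[\mu(x-y)]\,dy$. A smooth global solution is a pair $(\theta,\omega)$ of $C^\infty$ functions of $(x,t)$, $t\in[0,\infty)$, satisfying the equations pointwise and attaining the initial data at $t=0$; in the periodic case they are $L$-periodic in $x$; in the real-line case it is required that for every $T>0$ the supports of $\omega(\cdot,t)$ and $\theta_x(\cdot,t)$, $0\le t\le T$, lie in a common compact subset of $\mathbb{R}$. *)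

(* Defs.v *)
From mathcomp Require Import all_boot all_order all_algebra.
From mathcomp Require Import all_classical all_reals all_analysis.
Set Implicit Arguments.
Unset Strict Implicit.
Unset Printing Implicit Defensive.
Import Order.TTheory GRing.Theory Num.Theory.
Import numFieldNormedType.Exports.
Local Open Scope classical_set_scope.
Local Open Scope ring_scope.

(* A function of (x, t) is a term f : R -> R -> R; only its values at t >= 0
   are meaningful. *)
Section HL.
Context {R : realType}.
Implicit Types (f u theta omega : R -> R -> R) (g : R -> R).

Definition smooth1 g : Prop := forall (n : nat) (x : R), derivable (derive1n n g) x 1.

Definition supp g : set R := closure [set x | g x != 0].

Definition dx f : R -> R -> R := fun x t => derive1 (f ^~ t) x.

(* The increment h is restricted to 0 <= t + h, so that this is the usual
   derivative at t > 0 and the right derivative at t = 0. *)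
Definition dt_filter (t : R) : set_system R :=
  within [set h | 0 <= t + h] 0^'.

Definition dt_quot f (x t : R) : R -> R :=
  fun h => h^-1 * (f x (t + h) - f x t).

Definition dt f : R -> R -> R :=
  fun x t => lim (dt_quot f x t h @[h --> dt_filter t]).

Definition C0_spacetime f : Prop :=
  {within [set p : R * R | 0 <= p.2], continuous (fun p : R * R => f p.1 p.2)}.

Fixpoint Ck_spacetime (k : nat) f : Prop :=
  if k is k'.+1 then
    [/\ C0_spacetime f,
        forall x t : R, 0 <= t -> derivable (f ^~ t) x 1,
        forall x t : R, 0 <= t -> cvg (dt_quot f x t h @[h --> dt_filter t]),
        Ck_spacetime k' (dx f) &
        Ck_spacetime k' (dt f)]
  else C0_spacetime f.

Definition smooth_spacetime f : Prop := forall k : nat, Ck_spacetime k f.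

(* The logarithms below are singular only on a null set of y, where ln takes
   its default value ln 0 = 0; this does not affect the integrals. *)
Definition velocity_line omega : R -> R -> R := fun x t =>
  pi^-1 * \int[lebesgue_measure]_(y in [set: R]) (omega y t * ln `|x - y|).

Definition velocity_periodic (L : R) omega : R -> R -> R := fun x t =>
  pi^-1 * \int[lebesgue_measure]_(y in `[0, L])
            (omega y t * ln `|sin (pi / L * (x - y))|).

Definition HL_system u theta omega : Prop :=
  forall x t : R, 0 <= t ->
    dt omega x t + u x t * dx omega x t = dx theta x t /\
    dt theta x t + u x t * dx theta x t = 0.

Definition initial_data (theta0 omega0 : R -> R) theta omega : Prop :=
  forall x : R, theta x 0 = theta0 x /\ omega x 0 = omega0 x.

Definition global_solution_periodic (L : R) (theta0 omega0 : R -> R)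
    theta omega : Prop :=
  [/\ smooth_spacetime theta /\ smooth_spacetime omega,
      forall t : R, 0 <= t ->
        periodic (theta ^~ t) L /\ periodic (omega ^~ t) L,
      HL_system (velocity_periodic L omega) theta omega &
      initial_data theta0 omega0 theta omega].

Definition global_solution_line (theta0 omega0 : R -> R) theta omega : Prop :=
  [/\ smooth_spacetime theta /\ smooth_spacetime omega,
      forall T : R, 0 < T -> exists2 K : set R, compact K &
        forall t : R, 0 <= t <= T ->
          supp (omega ^~ t) `<=` K /\ supp (dx theta ^~ t) `<=` K,
      HL_system (velocity_line omega) theta omega &
      initial_data theta0 omega0 theta omega].

End HL.

(* Main.v *)
Require Import Defs.
From mathcomp Require Import all_boot all_order all_algebra.
From mathcomp Require Import all_classical all_reals all_analysis.
From mathcomp Require Import measurable_realfun ring lra.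
Import Order.TTheory GRing.Theory Num.Theory.
Import numFieldNormedType.Exports.
Local Open Scope classical_set_scope.
Local Open Scope ring_scope.
Set Implicit Arguments.
Unset Strict Implicit.
Unset Printing Implicit Defensive.

(* The blow-up argument of Choi, Hou, Kiselev, Luo, Sverak and Yao, carried out
   with kernels regularised at length e^(-2 lam): u and u_x are limits of smooth
   convolutions with error O(e^(-lam)), so no principal value occurs.
   Take omega_0 = 0 and theta_0 even about a minimum with value 0, increasing on
   one side up to distance m0 and constant beyond.  An energy estimate that loses
   one logarithm gives uniqueness, so theta stays even and omega odd; then
   theta_x and omega stay nonnegative on [0, l] and u is nonpositive there.
   With w(x) = 1/x on the line and w(x) = cot(pi x / L) on the circle, put
   I = \int_0^m0 theta w and J = \int_0^l theta omega w.  The lower bound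
   w(x) (K(x+y) - K(x-y)) >= w(y) for x <= y, K the kernel of u, yields
   I' >= J / pi; a symmetrisation shows that the transport terms contribute to J'
   with a favourable sign, leaving J' >= C I^2.  Hence I becomes infinite in
   finite time. *)

(** A given global solution is not known to be odd, while every sign used later (of omega, theta_x,
    u) rests on oddness; this is why uniqueness has to be proved at all. In place of the
    L2-boundedness of the Hilbert transform, Schur's test is applied to the regularised kernel,
    whose L1 norm grows like [lam]; the error e^(-lam) beats that growth on short time steps. The
    mismatch between the length e^(-2 lam) and the error e^(-lam) is deliberate: the kernel error is
    at most e^(-lam) |z|^(-1/2), so half a power of the length buys an integrable bound. On the
    line, [-l, l] must contain the supports up to time T, so [l] depends on T. The argument closes
    because the blow-up time involves only m0, I(0) and the constant in -w' >= c w^2, never [l];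
    hence I is taken over [0, m0] although J runs over [0, l]. Both geometries share one pair (s, c)
    obeying addition formulas with a parameter k (0 on the line, 1 on the circle). The inequality
    artanh z >= z replaces the logarithmic kernel by a rational function of s and c, so that each
    kernel inequality becomes algebra with the regularisation still present. *)

Section calculus.
Context {R : realType}.
Implicit Types (a b c x y : R) (f g F : R -> R).
Notation mu := (@lebesgue_measure R).

(** * Integrals and derivatives over a segment *)

Definition rint a b f : R := \int[mu]_(x in `[a, b]) f x.

(* Continuity is required from both sides at the end points, so that it is
   stable under pointwise operations. *)
Definition cts a b f := forall x, a <= x <= b -> {for x, continuous f}.

Lemma cts_within a b f : cts a b f -> {within `[a, b], continuous f}.
Proof.
move=> cf; apply: continuous_in_subspaceT => x.
by rewrite inE/= in_itv/= => xab; exact: cf.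
Qed.

Lemma ctsS a b c d f : a <= c -> d <= b -> cts a b f -> cts c d f.
Proof.
move=> ac db cf x /andP[cx xd]; apply: cf.
by rewrite (le_trans ac cx) (le_trans xd db).
Qed.

Lemma cts_cst a b c : cts a b (fun=> c).
Proof. by move=> x _; exact: cst_continuous. Qed.

Lemma ctsD a b f g : cts a b f -> cts a b g -> cts a b (fun x => f x + g x).
Proof. by move=> cf cg x xab; apply: continuousD; [exact: cf|exact: cg]. Qed.

Lemma ctsN a b f : cts a b f -> cts a b (fun x => - f x).
Proof. by move=> cf x xab; apply: continuousN; exact: cf. Qed.

Lemma ctsB a b f g : cts a b f -> cts a b g -> cts a b (fun x => f x - g x).
Proof. by move=> cf cg x xab; apply: continuousB; [exact: cf|exact: cg]. Qed.

Lemma ctsM a b f g : cts a b f -> cts a b g -> cts a b (fun x => f x * g x).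
Proof. by move=> cf cg x xab; apply: continuousM; [exact: cf|exact: cg]. Qed.

Lemma ctsZ a b c f : cts a b f -> cts a b (fun x => c * f x).
Proof. by move=> cf; apply: ctsM => //; exact: cts_cst. Qed.

Lemma cts_norm a b f : cts a b f -> cts a b (fun x => `|f x|).
Proof.
move=> cf x xab; apply: continuous_comp; first exact: cf.
exact: norm_continuous.
Qed.

Lemma continuous_cts a b f : continuous f -> cts a b f.
Proof. by move=> cf x _; exact: cf. Qed.

Lemma cts_comp a b f g :
  cts a b f -> continuous g -> cts a b (fun x => g (f x)).
Proof. by move=> cf cg x xab; apply: continuous_comp; [exact: cf|exact: cg]. Qed.

Lemma cts_integrable a b f : cts a b f -> mu.-integrable `[a, b] (EFin \o f).
Proof.
move=> cf; apply: continuous_compact_integrable; first exact: segment_compact.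
exact: cts_within.
Qed.
Hint Resolve cts_integrable : core.

Lemma eq_rint a b f g : (forall x, a <= x <= b -> f x = g x) ->
  rint a b f = rint a b g.
Proof.
by move=> fg; apply: eq_Rintegral => x; rewrite inE/= in_itv/=; exact: fg.
Qed.

Lemma rintD a b f g : cts a b f -> cts a b g ->
  rint a b (fun x => f x + g x) = rint a b f + rint a b g.
Proof. by move=> cf cg; rewrite /rint RintegralD//; apply: cts_integrable. Qed.

Lemma rintB a b f g : cts a b f -> cts a b g ->
  rint a b (fun x => f x - g x) = rint a b f - rint a b g.
Proof. by move=> cf cg; rewrite /rint RintegralB//; exact: cts_integrable. Qed.

Lemma rintZ a b c f : cts a b f ->
  rint a b (fun x => c * f x) = c * rint a b f.
Proof. by move=> cf; rewrite /rint RintegralZl//; exact: cts_integrable. Qed.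

Lemma rintN a b f : cts a b f ->
  rint a b (fun x => - f x) = - rint a b f.
Proof.
move=> cf; rewrite -mulN1r -rintZ//.
by apply: eq_rint => x _; rewrite mulN1r.
Qed.

Lemma rint_cst a b c : a <= b -> rint a b (fun=> c) = c * (b - a).
Proof.
move=> ab; rewrite /rint Rintegral_cst//= lebesgue_measure_itv/= lte_fin.
by case: ltgtP ab => // -> _; rewrite subrr.
Qed.

Lemma le_rint a b f g : cts a b f -> cts a b g ->
  (forall x, a <= x <= b -> f x <= g x) -> rint a b f <= rint a b g.
Proof.
move=> cf cg fg; apply: le_Rintegral;
  [by []|exact: cts_integrable|exact: cts_integrable|].
by move=> x; rewrite /= in_itv; exact: fg.
Qed.

Lemma rint_ge0 a b f : (forall x, a <= x <= b -> 0 <= f x) -> 0 <= rint a b f.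
Proof.
by move=> f0; apply: Rintegral_ge0 => x; rewrite /= in_itv; exact: f0.
Qed.

Lemma rint_norm_le a b f : cts a b f ->
  `|rint a b f| <= rint a b (fun x => `|f x|).
Proof. by move=> cf; apply: le_normr_Rintegral => //; exact: cts_integrable. Qed.

Lemma rint_bound a b f c : a <= b -> cts a b f ->
  (forall x, a <= x <= b -> `|f x| <= c) -> `|rint a b f| <= c * (b - a).
Proof.
move=> ab cf fc; apply: le_trans (rint_norm_le cf) _.
rewrite -rint_cst//; apply: le_rint => //; [exact: cts_norm|exact: cts_cst].
Qed.

Lemma rint_split a b c f : a <= c <= b ->
  mu.-integrable `[a, b] (EFin \o f) ->
  rint a b f = rint a c f + rint c b f.
Proof.
move=> /andP[ac cb] cf; rewrite /rint.
have := @Rintegral_itvB R f (BLeft a) (BRight b) c cf.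
rewrite !bnd_simp => /(_ ac cb) /(canRL (subrK _)) ->.
rewrite addrC Rintegral_itv_obnd_cbnd//.
apply: integrableS cf => // x; rewrite /= !in_itv/= => /andP[cx ->].
by rewrite andbT (le_trans ac (ltW cx)).
Qed.

Lemma isdM f g x (df dg : R) : is_derive x 1 f df -> is_derive x 1 g dg ->
  is_derive x 1 (fun y => f y * g y) (df * g x + f x * dg).
Proof.
move=> H1 H2; have H := is_deriveM H1 H2.
have -> : df * g x + f x * dg = f x *: dg + g x *: df.
  by rewrite /GRing.scale/=; ring.
exact: H.
Qed.

Lemma isdD f g x (df dg : R) : is_derive x 1 f df -> is_derive x 1 g dg ->
  is_derive x 1 (fun y => f y + g y) (df + dg).
Proof. by move=> H1 H2; exact: is_deriveD. Qed.

Lemma isdB f g x (df dg : R) : is_derive x 1 f df -> is_derive x 1 g dg ->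
  is_derive x 1 (fun y => f y - g y) (df - dg).
Proof. by move=> H1 H2; exact: is_deriveB. Qed.

Lemma isdN f x (df : R) : is_derive x 1 f df ->
  is_derive x 1 (fun y => - f y) (- df).
Proof. by move=> H1; exact: is_deriveN. Qed.

Lemma isd_cst x (c : R) : is_derive x 1 (fun=> c) 0.
Proof. exact: is_derive_cst. Qed.

Lemma isd_id x : is_derive x 1 (fun y => y) 1.
Proof. exact: is_derive_id. Qed.

Lemma isdZ f x c (df : R) : is_derive x 1 f df ->
  is_derive x 1 (fun y => c * f y) (c * df).
Proof.
move=> H; have := isdM (isd_cst x c) H; rewrite mul0r add0r; exact.
Qed.

Lemma isd_comp f g x (df dg : R) : is_derive x 1 f df ->
  is_derive (f x) 1 g dg -> is_derive x 1 (fun y => g (f y)) (dg * df).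
Proof. by move=> H1 H2; have := is_derive1_comp H2 H1. Qed.

Lemma isd_sqr f x (df : R) : is_derive x 1 f df ->
  is_derive x 1 (fun y => f y ^+ 2) (2 * f x * df).
Proof.
move=> H; have -> : 2 * f x * df = df * f x + f x * df by ring.
have -> : (fun y => f y ^+ 2) = (fun y => f y * f y).
  by apply/funext => y; rewrite expr2.
exact: isdM.
Qed.

Lemma isd_eq f x (df dg : R) : is_derive x 1 f df -> df = dg -> is_derive x 1 f dg.
Proof. by move=> ? <-. Qed.

Lemma is_derive_continuous f x (df : R) :
  is_derive x 1 f df -> {for x, continuous f}.
Proof.
move=> H; apply: differentiable_continuous; apply/derivable1_diffP.
exact: (@ex_derive _ _ _ _ _ _ _ H).
Qed.

Lemma is_derive_cts a b f (df : R -> R) :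
  (forall x, a <= x <= b -> is_derive x 1 f (df x)) -> cts a b f.
Proof. by move=> H x xab; apply: is_derive_continuous; exact: H. Qed.

Lemma rint_FTC a b f F : a <= b ->
  (forall x, a <= x <= b -> is_derive x 1 F (f x)) -> cts a b f ->
  rint a b f = F b - F a.
Proof.
rewrite le_eqVlt => /predU1P[->|ab] dF cf.
  by rewrite subrr /rint set_itv1 Rintegral_set1.
have cF : cts a b F by exact: is_derive_cts dF.
rewrite /rint /Rintegral (@continuous_FTC2 R f F)//.
- exact: cts_within.
- split.
  + move=> x; rewrite in_itv/= => /andP[ax xb].
    have xab : a <= x <= b by rewrite !ltW.
    by have := dF x xab => H; exact: (@ex_derive _ _ _ _ _ _ _ H).
  + by apply: cvg_at_right_filter; apply: cF; rewrite lexx ltW.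
  + by apply: cvg_at_left_filter; apply: cF; rewrite lexx ltW.
- move=> x; rewrite in_itv/= => /andP[ax xb].
  have xab : a <= x <= b by rewrite !ltW.
  by have := dF x xab => H; rewrite derive1E (@derive_val _ _ _ _ _ _ _ H).
Qed.

Lemma rint_parts a b F G f g : a <= b ->
  (forall x, a <= x <= b -> is_derive x 1 F (f x)) ->
  (forall x, a <= x <= b -> is_derive x 1 G (g x)) ->
  cts a b f -> cts a b g ->
  rint a b (fun x => F x * g x) =
  F b * G b - F a * G a - rint a b (fun x => f x * G x).
Proof.
move=> ab dF dG cf cg.
have cF := is_derive_cts dF; have cG := is_derive_cts dG.
have FTC : rint a b (fun x => F x * g x + f x * G x) = F b * G b - F a * G a.
  apply: (@rint_FTC _ _ _ (fun x => F x * G x)) => //.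
  - move=> x xab; have := isdM (dF _ xab) (dG _ xab).
    by rewrite addrC; exact.
  - by apply: ctsD; exact: ctsM.
by rewrite -FTC rintD; [rewrite addrK|exact: ctsM..].
Qed.

Lemma rint_opp a b f : a <= b -> cts (- b) (- a) f ->
  rint (- b) (- a) f = rint a b (fun x => f (- x)).
Proof.
move=> ab cf; rewrite /rint /Rintegral integration_by_substitution_oppr//.
exact: cts_within.
Qed.

End calculus.

(** * Differentiation under the integral sign, monotonicity in time, Gronwall *)

Section time_calculus.
Context {R : realType}.
Implicit Types (a b c s t x y T : R) (f g : R -> R) (F Ft : R -> R -> R).
Notation mu := (@lebesgue_measure R).

Lemma lipschitz_within s T f (C : R) :
  (forall t t', s <= t <= T -> s <= t' <= T -> `|f t - f t'| <= C * `|t - t'|) ->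
  {within `[s, T], continuous f}.
Proof.
move=> H; apply/subspace_continuousP => t; rewrite /= in_itv/= => tI.
apply/cvgrPdist_le => e e0.
have C0 : 0 < `|C| + 1 by rewrite ltr_wpDl.
rewrite near_withinE; near=> t'.
rewrite /= in_itv/= => t'I; apply: le_trans (H _ _ tI t'I) _.
have tt' : `|t - t'| <= e / (`|C| + 1).
  near: t'; apply: (@cvgr_dist_le _ R^o _ (nbhs t) _ id t cvg_id).
  by rewrite divr_gt0.
apply: (@le_trans _ _ ((`|C| + 1) * `|t - t'|)).
  by apply: ler_wpM2r => //; have := ler_norm C; lra.
by rewrite mulrC -ler_pdivlMr.
Unshelve. all: end_near. Qed.

Lemma MVT_bound s T f (df : R -> R) (C : R) :
  {within `[s, T], continuous f} ->
  (forall t, s < t < T -> is_derive t 1 f (df t)) ->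
  (forall t, s < t < T -> `|df t| <= C) ->
  forall t t', s <= t <= T -> s <= t' <= T -> `|f t - f t'| <= C * `|t - t'|.
Proof.
move=> cf dF dC.
suff H t t' : s <= t -> t < t' -> t' <= T -> `|f t' - f t| <= C * `|t' - t|.
  move=> t t' /andP[st tT] /andP[st' t'T].
  have [tt'|t't|->] := ltgtP t t'.
  - by rewrite distrC (distrC t); exact: H.
  - exact: H.
  - by rewrite !subrr normr0 mulr0.
move=> st tt' t'T.
have sub x : t < x < t' -> s < x < T.
  by move=> /andP[tx xt']; rewrite (le_lt_trans st tx) (lt_le_trans xt' t'T).
have [||x] := @MVT R f df t t' tt'.
- by move=> x; rewrite in_itv/= => xI; apply: dF; exact: sub.
- apply: continuous_subspaceW cf => x; rewrite /= !in_itv/= => /andP[tx xt'].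
  by rewrite (le_trans st tx) (le_trans xt' t'T).
- rewrite in_itv/= => xI ->; rewrite normrM.
  by apply: ler_wpM2r => //; apply: dC; exact: sub.
Qed.

(* Sufficient for differentiating \int_a^b F(x, t) dx in t on ]s, T[. *)
Definition tdiff a b s T F Ft := [/\
  forall t, s <= t <= T -> cts a b (F ^~ t),
  forall x, a <= x <= b -> {within `[s, T], continuous (F x)},
  forall x t, a <= x <= b -> s < t < T -> is_derive t 1 (F x) (Ft x t) &
  exists C,
    (forall x t, a <= x <= b -> s <= t <= T -> `|F x t| <= C) /\
    (forall x t, a <= x <= b -> s < t < T -> `|Ft x t| <= C)].

(** [Ft] is controlled only inside ]s, T[, so continuity up to the end points comes from a Lipschitz
    bound, by the mean value theorem in t, and not from differentiability. *)
Lemma tdiff_rint a b s T F Ft : a <= b -> tdiff a b s T F Ft ->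
  {within `[s, T], continuous (fun t => rint a b (F ^~ t))} /\
  forall t, s < t < T ->
    is_derive t 1 (fun t => rint a b (F ^~ t)) (rint a b (Ft ^~ t)).
Proof.
move=> ab [cx ct dF [C [FC FtC]]].
split.
  apply: (@lipschitz_within _ _ _ (C * (b - a))) => t t' tI t'I.
  rewrite -rintB; [|exact: cx..].
  rewrite mulrAC; apply: rint_bound => //; first by apply: ctsB; exact: cx.
  move=> x xI.
  apply: (@MVT_bound s T _ (Ft x)) => //; first exact: ct.
  - by move=> r rI; exact: dF.
  - by move=> r rI; exact: FtC.
move=> t tI.
have sub x : s < x < T -> s <= x <= T by move=> /andP[sx xT]; rewrite !ltW.
pose f t x := F x t.
have d1E r x : s < r < T -> a <= x <= b -> partial1of2 f r x = Ft x r.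
  move=> rI xI; rewrite partial1of2E /f/=.
  by have H := dF x r xI rI; rewrite (@derive_val _ _ _ _ _ _ _ H).
have C'0 : 0 <= Num.max C 0 by rewrite le_max lexx orbT.
have := @cvg_differentiation_under_integral R _ _ mu f `[a, b] _ t s T _ _ _
   (fun=> Num.max C 0) (fun=> C'0) _ _.
have -> : \int[mu]_(y in `[a, b]) partial1of2 f t y = rint a b (Ft ^~ t).
  apply: eq_Rintegral => x; rewrite inE/= in_itv/= => xI.
  exact: d1E.
move=> H.
have {}H : h^-1 *: (rint a b (F^~ (h + t)) - rint a b (F^~ t)) @[h --> 0^'] -->
    rint a b (Ft^~ t).
  apply: H => //.
  - move=> r; rewrite /= in_itv/= => /sub rI.
    by apply: cts_integrable; exact: cx.
  - move=> r x; rewrite /= !in_itv/= => rI xI.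
    by have H := dF x r xI rI; exact: (@ex_derive _ _ _ _ _ _ _ H).
  - by apply: (@cts_integrable R a b (fun=> Num.max C 0)); exact: cts_cst.
  - move=> r x; rewrite /= !in_itv/= => rI xI.
    rewrite d1E//; apply: le_trans (FtC _ _ xI rI) _.
    by rewrite le_max lexx.
apply: DeriveDef.
  apply/cvg_ex; exists (rint a b (Ft^~ t)) => /=.
  by under eq_fun do rewrite scaler1.
apply: cvg_lim => //=.
by under eq_fun do rewrite scaler1.
Qed.

Lemma tdiffD a b s T F Ft (G Gt : R -> R -> R) :
  tdiff a b s T F Ft -> tdiff a b s T G Gt ->
  tdiff a b s T (fun x t => F x t + G x t) (fun x t => Ft x t + Gt x t).
Proof.
move=> [cx ct dF [C [FC FtC]]] [gx gt dG [D [GD GtD]]]; split.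
- by move=> t tI; apply: ctsD; [exact: cx|exact: gx].
- move=> x xI t; apply: cvgD; [exact: ct|exact: gt].
- by move=> x t xI tI; apply: isdD; [exact: dF|exact: dG].
- exists (C + D); split=> x t xI tI;
    (apply: le_trans (ler_normD _ _) _; apply: lerD).
  + exact: FC.
  + exact: GD.
  + exact: FtC.
  + exact: GtD.
Qed.

Lemma tdiffM a b s T F Ft (G Gt : R -> R -> R) :
  tdiff a b s T F Ft -> tdiff a b s T G Gt ->
  tdiff a b s T (fun x t => F x t * G x t)
    (fun x t => Ft x t * G x t + F x t * Gt x t).
Proof.
move=> [cx ct dF [C [FC FtC]]] [gx gt dG [D [GD GtD]]]; split.
- by move=> t tI; apply: ctsM; [exact: cx|exact: gx].
- move=> x xI t; apply: cvgM; [exact: ct|exact: gt].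
- by move=> x t xI tI; apply: isdM; [exact: dF|exact: dG].
- exists (Num.max (C * D) (C * D + C * D)); split=> x t xI tI;
    rewrite le_max; apply/orP; [left|right].
    by rewrite normrM ler_pM ?FC ?GD.
  have tI' : s <= t <= T by case/andP: tI => ? ?; rewrite !ltW.
  apply: le_trans (ler_normD _ _) _; rewrite !normrM.
  by apply: lerD; rewrite ler_pM ?FC ?GD ?FtC ?GtD.
Qed.

Lemma nonincreasing_within s T f (df : R -> R) :
  {within `[s, T], continuous f} ->
  (forall t, s < t < T -> is_derive t 1 f (df t)) ->
  (forall t, s < t < T -> df t <= 0) ->
  forall t t', s <= t -> t <= t' -> t' <= T -> f t' <= f t.
Proof.
move=> cf dF df0; apply: (@ler0_derive1_nincr R f s T) => // x;
  rewrite in_itv/= => xI; have H := dF x xI.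
- exact: (@ex_derive _ _ _ _ _ _ _ H).
- by rewrite derive1E (@derive_val _ _ _ _ _ _ _ H); exact: df0.
Qed.

Lemma nondecreasing_within s T f (df : R -> R) :
  {within `[s, T], continuous f} ->
  (forall t, s < t < T -> is_derive t 1 f (df t)) ->
  (forall t, s < t < T -> 0 <= df t) ->
  forall t t', s <= t -> t <= t' -> t' <= T -> f t <= f t'.
Proof.
move=> cf dF df0; apply: (@ger0_derive1_ndecr R f s T) => // x;
  rewrite in_itv/= => xI; have H := dF x xI.
- exact: (@ex_derive _ _ _ _ _ _ _ H).
- by rewrite derive1E (@derive_val _ _ _ _ _ _ _ H); exact: df0.
Qed.

(** With the integrating factor [E], the function N E - B (t - s) is nonincreasing: E <= 1 lets the
    source B E be absorbed by B. *)
Lemma gronwall s T (N N' : R -> R) (A B : R) : 0 <= A -> 0 <= B ->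
  {within `[s, T], continuous N} ->
  (forall t, s < t < T -> is_derive t 1 N (N' t)) ->
  (forall t, s < t < T -> N' t <= A * N t + B) ->
  N s <= 0 ->
  forall t, s <= t <= T -> N t <= B * (t - s) * expR (A * (t - s)).
Proof.
move=> A0 B0 cN dN NN' Ns0 t /andP[st tT].
pose E t := expR (- A * (t - s)).
have dE (r : R) : is_derive r 1 E (E r * - A).
  have H : is_derive r 1 (fun t => - A * (t - s)) (- A).
    apply: (isd_eq (isdZ _ (isdB (isd_id _) (isd_cst _ _)))).
    by rewrite subr0 mulr1.
  exact: isd_comp H (is_derive_expR _).
pose g t := N t * E t - B * (t - s).
have gs : g t <= g s.
  apply: (@nonincreasing_within s T g
    (fun t => N' t * E t + N t * (E t * - A) - B * (1 - 0))) => //.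
  - have cE : {within `[s, T], continuous E}.
      by apply: continuous_subspaceT => r; exact: is_derive_continuous (dE r).
    have cL : {within `[s, T], continuous (fun t => B * (t - s))}.
      apply: continuous_subspaceT => r.
      exact: (is_derive_continuous (isdZ _ (isdB (isd_id _) (isd_cst _ _)))).
    by move=> r; apply: cvgB; [apply: cvgM; [exact: cN|exact: cE]|exact: cL].
  - move=> r rI; have H := dN r rI.
    exact: (isdB (isdM H (dE r)) (isdZ _ (isdB (isd_id _) (isd_cst _ _)))).
  - move=> r rI; have /andP[sr _] := rI.
    have E1 : E r <= 1.
      by rewrite -expR0 ler_expR mulNr oppr_le0 mulr_ge0// subr_ge0 ltW.
    have E0 : 0 <= E r by exact: expR_ge0.
    have := ler_wpM2r E0 (NN' r rI).
    have : B * E r <= B by rewrite -[leRHS]mulr1 ler_wpM2l.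
    by lra.
have {}gs : N t * E t <= B * (t - s).
  have E0 : 0 <= E s by exact: expR_ge0.
  move: gs; rewrite /g subrr mulr0 subr0.
  have : N s * E s <= 0 by rewrite mulr_le0_ge0.
  lra.
have : N t * E t * expR (A * (t - s)) <= B * (t - s) * expR (A * (t - s)).
  by apply: ler_wpM2r => //; exact: expR_ge0.
by rewrite -mulrA -expRD mulNr addNr expR0 mulr1.
Qed.

(** Cauchy-Schwarz against the constant 1, read off from the nonnegativity of the variance of f
    about its mean [m]. *)
Lemma rint_sqr_le a b f : a <= b -> cts a b f ->
  rint a b f ^+ 2 <= (b - a) * rint a b (fun x => f x ^+ 2).
Proof.
rewrite le_eqVlt => /predU1P[<-|ab] cf.
  by rewrite subrr mul0r /rint set_itv1 Rintegral_set1 expr0n.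
have cf2 : cts a b (fun x => f x ^+ 2).
  by move=> x xI; apply: (@continuousM _ _ f f x); exact: cf.
set m := rint a b f / (b - a).
have ba : 0 < b - a by rewrite subr_gt0.
have : 0 <= rint a b (fun x => (f x - m) ^+ 2).
  by apply: rint_ge0 => x _; exact: sqr_ge0.
have -> : rint a b (fun x => (f x - m) ^+ 2) =
    rint a b (fun x => f x ^+ 2) - 2 * m * rint a b f + m ^+ 2 * (b - a).
  rewrite -rint_cst ?ltW// -rintZ// -rintB//; last exact: ctsZ.
  rewrite -rintD; [|by apply: ctsB => //; exact: ctsZ|exact: cts_cst].
  by apply: eq_rint => x _; ring.
have -> : rint a b f = m * (b - a) by rewrite /m divfK// gt_eqF.
set I2 := rint a b _ => H.
have : 0 <= (b - a) * (I2 - 2 * m * (m * (b - a)) + m ^+ 2 * (b - a)).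
  by rewrite mulr_ge0// ltW.
by nra.
Qed.

End time_calculus.

(** * Fubini for bounded functions on rectangles of finite measure *)

Section fubini_bounded.
Context d1 d2 (T1 : measurableType d1) (T2 : measurableType d2) (R : realType).
Variables (m1 : {sigma_finite_measure set T1 -> \bar R}).
Variables (m2 : {sigma_finite_measure set T2 -> \bar R}).
Variables (A : set T1) (B : set T2) (F : T1 -> T2 -> R) (C : R).
Hypotheses (mA : measurable A) (mB : measurable B).
Hypotheses (fA : (m1 A < +oo)%E) (fB : (m2 B < +oo)%E).
Hypothesis mF : measurable_fun (A `*` B) (fun p => F p.1 p.2).
Hypothesis FC : forall x y, A x -> B y -> `|F x y| <= C.

Let D := A `*` B.
Let G : T1 * T2 -> \bar R := (fun p => (F p.1 p.2)%:E) \_ D.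

Let mD : measurable D. Proof. exact: measurableX. Qed.

Let mG : measurable_fun setT G.
Proof.
have mE := (@measurable_EFinP _ (T1 * T2)%type R D (fun p => F p.1 p.2)).2 mF.
exact: (measurable_restrictT _ mD).1 mE.
Qed.

Let GE1 x y :
  G (x, y) = ((fun x => ((fun y => (F x y)%:E) \_ B) y) \_ A) x.
Proof.
rewrite /G !patchE /D.
case: ifPn => [|]; rewrite ?inE ?notin_setE/=.
  by move=> [xI yI]; rewrite !mem_set.
move=> H; case: ifPn => //; rewrite inE => xI; case: ifPn => //.
by rewrite inE => yI; exfalso; exact: H.
Qed.

Let GE2 x y :
  G (x, y) = ((fun y => ((fun x => (F x y)%:E) \_ A) x) \_ B) y.
Proof. by rewrite GE1 !patchE; do 2 case: ifPn. Qed.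

Let iG : (m1 \x m2)%E.-integrable setT G.
Proof.
have C0 : 0 <= Num.max C 0 by rewrite le_max lexx orbT.
apply/integrableP; split => //.
have -> : (\int[m1 \x m2]_z `|G z| =
    \int[m1 \x m2]_(z in D) `|(F z.1 z.2)%:E|)%E.
  rewrite [RHS]integral_mkcond; apply: eq_integral => z _.
  by rewrite /G !patchE; case: ifPn; rewrite ?normr0 ?abse0.
apply: (@le_lt_trans _ _ (\int[m1 \x m2]_(z in D) (Num.max C 0)%:E)%E).
  apply: ge0_le_integral => //.
  - by apply: measurableT_comp => //;
      exact/(@measurable_EFinP _ (T1 * T2)%type R D (fun p => F p.1 p.2)).
  - by move=> [x y] [/= Ax By]; rewrite lee_fin le_max FC.
rewrite integral_cst//= product_measure1E//.
by rewrite lte_mul_pinfty// lte_mul_pinfty// ge0_fin_numE.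
Qed.

(** Fubini is applied to [G], the extension of F by zero, whose sections are again extensions by
    zero. Boundedness and finite measure make [G] and all sections integrable, so that [fine]
    forgets no infinite value. *)
Lemma Rintegral_swap :
  \int[m1]_(x in A) (\int[m2]_(y in B) F x y) =
  \int[m2]_(y in B) (\int[m1]_(x in A) F x y).
Proof.
have fubini := Fubini iG.
rewrite {1}/Rintegral.
have -> : (\int[m1]_(x in A) (\int[m2]_(y in B) F x y)%R%:E =
    \int[m1]_x \int[m2]_y G (x, y))%E.
  rewrite integral_mkcond; apply: eq_integral => x _; rewrite patchE.
  under eq_integral => y _ do rewrite GE1 patchE.
  case: ifPn => xI; last by rewrite integral0.
  rewrite -integral_mkcond /Rintegral fineK//.
  apply: integrable_fin_num => //.
  apply: (@measurable_bounded_integrable _ _ _ m2 (F x) B) => //.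
  - apply: (@measurable_comp _ _ _ _ _ _ D (fun p => F p.1 p.2) _ (pair x)) => //.
    by move=> _ [y yI <-]; split => //; exact/set_mem.
    by apply: (@measurable_funS _ _ _ _ setT) => //; exact: measurable_pair1.
  - exists C; split; rewrite ?num_real// => M CM y yB /=.
    apply: le_trans (ltW CM).
    by move: xI; rewrite inE => xI; exact: FC.
rewrite fubini {1}/Rintegral; congr fine.
rewrite [RHS]integral_mkcond; apply: eq_integral => y _; rewrite patchE.
under eq_integral => x _ do rewrite GE2 patchE.
case: ifPn => yI; last by rewrite integral0.
rewrite -integral_mkcond /Rintegral fineK//.
apply: integrable_fin_num => //.
apply: (@measurable_bounded_integrable _ _ _ m1 (F^~ y) A) => //.
- apply: (@measurable_comp _ _ _ _ _ _ D (fun p => F p.1 p.2) _ (fun x => (x, y))) => //.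
  by move=> _ [x xI <-]; split => //; exact/set_mem.
  by apply: (@measurable_funS _ _ _ _ setT) => //; exact: measurable_pair2.
- exists C; split; rewrite ?num_real// => M CM x xA /=.
  apply: le_trans (ltW CM).
  by move: yI; rewrite inE => yI; exact: FC.
Qed.

End fubini_bounded.

(** * Exchange of integrals over segments; measurability of kernels *)

Section fubini.
Context {R : realType}.
Implicit Types (a b c d x y : R) (f g h : R -> R) (F : R -> R -> R).
Notation mu := (@lebesgue_measure R).
Notation MR := (measurableTypeR R).

Lemma rint_swap a b c d F (C : R) :
  measurable_fun (`[a, b] `*` `[c, d] : set (MR * MR)) (fun p => F p.1 p.2) ->
  (forall x y, a <= x <= b -> c <= y <= d -> `|F x y| <= C) ->
  rint a b (fun x => rint c d (F x)) = rint c d (fun y => rint a b (F ^~ y)).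
Proof.
move=> mF FC.
have fin (r s : R) : (mu `[r, s]%classic < +oo)%E.
  by rewrite lebesgue_measure_itv/=; case: ifPn; rewrite ?ltry// -EFinB ltry.
apply: (@Rintegral_swap _ _ MR MR R mu mu _ _ F C) => //.
- exact: fin.
- exact: fin.
Qed.

Lemma cts_bounded a b f : cts a b f ->
  exists C, 0 <= C /\ forall x, a <= x <= b -> `|f x| <= C.
Proof.
move=> cf.
have : compact (f @` `[a, b]).
  apply: continuous_compact; first exact: cts_within.
  exact: segment_compact.
move=> /compact_bounded[M [_ MH]].
exists (Num.max (M + 1) 0); split; first by rewrite le_max lexx orbT.
move=> x xI; rewrite le_max; apply/orP; left.
by apply: MH; [rewrite ltrDl|exists x => //; rewrite /= in_itv].
Qed.

Lemma cts_measurable a b f : cts a b f ->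
  measurable_fun (`[a, b] : set MR) (f : MR -> R).
Proof.
by move=> /cts_integrable/integrableP[/measurable_EFinP].
Qed.

Lemma measurable_fst_cts a b c d f : cts a b f ->
  measurable_fun (`[a, b] `*` `[c, d] : set (MR * MR)) (fun p => f p.1).
Proof.
move=> /cts_measurable mf.
apply: (@measurable_comp _ _ _ _ _ _ `[a, b] f _ fst) => //.
- by move=> _ [[x y] [/= xI yI] <-].
- by apply: (@measurable_funS _ _ _ _ setT) => //; exact: measurable_fst.
Qed.

Lemma measurable_snd_cts a b c d f : cts c d f ->
  measurable_fun (`[a, b] `*` `[c, d] : set (MR * MR)) (fun p => f p.2).
Proof.
move=> /cts_measurable mf.
apply: (@measurable_comp _ _ _ _ _ _ `[c, d] f _ snd) => //.
- by move=> _ [[x y] [/= xI yI] <-].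
- by apply: (@measurable_funS _ _ _ _ setT) => //; exact: measurable_snd.
Qed.

(** Measurability refers to the product sigma-algebra; it is obtained by composing h with the sum
    and the difference of the projections. *)
Lemma measurable_convol h (D : set (MR * MR)) : measurable D -> continuous h ->
  measurable_fun D (fun p => h (p.1 - p.2)) /\
  measurable_fun D (fun p => h (p.1 + p.2)).
Proof.
move=> mD ch; have mh : measurable_fun setT (h : MR -> R).
  exact: continuous_measurable_fun.
split; apply: (@measurable_funS _ _ _ _ setT) => //;
  apply: measurableT_comp => //.
- by apply: measurable_funB; [exact: measurable_fst|exact: measurable_snd].
- by apply: measurable_funD; [exact: measurable_fst|exact: measurable_snd].
Qed.

End fubini.

(** * Functions of (x, t) that are regular up to t = 0 *)

Section spacetime.
Context {R : realType}.
Implicit Types (a b c s t x y T : R) (f fx ft : R -> R -> R).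

(** The time derivative is asked for only at t > 0, where it is two-sided; at t = 0 the continuity
    of [ft] is kept, which is what the bounds over [0, T] use. *)
Definition C1_spacetime f fx ft := [/\ C0_spacetime f,
  C0_spacetime fx, C0_spacetime ft,
  forall x t, 0 <= t -> is_derive x 1 (f ^~ t) (fx x t) &
  forall x t, 0 < t -> is_derive t 1 (f x) (ft x t)].

Lemma near_ge a x : a < x -> \forall y \near x, a <= y.
Proof.
move=> ax; near=> y; suff : `|x - y| <= x - a by rewrite ler_norml; lra.
near: y; apply: (@cvgr_dist_le _ R^o _ (nbhs x) _ id x cvg_id).
by rewrite subr_gt0.
Unshelve. all: end_near. Qed.

Lemma cvg_within_comp (T U V : topologicalType) (D : set T) (E : set U)
    (phi : T -> U) (h : U -> V) (p : T) (l : V) :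
  phi q @[q --> p] --> phi p -> (forall q, D q -> E (phi q)) ->
  h z @[z --> within E (nbhs (phi p))] --> l ->
  h (phi q) @[q --> within D (nbhs p)] --> l.
Proof.
move=> cphi DE ch B HB.
have H1 : nbhs (phi p) (fun z => E z -> B (h z)) := ch B HB.
have H2 : nbhs p (fun q => E (phi q) -> B (h (phi q))) := cphi _ H1.
exact: (filterS (fun q Hq Dq => Hq (DE q Dq)) H2).
Qed.

Lemma C0_compl f (g : R -> R) : continuous g -> C0_spacetime f ->
  C0_spacetime (fun x t => f (g x) t).
Proof.
move=> cg /subspace_continuousP cf; apply/subspace_continuousP => p p0.
have gp : (g q.1, q.2) @[q --> nbhs p] --> (g p.1, p.2).
  apply: (@cvg_pair _ _ _ (nbhs p) (nbhs (g p.1)) (nbhs p.2)) => /=; last exact: cvg_snd.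
  by apply: cvg_comp; [exact: cvg_fst|exact: cg].
apply: (cvg_within_comp (phi := fun q => (g q.1, q.2))
  (h := fun p => f p.1 p.2) (p := p) gp _ (cf (g p.1, p.2) p0)) => //.
Qed.

Lemma C0_slicex f t : C0_spacetime f -> 0 <= t -> continuous (f ^~ t).
Proof.
move=> /subspace_continuousP cf t0 x.
have H : (y, t) @[y --> x] --> (x, t).
  by apply: (@cvg_pair _ _ _ (nbhs x) (nbhs x) (nbhs t)) => //=; exact: cvg_cst.
move=> B HB.
have {}H : nbhs x (fun y => [set: R] y -> B (f y t)) :=
  cvg_within_comp (phi := fun y => (y, t)) (h := fun p => f p.1 p.2) (p := x)
    (D := setT) H (fun=> fun=> t0) (cf (x, t) t0) HB.
exact: (filterS (fun y Hy => Hy I) H).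
Qed.

Lemma C0_slicet f x s T : C0_spacetime f -> 0 <= s ->
  {within `[s, T], continuous (f x)}.
Proof.
move=> /subspace_continuousP cf s0; apply/subspace_continuousP => t.
rewrite /= in_itv/= => /andP[st tT].
have t0 : 0 <= (x, t).2 by exact: le_trans st.
have H : (x, r) @[r --> t] --> (x, t).
  by apply: (@cvg_pair _ _ _ (nbhs t) (nbhs x) (nbhs t)) => //=; exact: cvg_cst.
apply: (cvg_within_comp (phi := fun r => (x, r))
  (h := fun p => f p.1 p.2) (p := t) H _ (cf (x, t) t0)) => r /=.
by rewrite in_itv/= => /andP[sr _]; exact: le_trans sr.
Qed.

Lemma C0_bounded f a b T : C0_spacetime f ->
  exists C, 0 <= C /\ forall x t, a <= x <= b -> 0 <= t <= T -> `|f x t| <= C.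
Proof.
move=> cf.
have K : compact (`[a, b] `*` `[0, T] : set (R * R)).
  by apply: compact_setX; exact: segment_compact.
have : compact ((fun p : R * R => f p.1 p.2) @` (`[a, b] `*` `[0, T])).
  apply: continuous_compact => //.
  apply: continuous_subspaceW cf => -[x t] [/= _].
  by rewrite in_itv/= => /andP[].
move=> /compact_bounded[M [_ MH]].
exists (Num.max (M + 1) 0); split; first by rewrite le_max lexx orbT.
move=> x t xI tI; rewrite le_max; apply/orP; left.
apply: MH; first by rewrite ltrDl.
by exists (x, t) => //=; split; rewrite /= in_itv.
Qed.

Lemma C1_spacetime_of_Ck f k : Ck_spacetime k.+1 f -> C1_spacetime f (dx f) (dt f).
Proof.
move=> /= [f0 fx ft Cx Ct]; split => //.
- by case: k Cx {Ct} => [|k] // [].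
- by case: k Ct {Cx} => [|k] // [].
- by move=> x t t0; apply: DeriveDef; [exact: fx|rewrite /dx derive1E].
move=> x t t0.
(* At t > 0 the constraint 0 <= t + h holds for all small h, so the one-sided filter is the full
   punctured neighbourhood. *)
have E : dt_filter t = 0^'.
  apply/seteqP; split => A; rewrite /dt_filter /within/= => H.
    near=> h; apply: (near H h) => //.
    suff : `|h| <= t by rewrite ler_norml; lra.
    by near: h; exact: (@dnbhs0_le _ R^o).
  by near=> h => _; exact: (near H h).
have H := ft x t (ltW t0).
have D : (fun h : R => h^-1 *: (f x (h *: 1 + t) - f x t)) = dt_quot f x t.
  by apply: funext => h; rewrite scaler1 /dt_quot (addrC h).
apply: DeriveDef.
  by rewrite /derivable /= D -E.
by rewrite /derive /dt E -D.
Unshelve. all: end_near. Qed.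

Lemma C1_bounded f fx ft a b T : C1_spacetime f fx ft ->
  exists C, [/\ 0 <= C,
   forall x t, a <= x <= b -> 0 <= t <= T -> `|f x t| <= C,
   forall x t, a <= x <= b -> 0 <= t <= T -> `|fx x t| <= C &
   forall x t, a <= x <= b -> 0 <= t <= T -> `|ft x t| <= C].
Proof.
move=> [f0 fx0 ft0 _ _].
have [A [A0 HA]] := C0_bounded a b T f0.
have [B [B0 HB]] := C0_bounded a b T fx0.
have [C [C0 HC]] := C0_bounded a b T ft0.
exists (A + B + C); split; first by rewrite !addr_ge0.
- by move=> x t xI tI; have := HA x t xI tI; lra.
- by move=> x t xI tI; have := HB x t xI tI; lra.
- by move=> x t xI tI; have := HC x t xI tI; lra.
Qed.

Lemma C1_tdiff f fx ft a b s T : 0 <= s -> C1_spacetime f fx ft ->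
  tdiff a b s T f ft.
Proof.
move=> s0 Cf; have [f0 fx0 ft0 dfx dft] := Cf; split.
- move=> t /andP[st _]; apply: continuous_cts.
  by apply: C0_slicex => //; exact: le_trans st.
- by move=> x _; exact: C0_slicet.
- by move=> x t _ /andP[st _]; apply: dft; exact: le_lt_trans st.
- have [C [C0 HC _ HCt]] := C1_bounded a b T Cf.
  exists C; split=> x t xI /andP[st tT].
    by apply: HC => //; rewrite tT (le_trans s0 st).
  by apply: HCt => //; rewrite (ltW tT) (le_trans s0 (ltW st)).
Qed.

Lemma C1_opp f fx ft : C1_spacetime f fx ft ->
  C1_spacetime (fun x t => f (- x) t) (fun x t => - fx (- x) t)
    (fun x t => ft (- x) t).
Proof.
move=> [f0 fx0 ft0 dfx dft].
have cN : continuous (@GRing.opp R) by exact: opp_continuous.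
split.
- exact: C0_compl cN f0.
- have := C0_compl cN fx0 => /subspace_continuousP H.
  by apply/subspace_continuousP => p p0; apply: cvgN; exact: H.
- exact: C0_compl cN ft0.
- move=> x t t0; have H := dfx (- x) t t0.
  apply: (isd_eq (isd_comp (isdN (isd_id x)) H)); ring.
- by move=> x t t0; exact: dft.
Qed.

Lemma C1_neg f fx ft : C1_spacetime f fx ft ->
  C1_spacetime (fun x t => - f x t) (fun x t => - fx x t)
    (fun x t => - ft x t).
Proof.
move=> [f0 fx0 ft0 dfx dft].
have N g : C0_spacetime g -> C0_spacetime (fun x t => - g x t).
  move=> /subspace_continuousP H.
  by apply/subspace_continuousP => p p0; apply: cvgN; exact: H.
split; [exact: N..| |].
- by move=> x t t0; apply: isdN; exact: dfx.
- by move=> x t t0; apply: isdN; exact: dft.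
Qed.

(* The mixed partial derivative is identified by differentiating
   f(b,t) - f(a,t) = \int_a^b fx(x,t) dx in t. *)
Lemma mixed_partial f fx ft fxx fxt : C1_spacetime f fx ft ->
  C1_spacetime fx fxx fxt ->
  forall x t, 0 < t -> is_derive x 1 (ft ^~ t) (fxt x t).
Proof.
move=> Cf Cfx x t t0.
have [f0 fx0 ft0 dfx dft] := Cf; have [_ fxx0 fxt0 _ dfxt] := Cfx.
have t1 : t < t + 1 by rewrite ltrDl.
pose a := x - 1.
have ftE y : a <= y -> ft y t = ft a t + rint a y (fxt ^~ t).
  move=> ay.
  have [_ H] := tdiff_rint ay (C1_tdiff a y (t + 1) (lexx 0) Cfx).
  have tI : 0 < t < t + 1 by rewrite t0.
  have {}H := H t tI.
  have H2 := isdB (dft y t t0) (dft a t t0).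
  have E : \forall r \near t, rint a y (fx ^~ r) = f y r - f a r.
    near=> r; have r0 : 0 <= r by near: r; exact: near_ge.
    apply: (@rint_FTC _ a y _ (f ^~ r)) => //.
      by move=> z _; exact: dfx.
    by apply: continuous_cts; exact: C0_slicex.
  have -> : rint a y (fxt ^~ t) = ft y t - ft a t.
    rewrite -(@derive_val _ _ _ _ _ _ _ H) -(@derive_val _ _ _ _ _ _ _ H2).
    exact: near_eq_derive.
  by ring.
have cxt : continuous (fxt ^~ t) by apply: C0_slicex => //; exact: ltW.
have x1 : x < x + 1 by rewrite ltrDl.
have ax : a < x by rewrite /a ltrBlDr ltrDl.
have [D1 D2] := @continuous_FTC1_closed R (fxt ^~ t) a x (x + 1) x1
  (cts_integrable (continuous_cts cxt)) ax (cxt x).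
have HF : is_derive x 1 (fun y => rint a y (fxt ^~ t)) (fxt x t).
  by apply: DeriveDef; [exact: D1|rewrite -derive1E; exact: D2].
have HG := isd_eq (isdD (isd_cst x (ft a t)) HF) (add0r _).
have E : \forall y \near x, ft a t + rint a y (fxt ^~ t) = ft y t.
  by near=> y; rewrite -ftE//; near: y; exact: near_ge.
exact: near_eq_is_derive E HG.
Unshelve. all: end_near. Qed.

End spacetime.

(** * Vanishing criteria and propagation of sign under transport *)

Section tools.
Context {R : realType}.
Implicit Types (a b c s t x y T : R) (f g u : R -> R).

(** A positive value f x would give f >= f x / 2 on an interval [c, d] around x clipped to [a, b],
    which still has positive length because a < b. *)
Lemma rint_eq0 a b f : a < b -> cts a b f ->
  (forall x, a <= x <= b -> 0 <= f x) -> rint a b f <= 0 ->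
  forall x, a <= x <= b -> f x = 0.
Proof.
move=> ab cf f0 If x xI.
apply/eqP; rewrite eq_le f0// andbT leNgt; apply/negP => fx.
have [e e0 He] : exists2 e : R, 0 < e &
    forall y, `|x - y| <= e -> f x / 2 <= f y.
  have fx2 : 0 < f x / 2 by rewrite divr_gt0.
  have /cvgrPdist_le/(_ _ fx2)/nbhs_ballP[e /= e0 He] := cf x xI.
  exists (e / 2); first by rewrite divr_gt0.
  move=> y xy; have := He y; rewrite /ball/= => /(_ _)/=.
  have -> : `|x - y| < e by apply: le_lt_trans xy _; rewrite ltr_pdivrMr// mulr2n mulrDr mulr1 ltrDl.
  move=> /(_ isT); rewrite ler_norml => /andP[_]; lra.
have /andP[ax xb] := xI.
pose c := Num.max a (x - e); pose d := Num.min b (x + e).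
have ac : a <= c by rewrite le_max lexx.
have db : d <= b by rewrite ge_min lexx.
have cx : c <= x by rewrite ge_max ax/= lerBlDr lerDl ltW.
have xd : x <= d by rewrite le_min xb/= lerDl ltW.
have cd : c < d by rewrite lt_min !gt_max ab/=; apply/and3P; split; lra.
have ic := cts_integrable cf.
have cb : c <= b by exact: le_trans (ltW cd) db.
have E1 : rint a b f = rint a c f + rint c b f by apply: rint_split => //; rewrite ac.
have E2 : rint c b f = rint c d f + rint d b f.
  apply: rint_split; first by rewrite (ltW cd).
  by apply: cts_integrable; exact: ctsS cf.
have P1 : 0 <= rint a c f.
  by apply: rint_ge0 => y /andP[ay yc]; rewrite f0// ay (le_trans yc cb).
have P2 : 0 <= rint d b f.
  apply: rint_ge0 => y /andP[dy yb]; rewrite f0// yb andbT.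
  by rewrite (le_trans ac)// (le_trans (ltW cd)).
have P3 : f x / 2 * (d - c) <= rint c d f.
  rewrite -(rint_cst _ (ltW cd)).
  apply: le_rint; [exact: cts_cst|exact: ctsS cf|].
  move=> y /andP[cy yd]; apply: He; rewrite ler_norml.
  have : x - e <= y by apply: le_trans cy; rewrite le_max lexx orbT.
  have : y <= x + e by apply: le_trans yd _; rewrite ge_min lexx orbT.
  by lra.
have : 0 < f x / 2 * (d - c) by rewrite mulr_gt0 ?divr_gt0// subr_gt0.
by lra.
Qed.

(** Handles the points where a formula changes: [negsq] at 0, the flat functions at 0, and products
    g * w at the singularity of the weight. *)
Lemma is_derive_quadratic f x (C e : R) : 0 < e -> f x = 0 ->
  (forall y, `|y - x| < e -> `|f y| <= C * (y - x) ^+ 2) ->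
  is_derive x 1 f 0.
Proof.
move=> e0 fx0 H.
have K : h^-1 *: (f (h *: 1 + x) - f x) @[h --> 0^'] --> (0 : R).
  apply/cvgrPdist_le => r r0; near=> h.
  rewrite sub0r normrN scaler1 fx0 subr0.
  have h0 : h != 0 by near: h; exact: nbhs_dnbhs_neq.
  have he : `|h| < e by near: h; exact: (@dnbhs0_lt _ R^o).
  have hr : (`|C| + 1) * `|h| <= r.
    rewrite mulrC -ler_pdivlMr; last by have := normr_ge0 C; lra.
    near: h; apply: (@dnbhs0_le _ R^o).
    by rewrite divr_gt0//; have := normr_ge0 C; lra.
  apply: le_trans hr; rewrite normrM normfV.
  have := H (h + x); rewrite addrK => /(_ he) Hh.
  rewrite ler_pdivrMl ?normr_gt0//; apply: le_trans Hh _.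
  have -> : `|h| * ((`|C| + 1) * `|h|) = (`|C| + 1) * h ^+ 2.
    by rewrite mulrCA -expr2 real_normK ?num_real.
  apply: ler_wpM2r; first exact: sqr_ge0.
  by have := ler_norm C; lra.
apply: DeriveDef; first by apply/cvg_ex; exists 0; exact: K.
exact: cvg_lim K.
Unshelve. all: end_near. Qed.

Definition negsq (x : R) : R := Num.min x 0 ^+ 2.

Lemma negsq_ge0 x : 0 <= negsq x. Proof. exact: sqr_ge0. Qed.

Lemma negsq_eq0 x : negsq x = 0 -> 0 <= x.
Proof.
move=> /eqP; rewrite sqrf_eq0 => /eqP; by case: (leP x 0) => [x0 ->|/ltW].
Qed.

Lemma is_derive_negsq x : is_derive x 1 negsq (2 * Num.min x 0).
Proof.
have [x0|x0|->] := ltgtP x 0.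
- have H := isd_sqr (isd_id x); rewrite mulr1 in H.
  apply: near_eq_is_derive H.
  near=> y; rewrite /negsq min_l//; apply: ltW; near: y.
  exact: (@cvgr_lt _ _ _ _ id x cvg_id).
- rewrite mulr0; apply: near_eq_is_derive (isd_cst x 0).
  near=> y; rewrite /negsq min_r ?expr0n//; near: y; exact: near_ge.
- rewrite mulr0; apply: (@is_derive_quadratic _ _ 1 1) => //.
    by rewrite /negsq minxx expr0n.
  move=> y _; rewrite subr0 mul1r /negsq normrX real_normK ?num_real//.
  by case: (leP y 0) => y0; [exact: lexx|rewrite expr0n/= sqr_ge0].
Unshelve. all: end_near. Qed.

Lemma continuous_min0 : continuous (fun x : R => Num.min x 0).
Proof.
move=> x; apply: (@continuous_min _ _ (fun y : R => y) (fun=> 0)).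
  exact: cvg_id.
exact: cst_continuous.
Qed.

(* Energy estimate for the negative part: N = \int_a^b min(f,0)^2 satisfies
   N' <= C N. *)
Lemma transport_nonneg a b T (kappa A : R) (f fx ft u ux src : R -> R -> R) :
  a < b -> `|kappa| <= 1 -> C1_spacetime f fx ft ->
  (forall x t, a <= x <= b -> 0 < t < T -> is_derive x 1 (u ^~ t) (ux x t)) ->
  (forall t, 0 < t < T -> cts a b (ux ^~ t)) ->
  (forall t, 0 < t < T -> cts a b (src ^~ t)) ->
  (forall x t, a <= x <= b -> 0 < t < T -> `|ux x t| <= A) ->
  (forall x t, a <= x <= b -> 0 < t < T ->
    ft x t + u x t * fx x t + kappa * ux x t * f x t = src x t) ->
  (forall x t, a <= x <= b -> 0 < t < T -> 0 <= src x t) ->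
  (forall t, 0 < t < T -> u a t * negsq (f a t) <= u b t * negsq (f b t)) ->
  (forall x, a <= x <= b -> 0 <= f x 0) ->
  forall x t, a <= x <= b -> 0 <= t <= T -> 0 <= f x t.
Proof.
move=> ab k1 Cf du cux csrc uxA eqf src0 bd f0.
have [f00 fx00 ft00 dfx dft] := Cf.
pose P x t := negsq (f x t).
pose Pt x t := 2 * Num.min (f x t) 0 * ft x t.
have cx t : 0 <= t -> cts a b (f ^~ t).
  by move=> t0; apply: continuous_cts; exact: C0_slicex.
have dPx x t : 0 < t -> is_derive x 1 (P ^~ t) (2 * Num.min (f x t) 0 * fx x t).
  by move=> t0; exact: isd_comp (dfx x t (ltW t0)) (is_derive_negsq _).
have dPt x t : 0 < t -> is_derive t 1 (P x) (Pt x t).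
  by move=> t0; exact: isd_comp (dft x t t0) (is_derive_negsq _).
have cnegsq : continuous negsq.
  by move=> x; exact: is_derive_continuous (is_derive_negsq x).
have [C [C0 fC _ ftC]] := C1_bounded a b T Cf.
have minC y : `|y| <= C -> `|Num.min y 0| <= C.
  by move=> yC; case: (leP y 0) => // _; rewrite normr0.
have tP : tdiff a b 0 T P Pt.
  split.
  - by move=> t /andP[t0 _]; apply: cts_comp => //; exact: cx.
  - move=> x xI t; apply: (@continuous_comp _ _ _ (f x : subspace _ -> R) negsq).
      exact: C0_slicet.
    exact: cnegsq.
  - by move=> x t _ /andP[t0 _]; exact: dPt.
  - exists (C ^+ 2 + 2 * C * C); split=> x t xI tI.
      rewrite /P /negsq normrX.
      have := minC _ (fC x t xI tI) => H.
      have : `|Num.min (f x t) 0| ^+ 2 <= C ^+ 2 by rewrite lerXn2r// nnegrE.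
      by have := mulr_ge0 C0 C0; nra.
    rewrite /Pt !normrM (ger0_norm (ler0n _ 2)).
    have tI' : 0 <= t <= T by case/andP: tI => ? ?; rewrite !ltW.
    have H1 := minC _ (fC x t xI tI'); have H2 := ftC x t xI tI'.
    have := ler_pM (normr_ge0 _) (normr_ge0 _) H1 H2.
    by have := sqr_ge0 C; rewrite -mulrA; nra.
have [cN dN] := tdiff_rint (ltW ab) tP.
pose N t := rint a b (P ^~ t).
have A0 : 0 <= `|A| by [].
(* Of the 3, two come from the term kappa ux f and one from ux after integrating the transport term
   by parts; the boundary terms have the sign assumed on u at a and b. *)
have NN t : 0 < t < T -> rint a b (Pt ^~ t) <= 3 * `|A| * N t + 0.
  move=> tI; have /andP[t0 tT] := tI; have t0' := ltW t0.
  have cP : cts a b (P ^~ t) by apply: cts_comp => //; exact: cx.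
  have cfx : cts a b (fx ^~ t) by apply: continuous_cts; exact: C0_slicex.
  have cm : cts a b (fun x => 2 * Num.min (f x t) 0).
    by apply: ctsZ; exact: cts_comp (cx t t0') continuous_min0.
  have cu : cts a b (u ^~ t).
    by apply: (is_derive_cts (df := ux ^~ t)) => x xI; exact: du.
  have parts := @rint_parts R a b (u ^~ t) (P ^~ t) (ux ^~ t)
    (fun x => 2 * Num.min (f x t) 0 * fx x t) (ltW ab)
    (fun x xI => du x t xI tI) (fun x _ => dPx x t t0) (cux t tI)
    (ctsM cm cfx).
  rewrite addr0.
  apply: (@le_trans _ _ (rint a b (fun x =>
     - (u x t * (2 * Num.min (f x t) 0 * fx x t)) + 2 * `|A| * P x t))).
    have cft : cts a b (ft ^~ t) by apply: continuous_cts; exact: C0_slicex.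
    apply: le_rint.
    - exact: ctsM.
    - apply: ctsD; last exact: ctsZ.
      by apply: ctsN; apply: ctsM => //; exact: ctsM.
    - move=> x xI; rewrite /Pt /P /negsq.
      set m := Num.min _ _.
      have m0 : m <= 0 by rewrite ge_min lexx orbT.
      have mf : m * f x t = m ^+ 2.
        by rewrite /m; case: (leP (f x t) 0) => _; [rewrite expr2|rewrite mul0r expr0n].
      have -> : ft x t = src x t - u x t * fx x t - kappa * ux x t * f x t.
        by rewrite -(eqf x t xI tI); ring.
      have H1 : - (kappa * ux x t) <= `|A|.
        apply: le_trans (ler_norm _) _; rewrite normrN normrM.
        have := uxA x t xI tI => uA.
        have := ler_pM (normr_ge0 _) (normr_ge0 _) k1 uA.
        by rewrite mul1r => /le_trans; apply; exact: ler_norm.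
      have H2 := src0 x t xI tI.
      have -> : 2 * m * (src x t - u x t * fx x t - kappa * ux x t * f x t) =
         2 * (m * src x t) - u x t * (2 * m * fx x t)
         + 2 * (- (kappa * ux x t)) * (m * f x t) by ring.
      rewrite mf.
      have H3 : m * src x t <= 0 by rewrite mulr_le0_ge0.
      have H4 := ler_wpM2r (sqr_ge0 m) H1.
      by nra.
  rewrite rintD; last exact: ctsZ; last first.
    by apply: ctsN; apply: ctsM => //; exact: ctsM.
  rewrite rintN; last by apply: ctsM => //; exact: ctsM.
  rewrite rintZ// parts.
  have : rint a b (fun x => ux x t * P x t) <= `|A| * N t.
    rewrite -rintZ//; apply: le_rint; [|exact: ctsZ|].
      by apply: ctsM => //; exact: cux.
    move=> x xI; apply: ler_wpM2r; first exact: negsq_ge0.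
    apply: le_trans (ler_norm _) _; apply: le_trans (uxA x t xI tI) _.
    exact: ler_norm.
  have := bd t tI; rewrite /N /P.
  by lra.
have N0 : N 0 <= 0.
  have -> : N 0 = rint a b (fun=> 0).
    apply: eq_rint => x xI; rewrite /P /negsq min_r ?expr0n//; exact: f0.
  by rewrite (rint_cst _ (ltW ab)) mul0r.
have AA : 0 <= 3 * `|A| by lra.
have G := gronwall AA (lexx 0) cN dN NN N0.
move=> x t xI tI; apply: negsq_eq0.
have t0 : 0 <= t by case/andP: tI.
apply: (rint_eq0 ab (f := P ^~ t)) => //.
- by apply: cts_comp => //; exact: cx.
- by move=> y _; exact: negsq_ge0.
- by have := G t tI; rewrite !mul0r; exact.
Qed.

End tools.

(** * Convolutions, Schur's test, limits in [lam], blow-up of a differential system *)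

Section tools2.
Context {R : realType}.
Implicit Types (a b c s t x y T : R) (f g k : R -> R).
Notation mu := (@lebesgue_measure R).
Notation MR := (measurableTypeR R).

Lemma continuous_subr k x : continuous k -> continuous (fun y => k (x - y)).
Proof.
move=> ck y; apply: (@continuous_comp _ _ _ (fun y => x - y) k); last exact: ck.
exact: is_derive_continuous (isdB (isd_cst y x) (isd_id y)).
Qed.

Lemma continuous_subl k y : continuous k -> continuous (fun x => k (x - y)).
Proof.
move=> ck x; apply: (@continuous_comp _ _ _ (fun x => x - y) k); last exact: ck.
exact: is_derive_continuous (isdB (isd_id x) (isd_cst x y)).
Qed.

Lemma convol_continuous a b f k : cts a b f -> continuous k ->
  continuous (fun x => rint a b (fun y => f y * k (x - y))).
Proof.
move=> cf ck x.
have [F [F0 HF]] := cts_bounded cf.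
have [K [K0 HK]] := cts_bounded (continuous_cts (a := x - 1 - b) (b := x + 1 - a) ck).
have cxy z : cts a b (fun y => f y * k (z - y)).
  by apply: ctsM => //; apply: continuous_cts; exact: continuous_subr.
have H := @continuity_under_integral R _ _ mu (fun x y => f y * k (x - y))
  `[a, b] (measurable_itv _) (x - 1) (x + 1).
apply: (H _ _ (fun=> F * K)) => //.
- by move=> z _; apply: cts_integrable; exact: cxy.
- apply: aeW => y _ z _; apply: continuousM; first exact: cst_continuous.
  exact: continuous_subl.
- by apply: (@cts_integrable R a b (fun=> F * K)); exact: cts_cst.
- move=> z; rewrite /= in_itv/= => /andP[z1 z2]; apply: aeW => y.
  rewrite /= in_itv/= => yI; rewrite normrM; apply: ler_pM => //.
    exact: HF.
  by apply: HK; case/andP: yI => ? ?; apply/andP; split; lra.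
- by rewrite inE/= in_itv/=; apply/andP; split; lra.
Qed.

Lemma rint_convol_swap a b k f : cts a b f -> continuous k ->
  rint a b (fun x => rint a b (fun y => f y * k (x - y))) =
  rint a b (fun y => rint a b (fun x => f y * k (x - y))).
Proof.
move=> cf ck; have [F [F0 HF]] := cts_bounded cf.
have [K [K0 HK]] := cts_bounded (continuous_cts (a := a - b) (b := b - a) ck).
apply: (@rint_swap R a b a b (fun x y => f y * k (x - y)) (F * K)).
  apply: measurable_funM; first exact: measurable_snd_cts.
  have mD : measurable (`[a, b] `*` `[a, b] : set (MR * MR)) by exact: measurableX.
  exact: (measurable_convol mD ck).1.
move=> x y /andP[x1 x2] yI; rewrite normrM; apply: ler_pM => //; first exact: HF.
by apply: HK; case/andP: yI => ? ?; apply/andP; split; lra.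
Qed.

(** From 2 |f| |g| <= f^2 + g^2 under the double integral; since k is even, the bound on its row
    integrals also bounds its column integrals. *)
Lemma schur a b f g k (K : R) : cts a b f -> cts a b g -> continuous k ->
  (forall z, k (- z) = k z) -> (forall z, 0 <= k z) ->
  (forall x, a <= x <= b -> rint a b (fun y => k (x - y)) <= K) ->
  rint a b (fun x => `|f x| * rint a b (fun y => `|g y| * k (x - y))) <=
  K / 2 * (rint a b (fun x => f x ^+ 2) + rint a b (fun x => g x ^+ 2)).
Proof.
move=> cf cg ck ek k0 kK.
have cf2 : cts a b (fun x => f x ^+ 2).
  by move=> x xI; apply: (@continuousM _ _ f f x); exact: cf.
have cg2 : cts a b (fun x => g x ^+ 2).
  by move=> x xI; apply: (@continuousM _ _ g g x); exact: cg.
have ckx x : cts a b (fun y => k (x - y)).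
  by apply: continuous_cts; exact: continuous_subr.
have cC h : cts a b h -> cts a b (fun x => rint a b (fun y => h y * k (x - y))).
  by move=> ch; apply: continuous_cts; exact: convol_continuous.
have c1 := cC _ (@cts_cst R a b 1).
have E1 x : rint a b (fun y => 1 * k (x - y)) = rint a b (fun y => k (x - y)).
  by apply: eq_rint => y _; rewrite mul1r.
apply: (@le_trans _ _ (rint a b (fun x =>
   2^-1 * (f x ^+ 2 * rint a b (fun y => 1 * k (x - y)) +
          rint a b (fun y => g y ^+ 2 * k (x - y)))))).
  apply: le_rint.
  - by apply: ctsM; [exact: cts_norm|apply: cC; exact: cts_norm].
  - apply: ctsZ; apply: ctsD; last exact: cC.
    by apply: ctsM.
  - move=> x xI.
    have cgk : cts a b (fun y => `|g y| * k (x - y)).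
      by apply: ctsM => //; exact: cts_norm.
    have cgk2 : cts a b (fun y => g y ^+ 2 * k (x - y)) by exact: ctsM.
    have cfk : cts a b (fun y => f x ^+ 2 * k (x - y)) by exact: ctsZ.
    rewrite -(rintZ _ cgk) E1 -(rintZ _ (ckx x)) -(rintD cfk cgk2).
    rewrite -(rintZ _ (ctsD cfk cgk2)).
    apply: le_rint.
    + exact: ctsZ.
    + by apply: ctsZ; apply: ctsD => //; exact: ctsZ.
    + move=> y yI; have := k0 (x - y).
      rewrite -(real_normK (num_real (f x))) -(real_normK (num_real (g y))).
      set p := `|f x|; set q := `|g y|; set r := k _ => r0.
      have : 0 <= (p - q) ^+ 2 by exact: sqr_ge0.
      by nra.
rewrite rintZ; last by apply: ctsD; [exact: ctsM|exact: cC].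
rewrite rintD; [|exact: ctsM|exact: cC].
rewrite rint_convol_swap//.
have L1 : rint a b (fun x => f x ^+ 2 * rint a b (fun y => 1 * k (x - y))) <=
    K * rint a b (fun x => f x ^+ 2).
  rewrite -rintZ//; apply: le_rint; [exact: ctsM|exact: ctsZ|].
  move=> x xI; rewrite E1 mulrC; apply: ler_wpM2r; [exact: sqr_ge0|exact: kK].
have E2 : rint a b (fun y => rint a b (fun x => g y ^+ 2 * k (x - y))) =
    rint a b (fun y => g y ^+ 2 * rint a b (fun x => 1 * k (y - x))).
  apply: eq_rint => y yI; rewrite E1 -rintZ//; apply: eq_rint => x xI.
  by rewrite -ek opprB.
have L2 : rint a b (fun y => g y ^+ 2 * rint a b (fun x => 1 * k (y - x))) <=
    K * rint a b (fun x => g x ^+ 2).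
  rewrite -rintZ//; apply: le_rint; [exact: ctsM|exact: ctsZ|].
  move=> x xI; rewrite E1 mulrC; apply: ler_wpM2r; [exact: sqr_ge0|exact: kK].
by rewrite E2; lra.
Qed.

(** The form in which limits lam -> +oo are taken: exp(- lam) (1 + lam) <= 1 turns an exponential
    error into such a bound. *)
Lemma le0_of_linear_bound (y M : R) :
  (forall lam, 0 < lam -> y * (1 + lam) <= M) -> y <= 0.
Proof.
move=> H; rewrite leNgt; apply/negP => y0.
have M0 : 0 <= M by have := H 1 ltr01; nra.
have l0 : 0 < M / y + 1 by rewrite ltr_wpDl// divr_ge0// ltW.
have := H _ l0; rewrite !mulrDr mulrCA divff ?gt_eqF// !mulr1.
lra.
Qed.

Lemma expRN_le (lam : R) : 0 <= lam -> expR (- lam) * (1 + lam) <= 1.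
Proof.
move=> l0; have := expR_ge1Dx lam => H.
have := ler_wpM2l (expR_ge0 (- lam)) H.
by rewrite -expRD addNr expR0.
Qed.

(* The bound loses a logarithm: the rate A (1 + lam) grows while the error
   exp(- lam) decays, so Gronwall gives 0 on time steps of length 1/(2 A). *)
Lemma gronwall_log T (Y Y' : R -> R) (A : R) : 0 < A ->
  {within `[0, T], continuous Y} ->
  (forall t, 0 < t < T -> is_derive t 1 Y (Y' t)) ->
  (forall lam t, 0 < lam -> 0 < t < T ->
    Y' t <= A * (1 + lam) * Y t + A * expR (- lam)) ->
  Y 0 <= 0 ->
  forall t, 0 <= t <= T -> Y t <= 0.
Proof.
move=> A0 cY dY YY Y0.
pose tau := (2 * A)^-1.
have tau0 : 0 < tau by rewrite invr_gt0 mulr_gt0.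
have Atau : A * tau = 2^-1 by rewrite /tau invfM mulrCA divff ?mulr1// gt_eqF.
have step s : 0 <= s -> Y s <= 0 -> forall t, s <= t <= T -> t - s <= tau -> Y t <= 0.
  move=> s0 Ys t tI ts.
  apply: (@le0_of_linear_bound _ (expR 1)) => lam2 lam20.
  (* As A (t - s) <= 1/2, the Gronwall factor is at most exp((1 + lam) / 2), against a source of
     size exp(- lam); with lam = 2 lam2 a multiple of exp(- lam2) survives, and [lam2] is free. *)
  pose lam := 2 * lam2; have lam0 : 0 < lam by rewrite mulr_gt0.
  have sub r : s < r < T -> 0 < r < T.
    by move=> /andP[sr ->]; rewrite (le_lt_trans s0 sr).
  have G := @gronwall R s T Y Y' (A * (1 + lam)) (A * expR (- lam)).
  have {}G : Y t <= A * expR (- lam) * (t - s) * expR (A * (1 + lam) * (t - s)).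
    apply: G => //.
    - by apply: mulr_ge0; [exact: ltW|apply: addr_ge0 => //; exact: ltW].
    - by apply: mulr_ge0; [exact: ltW|exact: expR_ge0].
    - apply: continuous_subspaceW cY => r; rewrite /= !in_itv/= => /andP[sr ->].
      by rewrite (le_trans s0 sr).
    - by move=> r /sub; exact: dY.
    - by move=> r /sub rI; exact: YY.
  have st0 : 0 <= t - s by case/andP: tI => ? _; rewrite subr_ge0.
  have H1 : A * (t - s) <= 2^-1 by rewrite -Atau ler_wpM2l// ltW.
  have H2 : expR (A * (1 + lam) * (t - s)) <= expR (1 + lam2).
    rewrite ler_expR mulrAC.
    have l1 : 0 <= 1 + lam by rewrite addr_ge0// ltW.
    by apply: le_trans (ler_wpM2r l1 H1) _; rewrite /lam; lra.
  have H3 : Y t <= expR 1 * expR (- lam2).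
    apply: le_trans G _.
    have -> : A * expR (- lam) * (t - s) = A * (t - s) * expR (- lam) by ring.
    apply: (@le_trans _ _ (1 * expR (- lam) * expR (1 + lam2))).
      apply: ler_pM => //.
      + by apply: mulr_ge0; [apply: mulr_ge0 => //; exact: ltW|exact: expR_ge0].
      + by apply: ler_wpM2r; [exact: expR_ge0|lra].
    rewrite mul1r -!expRD ler_expR /lam; lra.
  have l2 : 0 <= 1 + lam2 by rewrite addr_ge0// ltW.
  apply: le_trans (ler_wpM2r l2 H3) _.
  rewrite -mulrA -[leRHS]mulr1 ler_wpM2l ?expR_ge0//.
  by apply: expRN_le; exact: ltW.
(* The step [tau] does not depend on [lam], so finitely many steps reach any time in [0, T]. *)
suff H n : forall t, 0 <= t <= T -> t <= tau * n%:R -> Y t <= 0.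
  move=> t tI; apply: (H (Num.bound (t / tau)) _ tI).
  rewrite mulrC -ler_pdivrMr//; apply: ltW; apply: archi_boundP.
  by case/andP: tI => ? _; rewrite divr_ge0// ltW.
elim: n => [|n IH] t tI tn.
  have -> : t = 0 by apply/eqP; rewrite eq_le; case/andP: tI => -> _; rewrite andbT -(mulr0 tau).
  exact: Y0.
have [tn'|tn'] := leP t (tau * n%:R); first exact: IH.
have s0 : 0 <= tau * n%:R by rewrite mulr_ge0// ltW.
have sT : tau * n%:R <= T by apply: le_trans (ltW tn') _; case/andP: tI.
apply: (step (tau * n%:R)) => //.
- by apply: IH => //; rewrite s0.
- by case/andP: tI => _ ->; rewrite ltW.
- by move: tn; rewrite -natr1 mulrDr mulr1; lra.
Qed.

Lemma MVT_lower s T (f df : R -> R) (m : R) : s <= T ->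
  {within `[s, T], continuous f} ->
  (forall t, s < t < T -> is_derive t 1 f (df t)) ->
  (forall t, s < t < T -> m <= df t) -> m * (T - s) <= f T - f s.
Proof.
rewrite le_eqVlt => /predU1P[->|sT] cf d1 dm; first by rewrite !subrr mulr0.
have H1 x : x \in `]s, T[ -> is_derive x 1 f (df x).
  by rewrite in_itv/=; exact: d1.
have [x] := MVT sT H1 cf; rewrite in_itv/= => xI ->.
by apply: ler_wpM2r; [rewrite subr_ge0 ltW|exact: dm].
Qed.

(* Along I' >= alpha J, J' >= beta I^2 the quantity I quadruples on successive
   intervals whose lengths halve. *)
Lemma ode_blowup T (alpha beta A : R) (I I' J J' : R -> R) :
  0 < alpha -> 0 < beta -> 0 < A ->
  4 * Num.sqrt (3 / (alpha * beta * A)) <= T ->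
  {within `[0, T], continuous I} -> {within `[0, T], continuous J} ->
  (forall t, 0 < t < T -> is_derive t 1 I (I' t)) ->
  (forall t, 0 < t < T -> is_derive t 1 J (J' t)) ->
  (forall t, 0 < t < T -> alpha * J t <= I' t) ->
  (forall t, 0 < t < T -> beta * I t ^+ 2 <= J' t) ->
  A <= I 0 -> 0 <= J 0 -> False.
Proof.
move=> al0 be0 A0 TT cI cJ dI dJ II JJ IA J0.
set q := Num.sqrt _ in TT.
have q0 : 0 < q by rewrite sqrtr_gt0 divr_gt0// !mulr_gt0.
(* The 3 makes the gain in one step three times the current value, hence the factor 4. *)
have q2 : alpha * beta * A * q ^+ 2 = 3.
  have p0 : 0 < alpha * beta * A by rewrite !mulr_gt0.
  by rewrite sqr_sqrtr ?divr_ge0// ?ltW// mulrC divfK// gt_eqF.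
have T0 : 0 <= T by apply: le_trans TT; rewrite mulr_ge0// ltW.
have sub (f : R -> R) s t : 0 <= s -> t <= T -> {within `[0, T], continuous f} ->
    {within `[s, t], continuous f}.
  move=> s0 tT; apply: continuous_subspaceW => x; rewrite /= !in_itv/= => /andP[sx xt].
  by rewrite (le_trans s0 sx) (le_trans xt tT).
have subo s t r : 0 <= s -> t <= T -> s < r < t -> 0 < r < T.
  by move=> s0 tT /andP[sr rt]; rewrite (le_lt_trans s0 sr) (lt_le_trans rt tT).
have Jge0 t : 0 <= t <= T -> 0 <= J t.
  move=> /andP[t0 tT]; apply: le_trans J0 _.
  apply: (nondecreasing_within cJ dJ) => // r rI; apply: le_trans (JJ r rI).
  by rewrite mulr_ge0 ?sqr_ge0// ltW.
have Imon s t : 0 <= s -> s <= t -> t <= T -> I s <= I t.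
  apply: (nondecreasing_within cI dI) => // r rI; apply: le_trans (II r rI).
  apply: mulr_ge0; first exact: ltW.
  by apply: Jge0; case/andP: rI => ? ?; rewrite !ltW.
(* An interval of length 2 d is used in two halves: on the first, J gains at least beta a^2 d; on
   the second, I gains at least alpha d times that. *)
have step s a d : 0 <= s -> 0 < a -> 0 <= d -> s + 2 * d <= T -> a <= I s ->
    a + alpha * beta * a ^+ 2 * d ^+ 2 <= I (s + 2 * d).
  move=> s0 a0 d0 sT aI.
  have sd : s + d <= T by lra.
  have H1 : beta * a ^+ 2 * (s + d - s) <= J (s + d) - J s.
    apply: (MVT_lower (df := J')); first lra.
    - exact: sub cJ.
    - by move=> r /(subo _ _ _ s0 sd); exact: dJ.
    - move=> r rI; have rI' := subo _ _ _ s0 sd rI; apply: le_trans (JJ r rI').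
      apply: ler_wpM2l; first exact: ltW.
      have aIr : a <= I r.
        by apply: le_trans aI _; apply: Imon => //; case/andP: rI => ? ?; lra.
      by rewrite lerXn2r ?nnegrE//; lra.
  have Js : 0 <= J s by apply: Jge0; apply/andP; split => //; lra.
  have H2 : alpha * (beta * a ^+ 2 * d) * (s + 2 * d - (s + d)) <= I (s + 2 * d) - I (s + d).
    have s0' : 0 <= s + d by lra.
    apply: (MVT_lower (df := I')); first lra.
    - exact: sub cI.
    - by move=> r /(subo _ _ _ s0' sT); exact: dI.
    - move=> r rI; have rI' := subo _ _ _ s0' sT rI; apply: le_trans (II r rI').
      apply: ler_wpM2l; first exact: ltW.
      have : J (s + d) <= J r.
        apply: (nondecreasing_within cJ dJ) => //.
        - by move=> z zI; apply: le_trans (JJ z zI); rewrite mulr_ge0 ?sqr_ge0// ltW.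
        - by case/andP: rI => ? ?; lra.
        - by case/andP: rI' => ? ?; lra.
      by lra.
  have H3 : I s <= I (s + d) by apply: Imon; lra.
  have -> : alpha * beta * a ^+ 2 * d ^+ 2 =
     alpha * (beta * a ^+ 2 * d) * (s + 2 * d - (s + d)) by ring.
  by lra.
(* The n-th step has half-length q 2^-n, so the times sum to 4 q (1 - 2^-n). Relative to the current
   value A 4^n, the gain is alpha beta A q^2 times 4^n from the square and 4^-n from the length,
   that is, always 3. *)
have grow n : A * 4 ^+ n <= I (4 * q * (1 - 2^-1 ^+ n)).
  elim: n => [|n IH]; first by rewrite !expr0 subrr mulr0 mulr1.
  have h0 : 0 < (2^-1 : R) ^+ n by rewrite exprn_gt0// invr_gt0.
  have h1 : (2^-1 : R) ^+ n <= 1 by rewrite exprn_ile1// ?invr_ge0// invf_le1// ler1n.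
  have f0 : 0 < (4 : R) ^+ n by rewrite exprn_gt0.
  have E : 4 * q * (1 - 2^-1 ^+ n.+1) = 4 * q * (1 - 2^-1 ^+ n) + 2 * (q * 2^-1 ^+ n).
    by rewrite exprS; field.
  have hh : (2^-1 : R) ^+ n * 2^-1 ^+ n * 4 ^+ n = 1.
    rewrite -!exprMn.
    have -> : (2^-1 * 2^-1 * 4 : R) = 1 by field.
    exact: expr1n.
  rewrite E; apply: le_trans (step _ (A * 4 ^+ n) _ _ _ _ _ IH).
  - have -> : alpha * beta * (A * 4 ^+ n) ^+ 2 * (q * 2^-1 ^+ n) ^+ 2 =
       (alpha * beta * A * q ^+ 2) * (A * 4 ^+ n) * (2^-1 ^+ n * 2^-1 ^+ n * 4 ^+ n) by ring.
    by rewrite hh q2 mulr1 exprS; lra.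
  - by rewrite mulr_ge0 ?subr_ge0// mulr_ge0// ltW.
  - by rewrite mulr_gt0.
  - by rewrite mulr_ge0// ltW.
  - rewrite -E; apply: le_trans TT; rewrite -[leRHS]mulr1; apply: ler_wpM2l.
      by rewrite mulr_ge0// ltW.
    by rewrite lerBlDr lerDl exprn_ge0// invr_ge0.
have IT n : A * 4 ^+ n <= I T.
  apply: le_trans (grow n) _; apply: Imon => //.
    rewrite mulr_ge0 ?subr_ge0//; first by rewrite mulr_ge0// ltW.
    by rewrite exprn_ile1// ?invr_ge0// invf_le1// ler1n.
  apply: le_trans TT; rewrite -[leRHS]mulr1; apply: ler_wpM2l.
    by rewrite mulr_ge0// ltW.
  by rewrite lerBlDr lerDl exprn_ge0// invr_ge0.
have IT0 : 0 <= I T / A.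
  by rewrite divr_ge0 ?ltW//; apply: lt_le_trans (IT 0%N); rewrite expr0 mulr1.
have := archi_boundP IT0; set n := Num.bound _ => Hn.
have := IT n; rewrite leNgt => /negP; apply.
rewrite mulrC -ltr_pdivrMr//; apply: lt_le_trans Hn _.
by rewrite -natrX ler_nat ltnW// ltn_expl.
Qed.

(** G is the tail of the integral of g, but [cts] wants two-sided continuity at a and b while g is
    uncontrolled outside [a, b]. So g is clamped by [cl], and the primitive starts at a - 1 so that
    the fundamental theorem also covers x = a. *)
Lemma rint_tail_parts a b (F f g : R -> R) : a < b ->
  (forall x, a <= x <= b -> is_derive x 1 F (f x)) -> cts a b f -> cts a b g ->
  exists2 G : R -> R, cts a b G & (forall x, a <= x <= b -> G x = rint x b g) /\
    rint a b (fun x => f x * G x) =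
    rint a b (fun x => F x * g x) - F a * rint a b g.
Proof.
move=> ab dF cf cg.
pose cl y := Num.max a (Num.min y b).
have clE y : a <= y <= b -> cl y = y.
  by move=> /andP[ay yb]; rewrite /cl min_l// max_r.
have clI y : a <= cl y <= b.
  by rewrite /cl le_max lexx/= ge_max (ltW ab)/= ge_min lexx orbT.
have ccl : continuous cl.
  move=> y; apply: (@continuous_max _ _ (fun=> a) (fun z => Num.min z b)).
    exact: cst_continuous.
  apply: (@continuous_min _ _ (fun z : R => z) (fun=> b)); first exact: cvg_id.
  exact: cst_continuous.
pose h y := g (cl y).
have ch : continuous h.
  by move=> y; apply: continuous_comp; [exact: ccl|exact: cg].
have hE y : a <= y <= b -> h y = g y by move=> yI; rewrite /h clE.
pose H x := rint (a - 1) x h.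
have dH x : a <= x <= b -> is_derive x 1 H (h x).
  move=> /andP[ax xb].
  have x1 : x < x + 1 by rewrite ltrDl.
  have a1 : a - 1 < x by lra.
  have [D1 D2] := @continuous_FTC1_closed R h (a - 1) x (x + 1) x1
    (cts_integrable (continuous_cts ch)) a1 (ch x).
  by apply: DeriveDef; [exact: D1|rewrite -derive1E; exact: D2].
have cH := is_derive_cts dH.
have tail x : a <= x <= b -> H b - H x = rint x b g.
  move=> xI; have /andP[ax xb] := xI.
  have -> : rint x b g = rint x b h.
    by apply: eq_rint => y /andP[xy yb]; rewrite hE// yb (le_trans ax xy).
  rewrite /H (@rint_split _ (a - 1) b x); first by rewrite addrC addKr.
    by rewrite xb andbT; lra.
  by apply: cts_integrable; exact: continuous_cts.
exists (fun x => H b - H x); first exact: (ctsB (@cts_cst _ a b (H b)) cH).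
split=> //.
have P := rint_parts (ltW ab) dF dH cf (continuous_cts ch).
have E1 : rint a b (fun x => F x * g x) = rint a b (fun x => F x * h x).
  by apply: eq_rint => x xI; rewrite hE.
have cHb : cts a b (fun x => f x * H b) := ctsM cf (@cts_cst _ a b (H b)).
have -> : rint a b (fun x => f x * (H b - H x)) =
    rint a b (fun x => H b * f x) - rint a b (fun x => f x * H x).
  rewrite -rintB; [|exact: ctsZ|exact: ctsM].
  by apply: eq_rint => x _; ring.
rewrite E1 P rintZ// (rint_FTC (ltW ab) dF cf) -(tail a) ?lexx ?ltW//.
by ring.
Qed.

End tools2.

(** * The model on [-l, l]: uniqueness and parity *)

Section abstract_problem.
Context {R : realType}.
Implicit Types (l x y z t T lam : R) (k f : R -> R).

Lemma C1_sub (f fx ft g gx gt : R -> R -> R) :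
  C1_spacetime f fx ft -> C1_spacetime g gx gt ->
  C1_spacetime (fun x t => f x t - g x t) (fun x t => fx x t - gx x t)
    (fun x t => ft x t - gt x t).
Proof.
move=> [f0 fx0 ft0 dfx dft] [g0 gx0 gt0 dgx dgt].
have B (h1 h2 : R -> R -> R) : C0_spacetime h1 -> C0_spacetime h2 ->
    C0_spacetime (fun x t => h1 x t - h2 x t).
  move=> /subspace_continuousP H1 /subspace_continuousP H2.
  by apply/subspace_continuousP => p p0; apply: cvgB; [exact: H1|exact: H2].
split; [exact: B..| |].
- by move=> x t t0; apply: isdB; [exact: dfx|exact: dgx].
- by move=> x t t0; apply: isdB; [exact: dft|exact: dgt].
Qed.

(** Here w and z are the differences of omega and theta_x for two solutions, v and vx those of u and
    u_x; u and a1 = u_x belong to the first solution, a2, a3, a4 are omega_x, theta_x, theta_xx of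
    the second. The left side is the time derivative of w^2 + z^2. On the right the transport term
    is set apart for integration by parts, and Q, a convolution of |w|, is kept for Schur's test. *)
Lemma energy_pointwise (A KS e Q w z wx zx u v vx a1 a2 a3 a4 : R) :
  0 <= A -> 0 <= KS -> 0 <= e ->
  `|a1| <= A -> `|a2| <= A -> `|a3| <= A -> `|a4| <= A ->
  `|v| <= KS + e -> `|vx| <= Q + e ->
  (- (u * wx) - v * a2 + z) * w + w * (- (u * wx) - v * a2 + z) +
  ((- (u * zx) - v * a4 - a1 * z - vx * a3) * z +
   z * (- (u * zx) - v * a4 - a1 * z - vx * a3)) <=
  - (u * (wx * w + w * wx + (zx * z + z * zx))) +
  ((2 * A + 1) * (w * w + z * z) +
   (2 * A * (KS + 2 * e) * (`|w| + `|z|) + 2 * A * (`|z| * Q))).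
Proof.
move=> A0 KS0 e0 h1 h2 h3 h4 v1 v2.
have T1 : - (a1 * z * z) <= A * (z * z).
  rewrite -mulrA -mulNr; apply: ler_wpM2r; first by rewrite -expr2 sqr_ge0.
  by apply: le_trans (ler_norm _) _; rewrite normrN.
have T (r a y B : R) : `|r| <= B -> `|a| <= A -> - (r * a * y) <= B * A * `|y|.
  move=> rB aA; apply: le_trans (ler_norm _) _; rewrite normrN !normrM.
  by apply: ler_pM => //; apply: ler_pM.
have T2 := T _ _ w _ v1 h2; have T3 := T _ _ z _ v1 h4; have T4 := T _ _ z _ v2 h3.
have T5 : 2 * (w * z) <= w * w + z * z.
  have : 0 <= (w - z) ^+ 2 by exact: sqr_ge0.
  by rewrite sqrrB !expr2; move: (w * w) (w * z) (z * z) => x y t; clear; lra.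
have T6 : 0 <= A * (w * w) by rewrite mulr_ge0// -expr2 sqr_ge0.
have T7 : 0 <= e * A * `|w| by rewrite !mulr_ge0.
rewrite -subr_ge0.
have -> : - (u * (wx * w + w * wx + (zx * z + z * zx))) +
  ((2 * A + 1) * (w * w + z * z) +
   (2 * A * (KS + 2 * e) * (`|w| + `|z|) + 2 * A * (`|z| * Q))) -
  ((- (u * wx) - v * a2 + z) * w + w * (- (u * wx) - v * a2 + z) +
  ((- (u * zx) - v * a4 - a1 * z - vx * a3) * z +
   z * (- (u * zx) - v * a4 - a1 * z - vx * a3))) =
  (w * w + z * z - 2 * (w * z)) + 2 * ((KS + e) * A * `|w| - - (v * a2 * w)) +
  2 * ((KS + e) * A * `|z| - - (v * a4 * z)) + 2 * (A * (z * z) - - (a1 * z * z)) +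
  2 * ((Q + e) * A * `|z| - - (vx * a3 * z)) + 2 * (A * (w * w)) +
  2 * (e * A * `|w|) by ring.
have P (x y : R) : x <= y -> 0 <= 2 * (y - x).
  by move=> xy; rewrite mulr_ge0// subr_ge0.
have Q0 (x : R) : 0 <= x -> 0 <= 2 * x by move=> x0; rewrite mulr_ge0.
apply: addr_ge0; last exact: Q0.
apply: addr_ge0; last exact: Q0.
apply: addr_ge0; last exact: P.
apply: addr_ge0; last exact: P.
apply: addr_ge0; last exact: P.
apply: addr_ge0; last exact: P.
by rewrite subr_ge0.
Qed.

(** S and Sz stand for the L1 norms of w and z, V for the integral of u_x (w^2 + z^2), Z for that of
    |z| Q, E for exp(- lam). L1 norms multiplied by 1 + lam are absorbed into Y by Cauchy-Schwarz,
    those multiplied by E are bounded through A: so Y carries one factor 1 + lam and E none. *)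
Lemma energy_final (A K l lam Y S Sz C E V Z : R) : 0 <= A -> 0 <= K ->
  0 < l -> 0 < lam -> 0 <= Y -> 0 <= C -> 0 < E ->
  V <= A * Y -> Z <= K * (1 + lam) / 2 * Y -> S ^+ 2 + Sz ^+ 2 <= 2 * l * Y ->
  S <= A * (2 * l) -> Sz <= A * (2 * l) ->
  V + ((2 * A + 1) * Y +
    (2 * A * (K * (1 + lam) * S + 2 * (C * E)) * (S + Sz) + 2 * A * Z)) <=
  (1 + (3 * A + 1 + 6 * A * K * l + A * K + 16 * A * A * l * C)) * (1 + lam) * Y +
  (1 + (3 * A + 1 + 6 * A * K * l + A * K + 16 * A * A * l * C)) * E.
Proof.
move=> A0 K0 l0 lam0 Y0 C0 E0 hV hZ hS LS LSz.
have l1 := ltW l0; have E1 := ltW E0.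
have m0 : 0 <= 1 + lam by rewrite addr_ge0// ltW.
have L4 : S * (S + Sz) <= 3 * l * Y.
  have := sqr_ge0 (S - Sz); have := sqr_ge0 Sz; rewrite sqrrB mulrDr -expr2.
  rewrite -!mulrA in hS *; move: hS.
  by move: (S ^+ 2) (Sz ^+ 2) (S * Sz) (l * Y) => x y z t; clear; lra.
have M1 : 2 * A * (K * (1 + lam)) * (S * (S + Sz)) <=
    2 * A * (K * (1 + lam)) * (3 * l * Y).
  by apply: ler_wpM2l => //; rewrite !mulr_ge0.
have M2 : 4 * A * (C * E) * (S + Sz) <= 4 * A * (C * E) * (A * (2 * l) + A * (2 * l)).
  by apply: ler_wpM2l; [rewrite !mulr_ge0|exact: lerD].
have M3 : 2 * A * Z <= 2 * A * (K * (1 + lam) / 2 * Y).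
  by apply: ler_wpM2l => //; rewrite mulr_ge0.
have M4 : 0 <= (3 * A + 1) * (lam * Y) by rewrite !(mulr_ge0, addr_ge0)// ltW.
have N0 : 0 <= (1 + lam) * Y by rewrite mulr_ge0.
have N1 : 0 <= 16 * A * A * l * C * ((1 + lam) * Y).
  by apply: mulr_ge0 => //; rewrite !mulr_ge0.
have N2 : 0 <= (1 + (3 * A + 1 + 6 * A * K * l + A * K)) * E.
  by rewrite !(mulr_ge0, addr_ge0).
rewrite -subr_ge0.
have -> : (1 + (3 * A + 1 + 6 * A * K * l + A * K + 16 * A * A * l * C)) * (1 + lam) * Y +
  (1 + (3 * A + 1 + 6 * A * K * l + A * K + 16 * A * A * l * C)) * E -
  (V + ((2 * A + 1) * Y +
    (2 * A * (K * (1 + lam) * S + 2 * (C * E)) * (S + Sz) + 2 * A * Z))) =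
  (A * Y - V) + (2 * A * (K * (1 + lam)) * (3 * l * Y) - 2 * A * (K * (1 + lam)) * (S * (S + Sz)))
  + (4 * A * (C * E) * (A * (2 * l) + A * (2 * l)) - 4 * A * (C * E) * (S + Sz))
  + (2 * A * (K * (1 + lam) / 2 * Y) - 2 * A * Z) + (3 * A + 1) * (lam * Y)
  + (1 + lam) * Y + 16 * A * A * l * C * ((1 + lam) * Y)
  + (1 + (3 * A + 1 + 6 * A * K * l + A * K)) * E by field.
do 4 (apply: addr_ge0 => //).
by do 3 (apply: addr_ge0; last by rewrite subr_ge0); rewrite subr_ge0.
Qed.

(* kd lam is a logarithmic kernel regularised at length e^(-2 lam); hence the
   bounds linear in lam. *)
Record kernel_family l (kd kd' : R -> R -> R) : Prop := KernelFamily {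
  kf_derive : forall lam z, 0 < lam -> is_derive z 1 (kd lam) (kd' lam z) ;
  kf_continuous : forall lam, 0 < lam -> continuous (kd' lam) ;
  kf_even : forall lam z, kd lam (- z) = kd lam z ;
  kf_odd : forall lam z, kd' lam (- z) = - kd' lam z ;
  kf_bound : exists2 K, 0 <= K & forall lam, 0 < lam ->
    (forall z, `|z| <= 2 * l -> `|kd lam z| <= K * (1 + lam)) /\
    (forall x, - l <= x <= l ->
       rint (- l) l (fun y => `|kd' lam (x - y)|) <= K * (1 + lam)) }.

Definition vel l k f x : R := pi^-1 * rint (- l) l (fun y => f y * k (x - y)).

(* The HL-model on [-l, l] x [0, T]: ze is theta_x, and the Biot-Savart law is
   encoded by u_approx alone.  The flag per is true on the circle (period 2l) and
   false on the line (supports inside ]-l, l[). *)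
Record hl_sol (per : bool) l T (kd kd' : R -> R -> R) := HLSol {
  th : R -> R -> R ; tht : R -> R -> R ;
  ze : R -> R -> R ; zex : R -> R -> R ; zet : R -> R -> R ;
  om : R -> R -> R ; omx : R -> R -> R ; omt : R -> R -> R ;
  u : R -> R -> R ; ux : R -> R -> R ;
  C1_th : C1_spacetime th ze tht ;
  C1_ze : C1_spacetime ze zex zet ;
  C1_om : C1_spacetime om omx omt ;
  eq_om : forall x t, - l <= x <= l -> 0 < t < T ->
    omt x t + u x t * omx x t = ze x t ;
  eq_th : forall x t, - l <= x <= l -> 0 < t < T ->
    tht x t + u x t * ze x t = 0 ;
  eq_ze : forall x t, - l <= x <= l -> 0 < t < T ->
    zet x t + u x t * zex x t + ux x t * ze x t = 0 ;
  d_u : forall x t, - l <= x <= l -> 0 < t < T ->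
    is_derive x 1 (u ^~ t) (ux x t) ;
  cts_ux : forall t, 0 < t < T -> cts (- l) l (ux ^~ t) ;
  u_approx : exists2 C, 0 <= C & forall lam x t, 0 < lam -> - l <= x <= l ->
    0 < t < T ->
    `|u x t - vel l (kd lam) (om ^~ t) x| <= C * expR (- lam) /\
    `|ux x t - vel l (kd' lam) (om ^~ t) x| <= C * expR (- lam) ;
  bd : forall t, 0 < t < T ->
    (per -> [/\ u l t = u (- l) t, om l t = om (- l) t &
                ze l t = ze (- l) t]) /\
    (~~ per -> [/\ om l t = 0, om (- l) t = 0, ze l t = 0 & ze (- l) t = 0]) }.

Arguments cts_ux {per l T kd kd'} s {t} tI : rename.

Variables (per : bool) (l T : R) (kd kd' : R -> R -> R).
Hypothesis (l0 : 0 < l) (KF : kernel_family l kd kd').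
Notation sol := (hl_sol per l T kd kd').

Let ll : - l < l. Proof. by rewrite gtrN. Qed.

Lemma pi_inv_bound : 0 < (pi^-1 : R) <= 1.
Proof.
rewrite invr_gt0 pi_gt0/= invf_le1 ?pi_gt0//.
by apply: le_trans (pi_ge2 R); rewrite ler1n.
Qed.

Lemma kd_continuous lam : 0 < lam -> continuous (kd lam).
Proof. by move=> lam0 z; exact: is_derive_continuous (kf_derive KF z lam0). Qed.

Lemma vel_le k f x : cts (- l) l f -> continuous k ->
  `|vel l k f x| <= rint (- l) l (fun y => `|f y| * `|k (x - y)|).
Proof.
move=> cf ck; rewrite /vel normrM.
have ckx : cts (- l) l (fun y => k (x - y)).
  by apply: continuous_cts; exact: continuous_subr.
have /andP[p0 p1] := pi_inv_bound.
have E : rint (- l) l (fun y => `|f y| * `|k (x - y)|) =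
    rint (- l) l (fun y => `|f y * k (x - y)|).
  by apply: eq_rint => y _; rewrite normrM.
rewrite E -[leRHS]mul1r (ger0_norm (ltW p0)); apply: ler_pM => //.
  exact: ltW.
by apply: rint_norm_le; exact: ctsM.
Qed.

(** [ux] is the one field without a bound from C1 regularity; the approximation at lam = 1 bounds it
    by the L1 norm of [kd' 1]. *)
Lemma sol_bounded (s : sol) : exists2 A, 0 <= A & forall x t,
  - l <= x <= l -> 0 < t < T ->
  [/\ `|om s x t| <= A, `|omx s x t| <= A, `|ze s x t| <= A,
      `|zex s x t| <= A & `|ux s x t| <= A].
Proof.
have [A1 [A10 o1 o2 _]] := C1_bounded (- l) l T (C1_om s).
have [A2 [A20 z1 z2 _]] := C1_bounded (- l) l T (C1_ze s).
have [C C0 HC] := u_approx s.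
have [K K0 HK] := kf_bound KF.
exists (A1 + A2 + (C + A1 * (K * (1 + 1)))).
  by rewrite !addr_ge0// !mulr_ge0.
move=> x t xI tI; have tI' : 0 <= t <= T by case/andP: tI => ? ?; rewrite !ltW.
have P0 : 0 <= A1 * (K * (1 + 1)) by rewrite !mulr_ge0.
have H1 := o1 x t xI tI'; have H2 := o2 x t xI tI'.
have H3 := z1 x t xI tI'; have H4 := z2 x t xI tI'.
have D0 : 0 <= C + A1 * (K * (1 + 1)) by rewrite addr_ge0.
have le1 : A1 <= A1 + A2 + (C + A1 * (K * (1 + 1))) by rewrite -addrA lerDl addr_ge0.
have le2 : A2 <= A1 + A2 + (C + A1 * (K * (1 + 1))).
  by rewrite (addrC A1) -addrA lerDl addr_ge0.
split; [exact: le_trans H1 le1|exact: le_trans H2 le1|exact: le_trans H3 le2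
  |exact: le_trans H4 le2|].
have [_ H5] := HC 1 x t ltr01 xI tI.
have com : cts (- l) l (om s ^~ t).
  have [om0 _ _ _ _] := C1_om s.
  by apply: continuous_cts; apply: C0_slicex => //; case/andP: tI'.
have ck := kf_continuous KF ltr01.
have H6 : `|vel l (kd' 1) (om s ^~ t) x| <= A1 * (K * (1 + 1)).
  apply: le_trans (vel_le x com ck) _.
  have ckx : cts (- l) l (fun y => `|kd' 1 (x - y)|).
    by apply: cts_norm; apply: continuous_cts; exact: continuous_subr.
  have [_ H7] := HK 1 ltr01.
  apply: (@le_trans _ _ (rint (- l) l (fun y => A1 * `|kd' 1 (x - y)|))).
    apply: le_rint.
    - by apply: ctsM => //; exact: cts_norm.
    - exact: ctsZ.
    - by move=> y yI; apply: ler_wpM2r => //; exact: o1.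
  by rewrite rintZ//; apply: ler_wpM2l => //; exact: H7.
have e1 : expR (- 1) <= 1 :> R by rewrite -[leRHS]expR0 ler_expR; lra.
have H8 : C * expR (- 1) <= C by rewrite -[leRHS]mulr1; exact: ler_wpM2l.
have := ler_normD (ux s x t - vel l (kd' 1) (om s ^~ t) x)
  (vel l (kd' 1) (om s ^~ t) x).
by rewrite subrK; lra.
Qed.

Let slice (f fx ft : R -> R -> R) t : C1_spacetime f fx ft -> 0 < t < T ->
  [/\ cts (- l) l (f ^~ t), cts (- l) l (fx ^~ t) & cts (- l) l (ft ^~ t)].
Proof.
move=> [f0 fx0 ft0 _ _] /andP[/ltW t0 _].
by split; apply: continuous_cts; exact: C0_slicex.
Qed.

(** The delicate term is the difference of the two u_x, which multiplies theta_x. It is at most a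
    convolution of |w| with |kd' lam| plus an error, and Schur's test bounds its pairing with |z| by
    (1 + lam) Y. The difference of the u needs only the sup bound on [kd lam] and the L1 norm of
    w. *)
Lemma hl_unique (s1 s2 : sol) :
  (forall x, - l <= x <= l -> om s1 x 0 = om s2 x 0 /\ ze s1 x 0 = ze s2 x 0) ->
  forall x t, - l <= x <= l -> 0 <= t <= T ->
    om s1 x t = om s2 x t /\ ze s1 x t = ze s2 x t.
Proof.
move=> init.
pose w x t := om s1 x t - om s2 x t; pose z x t := ze s1 x t - ze s2 x t.
pose wx x t := omx s1 x t - omx s2 x t; pose zx x t := zex s1 x t - zex s2 x t.
pose wt x t := omt s1 x t - omt s2 x t; pose zt x t := zet s1 x t - zet s2 x t.
have Cw : C1_spacetime w wx wt := C1_sub (C1_om s1) (C1_om s2).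
have Cz : C1_spacetime z zx zt := C1_sub (C1_ze s1) (C1_ze s2).
pose P x t := w x t * w x t + z x t * z x t.
pose Px x t := (wx x t * w x t + w x t * wx x t) +
   (zx x t * z x t + z x t * zx x t).
pose Pt x t := (wt x t * w x t + w x t * wt x t) +
   (zt x t * z x t + z x t * zt x t).
have tw := C1_tdiff (- l) l T (lexx 0) Cw.
have tz := C1_tdiff (- l) l T (lexx 0) Cz.
have tP : tdiff (- l) l 0 T P Pt := tdiffD (tdiffM tw tw) (tdiffM tz tz).
have [cY dY] := tdiff_rint (ltW ll) tP.
pose Y t := rint (- l) l (P ^~ t).
have P0 x t : 0 <= P x t by rewrite addr_ge0// -expr2 sqr_ge0.
have Y0 t : 0 <= Y t by apply: rint_ge0 => x _.
have [A1 A10 B1] := sol_bounded s1; have [A2 A20 B2] := sol_bounded s2.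
pose A := A1 + A2.
have A0 : 0 <= A by rewrite addr_ge0.
have [C1 C10 U1] := u_approx s1; have [C2 C20 U2] := u_approx s2.
have [K K0 HK] := kf_bound KF.
pose C := C1 + C2.
have C0 : 0 <= C by rewrite addr_ge0.
pose D := 1 + (3 * A + 1 + 6 * A * K * l + A * K + 16 * A * A * l * C).
have D0 : 0 < D.
  by apply: ltr_wpDr => //; rewrite !(mulr_ge0, addr_ge0)//; exact: ltW.
suff main lam t : 0 < lam -> 0 < t < T ->
    rint (- l) l (Pt ^~ t) <= D * (1 + lam) * Y t + D * expR (- lam).
  have Yle0 := gronwall_log D0 cY dY main.
  have Yinit : rint (- l) l (P ^~ 0) <= 0.
    have -> : rint (- l) l (P ^~ 0) = rint (- l) l (fun=> 0).
      apply: eq_rint => x xI; have [e1 e2] := init x xI.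
      by rewrite /P /w /z e1 e2 !subrr !mulr0 addr0.
    by rewrite (rint_cst _ (ltW ll)) mul0r.
  move=> x t xI tI.
  have : P x t = 0.
    apply: (rint_eq0 ll (f := P ^~ t)) => //.
    - by have [cP _ _ _] := tP; exact: cP.
    - exact: Yle0.
  rewrite /P -!expr2 => /eqP; rewrite paddr_eq0 ?sqr_ge0// !sqrf_eq0 !subr_eq0.
  by move=> /andP[/eqP -> /eqP ->].
move=> lam0 tI.
have [cw cwx cwt] := slice Cw tI; have [cz czx czt] := slice Cz tI.
have [co2 cox2 _] := slice (C1_om s2) tI.
have [co1 cox1 _] := slice (C1_om s1) tI.
have t0 : 0 < t by case/andP: tI.
pose K' := K * (1 + lam); pose e := C * expR (- lam).
have K'0 : 0 <= K' by rewrite mulr_ge0// addr_ge0// ltW.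
have e0 : 0 <= e by rewrite mulr_ge0// expR_ge0.
have [HKd HKd'] := HK lam lam0.
have ckd := kd_continuous lam0; have ckd' := kf_continuous KF lam0.
pose S := rint (- l) l (fun y => `|w y t|).
pose Sz := rint (- l) l (fun y => `|z y t|).
have S0 : 0 <= S by apply: rint_ge0 => y _.
have Sz0 : 0 <= Sz by apply: rint_ge0 => y _.
pose Q x := rint (- l) l (fun y => `|w y t| * `|kd' lam (x - y)|).
have velB k x : continuous k -> vel l k (om s1 ^~ t) x - vel l k (om s2 ^~ t) x
    = vel l k (w ^~ t) x.
  move=> ck; have ckx : cts (- l) l (fun y => k (x - y)).
    by apply: continuous_cts; exact: continuous_subr.
  rewrite /vel -mulrBr -rintB; [|exact: ctsM..].
  by congr (_ * _); apply: eq_rint => y _; rewrite mulrBl.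
have vE x : - l <= x <= l -> `|u s1 x t - u s2 x t| <= K' * S + e.
  move=> xI; have [H1 _] := U1 lam x t lam0 xI tI; have [H2 _] := U2 lam x t lam0 xI tI.
  have H3 : `|vel l (kd lam) (w ^~ t) x| <= K' * S.
    apply: le_trans (vel_le x cw ckd) _; rewrite /S -rintZ; last exact: cts_norm.
    apply: le_rint.
    - apply: ctsM; first exact: cts_norm.
      by apply: cts_norm; apply: continuous_cts; exact: continuous_subr.
    - by apply: ctsZ; exact: cts_norm.
    - move=> y yI; rewrite mulrC; apply: ler_wpM2r => //; apply: HKd.
      apply: le_trans (ler_normB _ _) _; rewrite mulr2n mulrDl mul1r.
      by apply: lerD; rewrite ler_norml.
  have -> : u s1 x t - u s2 x t = (u s1 x t - vel l (kd lam) (om s1 ^~ t) x) -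
     (u s2 x t - vel l (kd lam) (om s2 ^~ t) x) + vel l (kd lam) (w ^~ t) x.
    by rewrite -velB//; ring.
  apply: le_trans (ler_normD _ _) _; apply: le_trans (lerD (ler_normB _ _) (lexx _)) _.
  rewrite [leRHS]addrC /e /C mulrDl; exact: lerD (lerD H1 H2) H3.
have vxE x : - l <= x <= l -> `|ux s1 x t - ux s2 x t| <= Q x + e.
  move=> xI; have [_ H1] := U1 lam x t lam0 xI tI; have [_ H2] := U2 lam x t lam0 xI tI.
  have H3 := vel_le x cw ckd'.
  have -> : ux s1 x t - ux s2 x t = (ux s1 x t - vel l (kd' lam) (om s1 ^~ t) x) -
     (ux s2 x t - vel l (kd' lam) (om s2 ^~ t) x) + vel l (kd' lam) (w ^~ t) x.
    by rewrite -velB//; ring.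
  apply: le_trans (ler_normD _ _) _; apply: le_trans (lerD (ler_normB _ _) (lexx _)) _.
  rewrite [leRHS]addrC /e /C mulrDl; exact: lerD (lerD H1 H2) H3.
have cQ : cts (- l) l Q.
  apply: continuous_cts; apply: (@convol_continuous _ _ _ _ (fun y => `|kd' lam y|)).
    exact: cts_norm.
  by move=> y; apply: continuous_comp; [exact: ckd'|exact: norm_continuous].
have cu1 : cts (- l) l (u s1 ^~ t).
  by apply: (is_derive_cts (df := ux s1 ^~ t)) => x xI; exact: d_u.
have cux1 := cts_ux s1 tI.
have cPs : cts (- l) l (P ^~ t) by apply: ctsD; exact: ctsM.
have cPx : cts (- l) l (Px ^~ t) by apply: ctsD; apply: ctsD; exact: ctsM.
have cPt : cts (- l) l (Pt ^~ t) by apply: ctsD; apply: ctsD; exact: ctsM.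
have cwz : cts (- l) l (fun x => `|w x t| + `|z x t|).
  by apply: ctsD; exact: cts_norm.
have czQ : cts (- l) l (fun x => `|z x t| * Q x).
  by apply: ctsM => //; exact: cts_norm.
pose c1 := 2 * A * (K' * S + 2 * e).
have c10 : 0 <= c1.
  by rewrite /c1 !(mulr_ge0, addr_ge0)//; exact: ltW.
have ptw x : - l <= x <= l -> Pt x t <= - (u s1 x t * Px x t) +
    ((2 * A + 1) * P x t + (c1 * (`|w x t| + `|z x t|) + 2 * A * (`|z x t| * Q x))).
  move=> xI.
  have [_ _ _ _ a1] := B1 x t xI tI; have [_ a2 a3 a4 _] := B2 x t xI tI.
  have Ew : wt x t = - (u s1 x t * wx x t) - (u s1 x t - u s2 x t) * omx s2 x t + z x t.
    have := eq_om s1 xI tI; have := eq_om s2 xI tI; rewrite /wt /wx /z => H1 H2.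
    by rewrite -H1 -H2; ring.
  have Ez : zt x t = - (u s1 x t * zx x t) - (u s1 x t - u s2 x t) * zex s2 x t
      - ux s1 x t * z x t - (ux s1 x t - ux s2 x t) * ze s2 x t.
    have := eq_ze s1 xI tI; have := eq_ze s2 xI tI; rewrite /zt /zx /z => H1 H2.
    have E (a b c d : R) : a + b + c = 0 -> a = - b - c.
      by move=> h; rewrite -[LHS]addr0 -oppr0 -h; ring.
    by rewrite (E _ _ _ 0 H1) (E _ _ _ 0 H2); ring.
  have v1 := vE x xI; have v2 := vxE x xI.
  rewrite /Pt Ew Ez /Px /P /c1.
  have AA1 r : r <= A1 -> r <= A by move=> /le_trans; apply; rewrite lerDl.
  have AA2 r : r <= A2 -> r <= A by move=> /le_trans; apply; rewrite lerDr.
  have KS0 : 0 <= K' * S by exact: mulr_ge0.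
  by apply: energy_pointwise => //; [exact: AA1|exact: AA2|exact: AA2|exact: AA2].
have cG1 : cts (- l) l (fun x => u s1 x t * Px x t) by exact: ctsM.
have cG2 : cts (- l) l (fun x => (2 * A + 1) * P x t) by exact: ctsZ.
have cG3 : cts (- l) l (fun x => c1 * (`|w x t| + `|z x t|)) by exact: ctsZ.
have cG4 : cts (- l) l (fun x => 2 * A * (`|z x t| * Q x)) by exact: ctsZ.
have int : rint (- l) l (Pt ^~ t) <= - rint (- l) l (fun x => u s1 x t * Px x t) +
   ((2 * A + 1) * Y t + (c1 * (S + Sz) + 2 * A * rint (- l) l (fun x => `|z x t| * Q x))).
  rewrite -(rintN cG1) /Y /S /Sz -(rintD (cts_norm cw) (cts_norm cz)).
  rewrite -(rintZ _ cPs) -(rintZ _ cwz) -(rintZ _ czQ).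
  rewrite -(rintD cG3 cG4) -(rintD cG2 (ctsD cG3 cG4)).
  rewrite -(rintD (ctsN cG1) (ctsD cG2 (ctsD cG3 cG4))).
  apply: le_rint => //.
  exact: (ctsD (ctsN cG1) (ctsD cG2 (ctsD cG3 cG4))).
apply: le_trans int _.
have dPx x : - l <= x <= l -> is_derive x 1 (P ^~ t) (Px x t).
  move=> xI; have [_ _ _ dwx _] := Cw; have [_ _ _ dzx _] := Cz.
  by apply: isdD; apply: isdM; (exact: (dwx x t (ltW t0)) || exact: (dzx x t (ltW t0))).
have parts := rint_parts (ltW ll) (fun x xI => d_u s1 xI tI) dPx cux1 cPx.
(* The boundary terms cancel by periodicity on the circle and vanish separately on the line. *)
have bdP : u s1 l t * P l t = u s1 (- l) t * P (- l) t.
  have [b1 b1'] := bd s1 tI; have [b2 b2'] := bd s2 tI; rewrite /P /w /z.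
  have [pe|pe] : per \/ ~~ per by case: (per); [left|right].
    by have [-> -> ->] := b1 pe; have [_ -> ->] := b2 pe.
  have [-> -> -> ->] := b1' pe; have [-> -> -> ->] := b2' pe.
  by rewrite !subrr !mulr0 addr0 !mulr0.
have L1 : rint (- l) l (fun x => ux s1 x t * P x t) <= A * Y t.
  rewrite -rintZ//; apply: le_rint; [exact: ctsM|exact: ctsZ|].
  move=> x xI; apply: ler_wpM2r => //.
  have [_ _ _ _ h] := B1 x t xI tI; apply: le_trans (ler_norm _) _.
  by apply: le_trans h _; rewrite lerDl.
have csq (f : R -> R) : cts (- l) l f -> cts (- l) l (fun x => f x ^+ 2).
  by move=> cf x xI; apply: (@continuousM _ _ f f x); exact: cf.
have YE : Y t = rint (- l) l (fun x => w x t ^+ 2) + rint (- l) l (fun x => z x t ^+ 2).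
  rewrite -rintD; [|exact: csq..].
  by apply: eq_rint => x _; rewrite /P !expr2.
have L2 : rint (- l) l (fun x => `|z x t| * Q x) <= K' / 2 * Y t.
  rewrite YE addrC.
  apply: (@schur R (- l) l (z ^~ t) (w ^~ t) (fun y => `|kd' lam y|)) => //.
  - by move=> y; apply: continuous_comp; [exact: ckd'|exact: norm_continuous].
  - by move=> y; rewrite (kf_odd KF) normrN.
have sqn (f : R -> R) : rint (- l) l (fun x => `|f x| ^+ 2) = rint (- l) l (fun x => f x ^+ 2).
  by apply: eq_rint => x _; rewrite real_normK ?num_real.
have L3 : S ^+ 2 + Sz ^+ 2 <= 2 * l * Y t.
  have h1 := rint_sqr_le (ltW ll) (cts_norm cw).
  have h2 := rint_sqr_le (ltW ll) (cts_norm cz).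
  rewrite sqn opprK in h1; rewrite sqn opprK in h2.
  by rewrite YE mulrDr mulr2n mulrDl mul1r; exact: lerD h1 h2.
have wA x : - l <= x <= l -> `|w x t| <= A.
  move=> xI; have [h1 _ _ _ _] := B1 x t xI tI; have [h2 _ _ _ _] := B2 x t xI tI.
  by apply: le_trans (ler_normB _ _) _; rewrite /A lerD.
have zA x : - l <= x <= l -> `|z x t| <= A.
  move=> xI; have [_ _ h1 _ _] := B1 x t xI tI; have [_ _ h2 _ _] := B2 x t xI tI.
  by apply: le_trans (ler_normB _ _) _; rewrite /A lerD.
have LS : S <= A * (2 * l).
  have -> : 2 * l = l - - l by rewrite opprK mulr2n mulrDl mul1r.
  rewrite -(rint_cst _ (ltW ll)).
  by apply: le_rint; [exact: cts_norm|exact: cts_cst|exact: wA].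
have LSz : Sz <= A * (2 * l).
  have -> : 2 * l = l - - l by rewrite opprK mulr2n mulrDl mul1r.
  rewrite -(rint_cst _ (ltW ll)).
  by apply: le_rint; [exact: cts_norm|exact: cts_cst|exact: zA].
rewrite parts bdP subrr sub0r opprK /D /c1 /e /K'.
by apply: energy_final => //; exact: expR_gt0.
Qed.

(** Serves the even kernel (e = 1) and its odd derivative (e = -1) at once. Where k does not vanish,
    two reflections give e * e = 1. *)
Lemma vel_opp k f x (e : R) : (forall z, k (- z) = e * k z) -> continuous k ->
  cts (- l) l f -> vel l k (fun y => - f (- y)) x = - e * vel l k f (- x).
Proof.
move=> ek ck cf.
have ckx z : cts (- l) l (fun y => k (z - y)).
  by apply: continuous_cts; exact: continuous_subr.
have := @rint_opp R (- l) l (fun y => f y * k (- x - y)) (ltW ll).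
rewrite opprK => H.
rewrite /vel [in RHS]H; last exact: ctsM.
have cfN : cts (- l) l (fun y => f (- y)).
  move=> y yI; apply: (@continuous_comp _ _ _ (fun y : R => - y) f).
    exact: opp_continuous.
  by apply: cf; case/andP: yI => ? ?; lra.
rewrite mulrCA; congr (_ * _).
have c2 : cts (- l) l (fun y => f (- y) * k (- x - - y)).
  apply: ctsM => //; apply: continuous_cts => y.
  apply: (@continuous_comp _ _ _ (fun y => - x - - y) k); last exact: ck.
  exact: is_derive_continuous (isdB (isd_cst y (- x)) (isdN (isd_id y))).
rewrite -rintZ//; apply: eq_rint => y _.
have -> : - x - - y = - (x - y) by ring.
have [e2|e2] := eqVneq (k (x - y)) 0; first by rewrite ek e2 !mulr0.
have e3 : e * e = 1.
  have := ek (- (x - y)); rewrite opprK ek => /eqP.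
  rewrite mulrA -subr_eq0 -{1}(mul1r (k _)) -mulrBl mulf_eq0 (negbTE e2) orbF subr_eq0.
  by move=> /eqP.
rewrite ek; have -> : - e * (f (- y) * (e * k (x - y))) = - (e * e) * f (- y) * k (x - y) by ring.
by rewrite e3; ring.
Qed.

(** Under x -> -x, theta and u_x are composed with the reflection while omega, theta_x and u also
    change sign. The double minus signs are what [C1_neg] applied to [C1_opp] produces. *)
Lemma hl_reflect (s : sol) : exists s' : sol, forall x t,
  om s' x t = - om s (- x) t /\ ze s' x t = - ze s (- x) t.
Proof.
have nI x : - l <= x <= l -> - l <= - x <= l by move=> /andP[? ?]; lra.
unshelve (refine (ex_intro _ (@HLSol per l T kd kd'
  (fun x t => th s (- x) t) (fun x t => tht s (- x) t)
  (fun x t => - ze s (- x) t) (fun x t => - - zex s (- x) t)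
  (fun x t => - zet s (- x) t)
  (fun x t => - om s (- x) t) (fun x t => - - omx s (- x) t)
  (fun x t => - omt s (- x) t)
  (fun x t => - u s (- x) t) (fun x t => ux s (- x) t)
  (C1_opp (C1_th s)) (C1_neg (C1_opp (C1_ze s))) (C1_neg (C1_opp (C1_om s)))
  _ _ _ _ _ _ _) _)).
- by move=> x t /nI xI tI; rewrite -(eq_om s xI tI); ring.
- by move=> x t /nI xI tI; rewrite -(eq_th s xI tI); ring.
- move=> x t /nI xI tI.
  have -> : 0 = - (0 : R) by rewrite oppr0.
  by rewrite -(eq_ze s xI tI); ring.
- move=> x t /nI xI tI; have H := d_u s xI tI.
  by apply: (isd_eq (isdN (isd_comp (isdN (isd_id x)) H))); ring.
- move=> t tI x /nI xI.
  apply: (@continuous_comp _ _ _ (fun y : R => - y) (ux s ^~ t)).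
    exact: opp_continuous.
  exact: (cts_ux s tI).
- have [C C0 HC] := u_approx s; exists C => // lam x t lam0 /nI xI tI.
  have [H1 H2] := HC lam (- x) t lam0 xI tI.
  have [co _ _] := slice (C1_om s) tI.
  rewrite (@vel_opp (kd lam) (om s ^~ t) x 1).
  + rewrite (@vel_opp (kd' lam) (om s ^~ t) x (- 1)).
    * by rewrite opprK mul1r mulN1r opprK addrC -normrN opprD opprK addrC.
    * by move=> z; rewrite (kf_odd KF) mulN1r.
    * exact: (kf_continuous KF lam0).
    * exact: co.
  + by move=> z; rewrite (kf_even KF) mul1r.
  + exact: kd_continuous.
  + exact: co.
- move=> t tI; have [b b'] := bd s tI; rewrite opprK; split => pe.
    by have [-> -> ->] := b pe.
  by have [-> -> -> ->] := b' pe; rewrite !oppr0.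
- by move=> x t; split.
Qed.

Lemma hl_parity (s : sol) :
  (forall x, - l <= x <= l -> om s (- x) 0 = - om s x 0 /\ ze s (- x) 0 = - ze s x 0) ->
  forall x t, - l <= x <= l -> 0 <= t <= T ->
    om s (- x) t = - om s x t /\ ze s (- x) t = - ze s x t.
Proof.
move=> init x t xI tI.
have nI : - l <= - x <= l by case/andP: xI => ? ?; lra.
have [s' s'E] := hl_reflect s.
have [|H1 H2] := @hl_unique s' s _ (- x) t nI tI.
  move=> y /init[e1 e2]; have [-> ->] := s'E y 0.
  by rewrite e1 e2 !opprK.
move: H1 H2; have [-> ->] := s'E (- x) t.
by rewrite opprK => <- <-.
Qed.

End abstract_problem.

Arguments cts_ux {R per l T kd kd'} s {t} tI : rename.

(** * Blow-up on [0, l] from the kernel inequalities *)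

Section blowup.
Context {R : realType}.
Implicit Types (x y z t lam : R) (k f g : R -> R).
Notation mu := (@lebesgue_measure R).
Notation MR := (measurableTypeR R).

Lemma le_of_exp_error (a b C : R) :
  (forall lam, 0 < lam -> a <= b + C * expR (- lam)) -> a <= b.
Proof.
move=> H; rewrite -subr_le0.
apply: (@le0_of_linear_bound _ _ `|C|) => lam lam0.
have h1 : 0 <= 1 + lam by rewrite addr_ge0// ltW.
have h2 : a - b <= `|C| * expR (- lam).
  have := H lam lam0; have := ler_wpM2r (expR_ge0 (- lam)) (ler_norm C); lra.
apply: le_trans (ler_wpM2r h1 h2) _.
rewrite -mulrA -[leRHS]mulr1; apply: ler_wpM2l => //.
by apply: expRN_le; exact: ltW.
Qed.

(* The weight w behaves like 1/x; w 0 = q 0 = 0 are the junk values of 1/0, and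
   every integrand below is O(x) at 0, hence continuous there. *)
Record weight (l c : R) (kd kd' : R -> R -> R) (w q : R -> R) : Prop := Weight {
  w_at0 : w 0 = 0 ;
  q_at0 : q 0 = 0 ;
  w_derive : forall x, 0 < x <= l -> is_derive x 1 w (- q x) ;
  q_continuous : forall x, 0 < x <= l -> {for x, continuous q} ;
  wq_bound : exists2 C, 0 <= C & forall x, - l <= x <= l ->
    `|w x| * `|x| <= C /\ `|q x| * `|x| ^+ 2 <= C ;
  w_ge0 : forall x, 0 <= x <= l -> 0 <= w x ;
  q_ge : forall x, 0 <= x <= l -> c * w x ^+ 2 <= q x ;
  lam_ge0 : forall lam x y, 0 < lam -> 0 <= x <= l -> 0 <= y <= l ->
    0 <= kd lam (x + y) - kd lam (x - y) ;
  lam_lower : forall x, 0 < x <= l -> exists2 M, 0 <= M & forall lam y,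
    0 < lam -> x <= y <= l ->
    w y - M * expR (- lam) <= w x * (kd lam (x + y) - kd lam (x - y)) ;
  H_le0 : forall lam x y, 0 < lam -> 0 < y <= x -> x <= l ->
    w x * (kd' lam (x + y) - kd' lam (x - y)) -
    q x * (kd lam (x + y) - kd lam (x - y)) <= 0 ;
  H_sym : forall lam x y, 0 < lam -> 0 < x <= l -> 0 < y <= l ->
    (w x * (kd' lam (x + y) - kd' lam (x - y)) -
     q x * (kd lam (x + y) - kd lam (x - y))) +
    (w y * (kd' lam (y + x) - kd' lam (y - x)) -
     q y * (kd lam (y + x) - kd lam (y - x))) <= 0 }.

Variables (per : bool) (l c T m0 A0 : R) (kd kd' : R -> R -> R) (w q : R -> R).
Hypotheses (l0 : 0 < l) (c0 : 0 < c) (A00 : 0 < A0).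
Hypotheses (m00 : 0 < m0) (m0l : m0 <= l).
Hypotheses (KF : kernel_family l kd kd') (W : weight l c kd kd' w q).
Variable s : hl_sol per l T kd kd'.
Hypothesis om_init : forall x, - l <= x <= l -> om s x 0 = 0.
Hypothesis ze_init_odd : forall x, - l <= x <= l -> ze s (- x) 0 = - ze s x 0.
Hypothesis ze_init_ge0 : forall x, 0 <= x <= l -> 0 <= ze s x 0.
Hypothesis ze_init_supp : forall x, m0 <= x <= l -> ze s x 0 = 0.
Hypothesis th_init0 : th s 0 0 = 0.
Hypothesis I_init : A0 <= rint 0 m0 (fun x => th s x 0 * w x).
Hypothesis T_large : 4 * Num.sqrt (3 / (pi^-1 * (c / (2 * m0)) * A0)) <= T.

Let ll : - l < l. Proof. by rewrite gtrN. Qed.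

Let half x : 0 <= x <= l -> - l <= x <= l.
Proof. by move=> /andP[x0 ->]; rewrite andbT (le_trans _ x0)// oppr_le0 ltW. Qed.

Let clo t : 0 < t < T -> 0 <= t <= T.
Proof. by move=> /andP[? ?]; rewrite !ltW. Qed.

Let T0 : 0 < T.
Proof.
apply: lt_le_trans T_large; rewrite mulr_gt0// sqrtr_gt0 divr_gt0//.
by rewrite !mulr_gt0 ?invr_gt0 ?pi_gt0// mulr_gt0.
Qed.

Let parity x t : - l <= x <= l -> 0 <= t <= T ->
  om s (- x) t = - om s x t /\ ze s (- x) t = - ze s x t.
Proof.
apply: (hl_parity l0 KF) => y yI; split; last exact: ze_init_odd.
by rewrite !om_init ?oppr0//; case/andP: yI => ? ?; rewrite lerNl opprK lerNl; apply/andP.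
Qed.

Let odd0 (a : R) : a = - a -> a = 0.
Proof. by move=> h; lra. Qed.

Let in0 : - l <= 0 <= l. Proof. by rewrite oppr_le0 ltW. Qed.
Let inl : - l <= l <= l. Proof. by rewrite lexx andbT ltW. Qed.

Let om0 t : 0 <= t <= T -> om s 0 t = 0.
Proof. by move=> tI; have [h _] := parity in0 tI; apply: odd0; rewrite -h oppr0. Qed.

Let ze0 t : 0 <= t <= T -> ze s 0 t = 0.
Proof. by move=> tI; have [_ h] := parity in0 tI; apply: odd0; rewrite -h oppr0. Qed.

Let oml t : 0 < t < T -> om s l t = 0.
Proof.
move=> tI; have [b b'] := bd s tI.
have [pe|pe] : per \/ ~~ per by case: (per); [left|right].
  have [_ h _] := b pe; have [h2 _] := parity inl (clo tI).
  by apply: odd0; rewrite -h2.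
by have [h _ _ _] := b' pe.
Qed.

Let zel t : 0 < t < T -> ze s l t = 0.
Proof.
move=> tI; have [b b'] := bd s tI.
have [pe|pe] : per \/ ~~ per by case: (per); [left|right].
  have [_ _ h] := b pe; have [_ h2] := parity inl (clo tI).
  by apply: odd0; rewrite -h2.
by have [_ _ h _] := b' pe.
Qed.

Let cslice (f fx ft : R -> R -> R) a b t : C1_spacetime f fx ft -> 0 <= t ->
  [/\ cts a b (f ^~ t), cts a b (fx ^~ t) & cts a b (ft ^~ t)].
Proof.
move=> [f0 fx0 ft0 _ _] t0.
by split; apply: continuous_cts; exact: C0_slicex.
Qed.

(** Oddness folds the window onto [0, l], where the kernel becomes k(x + y) - k(x - y); by [lam_ge0]
    this has a sign, which k itself has not. *)
Lemma vel_odd k f x : continuous k -> cts (- l) l f ->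
  (forall y, - l <= y <= l -> f (- y) = - f y) ->
  vel l k f x = - (pi^-1 * rint 0 l (fun y => f y * (k (x + y) - k (x - y)))).
Proof.
move=> ck cf fodd.
have ckx : cts (- l) l (fun y => k (x - y)).
  by apply: continuous_cts; exact: continuous_subr.
have cfk := ctsM cf ckx.
have cka : cts 0 l (fun y => k (x + y)).
  apply: continuous_cts => y; apply: (@continuous_comp _ _ _ (fun y => x + y) k); last exact: ck.
  exact: is_derive_continuous (isdD (isd_cst y x) (isd_id y)).
have l0' := ltW l0.
have c1 : cts 0 l (fun y => f y * k (x - y)) by apply: ctsS cfk; rewrite ?oppr_le0.
have cf1 : cts 0 l f by apply: ctsS cf; rewrite ?oppr_le0.
rewrite /vel -mulrN; congr (_ * _).
rewrite (@rint_split _ _ _ 0)//; last first.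
  by apply: cts_integrable.
have -> : rint (- l) 0 (fun y => f y * k (x - y)) = rint 0 l (fun y => - (f y * k (x + y))).
  have := @rint_opp R 0 l (fun y => f y * k (x - y)) l0'.
  rewrite oppr0 => ->; last by apply: ctsS cfk; rewrite ?oppr_le0.
  apply: eq_rint => y yI; rewrite fodd; last exact: half.
  by rewrite opprK mulNr.
have c2 : cts 0 l (fun y => f y * k (x + y)) by exact: ctsM.
rewrite -rintD//; last exact: ctsN.
rewrite -rintN; last by apply: ctsM => //; apply: ctsB => //; apply: ctsS ckx; rewrite ?oppr_le0.
by apply: eq_rint => y _; ring.
Qed.

Let com t : 0 <= t -> cts (- l) l (om s ^~ t).
Proof. by move=> t0; have [] := cslice (- l) l (C1_om s) t0. Qed.

Let velE k x t : continuous k -> 0 <= t <= T -> vel l k (om s ^~ t) x =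
  - (pi^-1 * rint 0 l (fun y => om s y t * (k (x + y) - k (x - y)))).
Proof.
move=> ck tI; have /andP[t0 _] := tI; apply: vel_odd => //; first exact: com.
by move=> y yI; have [] := parity yI tI.
Qed.

Let ckd lam : 0 < lam -> continuous (kd lam).
Proof. exact: (kd_continuous KF). Qed.

Let u0 t : 0 < t < T -> u s 0 t = 0.
Proof.
move=> tI; have [C C0 HC] := u_approx s.
apply/eqP; rewrite -normr_le0.
apply: (@le_of_exp_error _ _ C) => lam lam0; rewrite add0r.
have [h _] := HC lam 0 t lam0 in0 tI; apply: le_trans h.
rewrite (velE _ (ckd lam0) (clo tI)).
have -> : rint 0 l (fun y => om s y t * (kd lam (0 + y) - kd lam (0 - y))) = rint 0 l (fun=> 0).
  by apply: eq_rint => y _; rewrite add0r sub0r (kf_even KF) subrr mulr0.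
by rewrite (rint_cst _ (ltW l0)) mul0r mulr0 oppr0 subr0.
Qed.

Let negsq0 : negsq (0 : R) = 0.
Proof. by rewrite /negsq minxx expr0n. Qed.

Let uxA : exists2 A, 0 <= A & forall x t, - l <= x <= l -> 0 < t < T -> `|ux s x t| <= A.
Proof.
have [A A1 HA] := sol_bounded KF s; exists A => // x t xI tI.
by have [_ _ _ _ h] := HA x t xI tI.
Qed.

(** theta_x obeys the transport inequality with kappa = 1 and zero source; there is no flux at 0,
    where u vanishes by oddness, nor at l, where theta_x vanishes. *)
Let ze_ge0 x t : 0 <= x <= l -> 0 <= t <= T -> 0 <= ze s x t.
Proof.
have [A _ HA] := uxA.
move: x t; apply: (@transport_nonneg _ 0 l T 1 A _ _ _ (u s) (ux s) (fun _ _ => 0)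
  l0 _ (C1_ze s)).
- by rewrite normr1.
- by move=> x t /half xI tI; exact: d_u.
- by move=> t tI; have h := cts_ux s tI; apply: ctsS h; rewrite ?oppr_le0 ?(ltW l0).
- by move=> t tI; exact: cts_cst.
- by move=> x t /half xI tI; exact: HA.
- by move=> x t /half xI tI; rewrite mul1r eq_ze.
- by [].
- by move=> t tI; rewrite u0// zel// negsq0 mul0r mulr0.
- exact: ze_init_ge0.
Qed.

Let om_ge0 x t : 0 <= x <= l -> 0 <= t <= T -> 0 <= om s x t.
Proof.
have [A _ HA] := uxA.
move: x t; apply: (@transport_nonneg _ 0 l T 0 A _ _ _ (u s) (ux s) (ze s)
  l0 _ (C1_om s)).
- by rewrite normr0.
- by move=> x t /half xI tI; exact: d_u.
- by move=> t tI; have h := cts_ux s tI; apply: ctsS h; rewrite ?oppr_le0 ?(ltW l0).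
- by move=> t /andP[t0 _]; have [] := cslice 0 l (C1_ze s) (ltW t0).
- by move=> x t /half xI tI; exact: HA.
- by move=> x t /half xI tI; rewrite !mul0r addr0 eq_om.
- by move=> x t xI tI; apply: ze_ge0 => //; exact: clo.
- by move=> t tI; rewrite u0// oml// negsq0 mul0r mulr0.
- by move=> x /half xI; rewrite om_init.
Qed.

Let u_le0 x t : 0 <= x <= l -> 0 < t < T -> u s x t <= 0.
Proof.
move=> xI tI; have [C C0 HC] := u_approx s.
apply: (@le_of_exp_error _ _ C) => lam lam0; rewrite add0r.
have [h _] := HC lam x t lam0 (half xI) tI.
have hv : vel l (kd lam) (om s ^~ t) x <= 0.
  rewrite (velE _ (ckd lam0) (clo tI)) oppr_le0 mulr_ge0 ?invr_ge0 ?pi_ge0//.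
  apply: rint_ge0 => y yI; apply: mulr_ge0; first by apply: om_ge0 => //; exact: clo.
  exact: (lam_ge0 W).
by have := le_trans (ler_norm _) h; lra.
Qed.

(** Sign propagation for - theta_x on [m0, l]: since u <= 0, characteristics leave through m0, which
    is the favourable sign of the boundary term. The time T is excluded because m0 = l is allowed
    and the vanishing at l is known only for 0 < t < T. *)
Let ze_supp x t : m0 <= x <= l -> 0 <= t < T -> ze s x t = 0.
Proof.
move=> xI /andP[t0 tT].
have hx y : m0 <= y <= l -> 0 <= y <= l.
  by move=> /andP[my ->]; rewrite (le_trans (ltW m00) my).
have tI : 0 <= t <= T by rewrite t0 ltW.
apply/eqP; rewrite eq_le ze_ge0 ?hx// andbT -oppr_ge0.
have [ml|ml] := ltP m0 l; last first.
  have -> : x = l by apply/eqP; rewrite eq_le; case/andP: xI => h1 ->; exact: le_trans ml h1.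
  move: t0; rewrite le_eqVlt => /predU1P[<-|t0].
    by rewrite ze_init_supp ?oppr0// m0l lexx.
  by rewrite zel ?oppr0// t0.
have [A _ HA] := uxA.
move: x t xI {t0 tT} tI.
apply: (@transport_nonneg _ m0 l T 1 A _ _ _ (u s) (ux s) (fun _ _ => 0)
  ml _ (C1_neg (C1_ze s))).
- by rewrite normr1.
- by move=> x t /hx/half xI tI; exact: d_u.
- move=> t tI; have h := cts_ux s tI; apply: ctsS h => //.
  by rewrite (le_trans _ (ltW m00))// oppr_le0 ltW.
- by move=> t tI; exact: cts_cst.
- by move=> x t /hx/half xI tI; exact: HA.
- move=> x t /hx/half xI tI; have := eq_ze s xI tI.
  by rewrite mul1r => h; rewrite -[RHS]oppr0 -h; ring.
- by [].
- move=> t tI; rewrite zel// oppr0 negsq0 mulr0.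
  apply: mulr_le0_ge0; last exact: negsq_ge0.
  by apply: u_le0 => //; rewrite m0l ltW.
- by move=> x xI; rewrite ze_init_supp// oppr0.
Qed.

Let th0 t : 0 <= t <= T -> th s 0 t = 0.
Proof.
move=> /andP[t0 tT]; have [C0th _ _ _ dth] := C1_th s.
have ct : {within `[0, T], continuous (th s 0)} := C0_slicet C0th (lexx 0).
have H := @MVT_bound _ 0 T (th s 0) (tht s 0) 0 ct.
have : `|th s 0 t - th s 0 0| <= 0 * `|t - 0|.
  apply: H; rewrite ?lexx ?t0 ?tT ?(ltW T0)//.
  - by move=> r /andP[r0 _]; exact: dth.
  - move=> r rI; have := eq_th s in0 rI.
    by rewrite u0// mul0r addr0 => ->; rewrite normr0.
by rewrite mul0r normr_le0 subr_eq0 th_init0 => /eqP.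
Qed.

(** Orders of vanishing at 0: one for omega, theta_x and u, two for theta because theta(0) = 0 and
    theta_x = O(x). They compensate w = O(1/x) and q = O(1/x^2) in all integrands below. *)
Let bounds : exists2 A, 0 <= A & forall x t, - l <= x <= l -> 0 <= t <= T ->
  [/\ `|om s x t| <= A * `|x|, `|ze s x t| <= A * `|x|,
      `|th s x t| <= A * `|x| ^+ 2, `|omx s x t| <= A /\ `|zex s x t| <= A &
      `|omt s x t| <= A /\ (0 < t < T -> `|u s x t| <= A * `|x| /\ `|ux s x t| <= A)].
Proof.
have [A1 [A10 _ o1 o2]] := C1_bounded (- l) l T (C1_om s).
have [A2 [A20 _ z1 _]] := C1_bounded (- l) l T (C1_ze s).
have [A3 A30 HA] := uxA.
exists (A1 + A2 + A3); first by rewrite !addr_ge0.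
have van (f df : R -> R) (A : R) : (forall y, - l <= y <= l -> is_derive y 1 f (df y)) ->
    (forall y, - l <= y <= l -> `|df y| <= A) -> f 0 = 0 ->
    forall y, - l <= y <= l -> `|f y| <= A * `|y|.
  move=> df1 dfA f0 y yI.
  have oo r : - l < r < l -> - l <= r <= l by move=> /andP[? ?]; rewrite !ltW.
  have := @MVT_bound _ (- l) l f df A (cts_within (is_derive_cts df1))
    (fun r rI => df1 r (oo r rI)) (fun r rI => dfA r (oo r rI)) y 0 yI in0.
  by rewrite f0 !subr0.
move=> x t xI tI; have /andP[t0 _] := tI.
have [_ _ _ dom _] := C1_om s; have [_ _ _ dze _] := C1_ze s.
have [_ _ _ dth _] := C1_th s.
have x0 := normr_ge0 x.
have B1 : `|om s x t| <= A1 * `|x|.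
  apply: (van (om s ^~ t) (omx s ^~ t)) => //; [|by move=> y yI; exact: o1|exact: om0].
  by move=> y _; exact: dom.
have B2 y : - l <= y <= l -> `|ze s y t| <= A2 * `|y|.
  apply: (van (ze s ^~ t) (zex s ^~ t)) => //; [|by move=> z zI; exact: z1|exact: ze0].
  by move=> z _; exact: dze.
have B3 : `|th s x t| <= A2 * `|x| ^+ 2.
  have cth : {within `[- `|x|, `|x|], continuous (th s ^~ t)}.
    by apply: cts_within; have [] := cslice (- `|x|) `|x| (C1_th s) t0.
  have bz r : - `|x| < r < `|x| -> `|ze s r t| <= A2 * `|x|.
    move=> /andP[r1 r2].
    have rx : `|r| <= `|x| by rewrite ler_norml !ltW.
    have xl : `|x| <= l by rewrite ler_norml.
    apply: le_trans (B2 r _) _; first by rewrite -ler_norml (le_trans rx).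
    exact: ler_wpM2l.
  have := @MVT_bound _ (- `|x|) `|x| (th s ^~ t) (ze s ^~ t) (A2 * `|x|) cth
    (fun r _ => dth r t t0) bz x 0.
  rewrite th0// !subr0 expr2 mulrA; apply.
    by rewrite -ler_norml.
  by rewrite oppr_le0 x0.
have H1 : A1 * `|x| <= (A1 + A2 + A3) * `|x| by apply: ler_wpM2r => //; lra.
have H2 : A2 * `|x| <= (A1 + A2 + A3) * `|x| by apply: ler_wpM2r => //; lra.
have H3 : A2 * `|x| ^+ 2 <= (A1 + A2 + A3) * `|x| ^+ 2.
  by apply: ler_wpM2r; [exact: sqr_ge0|lra].
have h1 := o1 x t xI tI; have h2 := o2 x t xI tI; have h3 := z1 x t xI tI.
split.
- exact: le_trans B1 H1.
- exact: le_trans (B2 x xI) H2.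
- exact: le_trans B3 H3.
- by split; lra.
- split; first by lra.
  move=> tI'; split; last by have := HA x t xI tI'; lra.
  apply: (@le_trans _ _ (A3 * `|x|)); last by apply: ler_wpM2r => //; lra.
  apply: (van (u s ^~ t) (ux s ^~ t)) => //; [|by move=> y yI; exact: HA|exact: u0].
  by move=> y yI; exact: d_u.
Qed.

(** p may grow like |x|^-n near 0, where its stored value is 0; one extra power in g makes the
    product tend to that value. Used with n = 1 for w and n = 2 for q. The bounds cover negative x
    as well because [cts] is two-sided at 0. *)
Let cts_weight (b : R) (p g : R -> R) (C D : R) (n : nat) : b <= l -> p 0 = 0 ->
  (forall x, 0 < x <= l -> {for x, continuous p}) ->
  (forall x, - l <= x <= l -> `|p x| * `|x| ^+ n <= C) -> 0 <= D ->
  cts 0 b g -> (forall x, - l <= x <= l -> `|g x| <= D * `|x| ^+ n.+1) ->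
  cts 0 b (fun x => g x * p x).
Proof.
move=> bl p0 cp pC D0 cg gD x /andP[]; rewrite le_eqVlt => /predU1P[<- b0|x0 xb]; last first.
  apply: continuousM; first by apply: cg; rewrite xb ltW.
  by apply: cp; rewrite x0 (le_trans xb).
have C0 : 0 <= C by apply: le_trans (pC 0 in0); rewrite mulr_ge0.
rewrite /continuous_at /prop_for p0 mulr0; apply/cvgrPdist_le => e e0.
near=> y; rewrite sub0r normrN normrM.
have yl : - l <= y <= l.
  by rewrite -ler_norml; near: y; apply: (@nbhs0_le _ R^o).
have ye : `|y| <= e / (D * C + 1).
  by near: y; apply: (@nbhs0_le _ R^o); rewrite divr_gt0// ltr_wpDl// mulr_ge0.
have h1 := ler_wpM2r (normr_ge0 (p y)) (gD y yl).
apply: le_trans h1 _.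
have -> : D * `|y| ^+ n.+1 * `|p y| = D * (`|p y| * `|y| ^+ n) * `|y| by rewrite exprS; ring.
apply: (@le_trans _ _ (D * C * `|y|)).
  by apply: ler_wpM2r => //; apply: ler_wpM2l => //; exact: pC.
apply: (@le_trans _ _ ((D * C + 1) * `|y|)).
  by apply: ler_wpM2r => //; lra.
by rewrite mulrC -ler_pdivlMr// ltr_wpDl// mulr_ge0.
Unshelve. all: end_near. Qed.

Lemma cts_weighted (b D : R) g : b <= l -> 0 <= D -> cts 0 b g ->
  (forall x, - l <= x <= l -> `|g x| <= D * `|x| ^+ 2) -> cts 0 b (fun x => g x * w x).
Proof.
move=> bl D0 cg gD; have [C _ HC] := wq_bound W.
apply: (@cts_weight b w g C D 1%N) => //; first exact: (w_at0 W).
- by move=> x xI; exact: is_derive_continuous (w_derive W xI).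
- by move=> x xI; rewrite expr1; have [] := HC x xI.
Qed.

Let ctsq (b D : R) g : b <= l -> 0 <= D -> cts 0 b g ->
  (forall x, - l <= x <= l -> `|g x| <= D * `|x| ^+ 3) -> cts 0 b (fun x => g x * q x).
Proof.
move=> bl D0 cg gD; have [C _ HC] := wq_bound W.
apply: (@cts_weight b q g C D 2%N) => //; first exact: (q_at0 W).
- by move=> x xI; exact: (q_continuous W xI).
- by move=> x xI; have [] := HC x xI.
Qed.

Let tdiffw (b D : R) (F Ft : R -> R -> R) : b <= l -> 0 <= D ->
  tdiff 0 b 0 T F Ft ->
  (forall x t, - l <= x <= l -> 0 <= t <= T -> `|F x t| <= D * `|x| ^+ 2) ->
  (forall x t, - l <= x <= l -> 0 < t < T -> `|Ft x t| <= D * `|x| ^+ 2) ->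
  tdiff 0 b 0 T (fun x t => F x t * w x) (fun x t => Ft x t * w x).
Proof.
move=> bl D0 [cx ct dF _] FD FtD; have [C C0 HC] := wq_bound W.
have hb x : 0 <= x <= b -> - l <= x <= l.
  by move=> /andP[x1 x2]; apply: half; rewrite x1 (le_trans x2).
have wD (r : R) x : 0 <= x <= b -> `|r| <= D * `|x| ^+ 2 -> `|r * w x| <= D * l * C.
  move=> xI rD; have [h _] := HC x (hb x xI); have /andP[x1 x2] := xI.
  rewrite normrM; apply: le_trans (ler_wpM2r (normr_ge0 _) rD) _.
  have -> : D * `|x| ^+ 2 * `|w x| = D * `|x| * (`|w x| * `|x|) by ring.
  apply: ler_pM => //; first by rewrite mulr_ge0.
  by apply: ler_wpM2l => //; rewrite ger0_norm// (le_trans x2).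
split.
- move=> t tI; apply: (@cts_weighted b D) => //; first exact: cx.
  by move=> x xI; exact: FD.
- move=> x xI t; apply: cvgM; [exact: ct|exact: cvg_cst].
- move=> x t xI tI; apply: (isd_eq (isdM (dF x t xI tI) (isd_cst _ (w x)))).
  by rewrite mulr0 addr0.
- exists (D * l * C); split=> x t xI tI; apply: wD => //.
    by apply: FD => //; exact: hb.
  by apply: FtD => //; exact: hb.
Qed.

Let tht_bound A x t : 0 <= A -> `|ze s x t| <= A * `|x| -> `|u s x t| <= A * `|x| ->
  - l <= x <= l -> 0 < t < T -> `|tht s x t| <= A * A * `|x| ^+ 2.
Proof.
move=> A1 h1 h2 xI tI.
have -> : tht s x t = - (u s x t * ze s x t) by rewrite -[LHS]subr0 -(eq_th s xI tI); ring.
rewrite normrN normrM; apply: le_trans (ler_pM _ _ h2 h1) _ => //.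
by rewrite le_eqVlt; apply/orP; left; apply/eqP; ring.
Qed.

Let I t := rint 0 m0 (fun x => th s x t * w x).
Let I' t := rint 0 m0 (fun x => tht s x t * w x).
Let J t := rint 0 l (fun x => th s x t * om s x t * w x).
Let J' t := rint 0 l (fun x => (tht s x t * om s x t + th s x t * omt s x t) * w x).

Let I_diff : {within `[0, T], continuous I} /\
  forall t, 0 < t < T -> is_derive t 1 I (I' t).
Proof.
have [A A1 HA] := bounds.
apply: (tdiff_rint (F := fun x t => th s x t * w x)
  (Ft := fun x t => tht s x t * w x) (ltW m00)).
apply: (@tdiffw m0 (A + A * A)) => //.
- by rewrite addr_ge0// mulr_ge0.
- exact: C1_tdiff (C1_th s).
- move=> x t xI tI; have [_ _ h _ _] := HA x t xI tI; apply: le_trans h _.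
  by apply: ler_wpM2r; [exact: sqr_ge0|rewrite lerDl mulr_ge0].
- move=> x t xI tI; have [_ h1 _ _ [_ /(_ tI)[h2 _]]] := HA x t xI (clo tI).
  apply: le_trans (tht_bound A1 h1 h2 xI tI) _.
  by apply: ler_wpM2r; [exact: sqr_ge0|rewrite lerDr].
Qed.

Let J_diff : {within `[0, T], continuous J} /\
  forall t, 0 < t < T -> is_derive t 1 J (J' t).
Proof.
have [A A1 HA] := bounds.
have nl x : - l <= x <= l -> `|x| <= l by rewrite ler_norml.
apply: (tdiff_rint (F := fun x t => th s x t * om s x t * w x)
  (Ft := fun x t => (tht s x t * om s x t + th s x t * omt s x t) * w x) (ltW l0)).
apply: (@tdiffw l (A * A * l + (A * A * (A * l) + A * A))) => //.
- by rewrite !(addr_ge0, mulr_ge0)// ltW.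
- exact: tdiffM (C1_tdiff _ _ _ (lexx 0) (C1_th s)) (C1_tdiff _ _ _ (lexx 0) (C1_om s)).
- move=> x t xI tI; have [h1 _ h2 _ _] := HA x t xI tI; rewrite normrM.
  apply: le_trans (ler_pM _ _ h2 h1) _ => //.
  have -> : A * `|x| ^+ 2 * (A * `|x|) = A * A * `|x| * `|x| ^+ 2 by ring.
  apply: ler_wpM2r; first exact: sqr_ge0.
  apply: (@le_trans _ _ (A * A * l)).
    by apply: ler_wpM2l; [rewrite mulr_ge0|exact: nl].
  by rewrite lerDl !(addr_ge0, mulr_ge0)// ltW.
- move=> x t xI tI; have [h0 h1 h3 _ [h4 /(_ tI)[h2 _]]] := HA x t xI (clo tI).
  have h5 := tht_bound A1 h1 h2 xI tI.
  apply: le_trans (ler_normD _ _) _; rewrite !normrM.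
  apply: le_trans (lerD (ler_pM _ _ h5 h0) (ler_pM _ _ h3 h4)) _ => //.
  have -> : A * A * `|x| ^+ 2 * (A * `|x|) + A * `|x| ^+ 2 * A =
     (A * A * (A * `|x|) + A * A) * `|x| ^+ 2 by ring.
  apply: ler_wpM2r; first exact: sqr_ge0.
  apply: (@le_trans _ _ (A * A * (A * l) + A * A)).
    apply: lerD => //; apply: ler_wpM2l; first by rewrite mulr_ge0.
    by apply: ler_wpM2l => //; exact: nl.
  by rewrite lerDr !mulr_ge0// ltW.
Qed.

Let cts_th t b : 0 <= t -> cts 0 b (th s ^~ t).
Proof. by move=> h; have [] := cslice 0 b (C1_th s) h. Qed.
Let cts_ze t b : 0 <= t -> cts 0 b (ze s ^~ t).
Proof. by move=> h; have [] := cslice 0 b (C1_ze s) h. Qed.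
Let cts_om t b : 0 <= t -> cts 0 b (om s ^~ t).
Proof. by move=> h; have [] := cslice 0 b (C1_om s) h. Qed.
Let cts_omx t b : 0 <= t -> cts 0 b (omx s ^~ t).
Proof. by move=> h; have [] := cslice 0 b (C1_om s) h. Qed.

Let cts_u t : 0 < t < T -> cts 0 l (u s ^~ t).
Proof.
move=> tI; apply: (is_derive_cts (df := ux s ^~ t)) => x xI.
by apply: d_u => //; exact: half.
Qed.

Let cts_ux' t : 0 < t < T -> cts 0 l (ux s ^~ t).
Proof. by move=> tI; have h := cts_ux s tI; apply: ctsS h; rewrite ?oppr_le0 ?(ltW l0). Qed.

Let th_mono x y t : 0 <= x -> x <= y -> y <= l -> 0 <= t <= T -> th s x t <= th s y t.
Proof.
move=> x0 xy yl tI; have /andP[t0 tT] := tI.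
have [_ _ _ dth _] := C1_th s.
apply: (@nondecreasing_within _ 0 l (th s ^~ t) (ze s ^~ t)) => //.
- by apply: cts_within; exact: cts_th.
- by move=> z _; exact: dth.
- by move=> z /andP[z0 zl]; apply: ze_ge0 => //; rewrite !ltW.
Qed.

Let th_ge0 x t : 0 <= x <= l -> 0 <= t <= T -> 0 <= th s x t.
Proof. by move=> /andP[x0 xl] tI; rewrite -(th0 tI); exact: th_mono. Qed.

(** The part y < x of the folded integral is nonnegative and dropped; on y >= x [lam_lower] applies.
    Its error constant depends on x, so the limit in [lam] is taken at fixed x > 0. *)
Let velocity_lower x t : 0 < x <= l -> 0 < t < T ->
  pi^-1 * rint x l (fun y => om s y t * w y) <= - (u s x t * w x).
Proof.
move=> /andP[x0 xl] tI; have tI' := clo tI; have /andP[t0 _] := tI'.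
have [M M0 HM] : exists2 M, 0 <= M & forall lam y, 0 < lam -> x <= y <= l ->
    w y - M * expR (- lam) <= w x * (kd lam (x + y) - kd lam (x - y)).
  by apply: (lam_lower W); rewrite x0.
have [C C0 HC] := u_approx s.
have [A A1 HA] := bounds.
have xI : 0 <= x <= l by rewrite (ltW x0).
have wx0 := w_ge0 W xI.
have /andP[p0 p1] := @pi_inv_bound R.
have sub y : x <= y <= l -> 0 <= y <= l.
  by move=> /andP[xy ->]; rewrite (le_trans (ltW x0)).
have comx : cts x l (om s ^~ t).
  by have h := @cts_om t l t0; apply: ctsS h => //; exact: ltW.
have cwx : cts x l w.
  apply: (is_derive_cts (df := fun y => - q y)) => y /andP[xy yl].
  by apply: (w_derive W); rewrite yl (lt_le_trans x0 xy).
apply: (@le_of_exp_error _ _ (C * w x + pi^-1 * (M * (A * l) * (l - x)))) => lam lam0.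
have [h _] := HC lam x t lam0 (half xI) tI.
have ck := ckd lam0.
have ckp : cts 0 l (fun y => kd lam (x + y)).
  apply: continuous_cts => y; apply: (@continuous_comp _ _ _ (fun y => x + y) (kd lam)).
    exact: is_derive_continuous (isdD (isd_cst y x) (isd_id y)).
  exact: ck.
have ckm : cts 0 l (fun y => kd lam (x - y)).
  by apply: continuous_cts; exact: continuous_subr.
have cint : cts 0 l (fun y => om s y t * (kd lam (x + y) - kd lam (x - y))).
  by apply: ctsM; [exact: cts_om|exact: ctsB].
have cintx : cts x l (fun y => om s y t * (kd lam (x + y) - kd lam (x - y))).
  by have h' := cint; apply: ctsS h' => //; exact: ltW.
have e0 := expR_ge0 (- lam).
have S : w x * rint x l (fun y => om s y t * (kd lam (x + y) - kd lam (x - y))) <=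
    w x * rint 0 l (fun y => om s y t * (kd lam (x + y) - kd lam (x - y))).
  apply: ler_wpM2l => //; rewrite [leRHS](@rint_split _ _ _ x) ?(ltW x0)//; last first.
    exact: cts_integrable.
  rewrite lerDr; apply: rint_ge0 => y /andP[y0 yx].
  have yI : 0 <= y <= l by rewrite y0 (le_trans yx).
  by apply: mulr_ge0; [exact: om_ge0|exact: (lam_ge0 W)].
have L : rint x l (fun y => om s y t * w y) - M * expR (- lam) * (A * l) * (l - x) <=
    w x * rint x l (fun y => om s y t * (kd lam (x + y) - kd lam (x - y))).
  rewrite -(rint_cst _ xl) -(rintZ _ cintx) -rintB; [|exact: ctsM|exact: cts_cst].
  apply: le_rint.
  - by apply: ctsB; [exact: ctsM|exact: cts_cst].
  - exact: ctsZ.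
  - move=> y yI; have om0y := om_ge0 (sub y yI) tI'.
    have oA : om s y t <= A * l.
      have [h1 _ _ _ _] := HA y t (half (sub y yI)) tI'.
      apply: le_trans (ler_norm _) _; apply: le_trans h1 _.
      by apply: ler_wpM2l => //; rewrite ler_norml half// sub.
    have h2 := ler_wpM2l om0y (HM lam y lam0 yI).
    have h3 : om s y t * (M * expR (- lam)) <= M * expR (- lam) * (A * l).
      by rewrite mulrC; apply: ler_wpM2l => //; rewrite mulr_ge0.
    have -> : w x * (om s y t * (kd lam (x + y) - kd lam (x - y))) =
       om s y t * (w x * (kd lam (x + y) - kd lam (x - y))) by ring.
    by apply: le_trans h2; rewrite mulrBr lerB.
have h4 : - (u s x t) >= pi^-1 * rint 0 l (fun y => om s y t * (kd lam (x + y) - kd lam (x - y))) - C * expR (- lam).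
  move: h; rewrite (velE _ ck tI') opprK => /ler_normlP[_]; lra.
have h5 := ler_wpM2r wx0 h4.
have h6 := ler_wpM2l (ltW p0) (le_trans L S).
rewrite -mulNr.
move: h5 h6; set X := rint 0 l _; set Y := rint x l _ => h5 h6.
rewrite mulrBl in h5.
have -> : (C * w x + pi^-1 * (M * (A * l) * (l - x))) * expR (- lam) =
  C * expR (- lam) * w x + pi^-1 * (M * expR (- lam) * (A * l) * (l - x)) by ring.
have E : pi^-1 * X * w x = pi^-1 * (w x * X) by ring.
by rewrite E in h5; rewrite mulrBr in h6; lra.
Qed.

Let nl x : - l <= x <= l -> `|x| <= l. Proof. by rewrite ler_norml. Qed.

Let cts_J t : 0 <= t <= T -> cts 0 l (fun x => th s x t * om s x t * w x).
Proof.
move=> tI; have /andP[t0 _] := tI; have [A A1 HA] := bounds.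
apply: (@cts_weighted l (A * A * l)) => //.
- by rewrite !mulr_ge0// ltW.
- by apply: ctsM; [exact: cts_th|exact: cts_om].
- move=> x xI; have [h1 _ h2 _ _] := HA x t xI tI; rewrite normrM.
  apply: le_trans (ler_pM _ _ h2 h1) _ => //.
  have -> : A * `|x| ^+ 2 * (A * `|x|) = A * A * `|x| * `|x| ^+ 2 by ring.
  apply: ler_wpM2r; first exact: sqr_ge0.
  by apply: ler_wpM2l; [rewrite mulr_ge0|exact: nl].
Qed.

Let thtE x t : - l <= x <= l -> 0 < t < T -> tht s x t = - (u s x t * ze s x t).
Proof. by move=> xI tI; rewrite -[LHS]subr0 -(eq_th s xI tI); ring. Qed.

Let cts_I' t : 0 < t < T -> cts 0 l (fun x => tht s x t * w x).
Proof.
move=> tI; have [A A1 HA] := bounds.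
have /andP[/ltW t0 _] := tI.
apply: (@cts_weighted l (A * A)) => //.
- by rewrite mulr_ge0.
- by have [] := cslice 0 l (C1_th s) t0.
- by move=> x xI; have [_ h1 _ _ [_ /(_ tI)[h2 _]]] := HA x t xI (clo tI); exact: tht_bound.
Qed.

(** Inserting [velocity_lower] in the integral of - u theta_x w leaves theta_x times a tail of the
    integral of omega w, and integration by parts makes this J. The product omega w may jump at 0,
    where w is 0 by convention, so the computation is done on [e, l] with e = l exp(- lam) and the
    omitted pieces are O(e). *)
Let I_lower t : 0 < t < T -> pi^-1 * J t <= I' t.
Proof.
move=> tI; have tI' := clo tI; have /andP[t0 tT] := tI'.
have [A A1 HA] := bounds; have [C C0 HC] := wq_bound W.
have /andP[p0 p1] := @pi_inv_bound R.
have [_ _ _ dth _] := C1_th s.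
have cJ := cts_J tI'; have cI := cts_I' tI.
have int_ge0 x : 0 <= x <= l -> 0 <= tht s x t * w x.
  move=> xI; rewrite thtE//; last exact: half.
  apply: mulr_ge0; last exact: (w_ge0 W).
  by rewrite oppr_ge0 mulr_le0_ge0 ?u_le0 ?ze_ge0.
(* theta_t = - u theta_x vanishes beyond m0, so the upper limit m0 of I may be replaced by l. *)
have E0 : I' t = rint 0 l (fun x => tht s x t * w x).
  rewrite /I' [RHS](@rint_split _ _ _ m0) ?(ltW m00)//; last exact: cts_integrable.
  have -> : rint m0 l (fun x => tht s x t * w x) = rint m0 l (fun=> 0).
    apply: eq_rint => x xI; rewrite thtE//.
      rewrite ze_supp// ?mulr0 ?oppr0 ?mul0r// t0.
      by case/andP: tI.
    by apply: half; case/andP: xI => h ->; rewrite (le_trans (ltW m00) h).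
  by rewrite rint_cst// mul0r addr0.
apply: (@le_of_exp_error _ _ (pi^-1 * (2 * (A * A * l * l * C) * l))) => lam lam0.
pose e := l * expR (- lam).
have e0 : 0 < e by rewrite mulr_gt0// expR_gt0.
have el : e < l.
  rewrite -[ltRHS]mulr1 ltr_pM2l// -[ltRHS]expR0 ltr_expR oppr_lt0//.
have xe x : e <= x <= l -> 0 <= x <= l.
  by move=> /andP[h ->]; rewrite (le_trans (ltW e0) h).
have xe' x : 0 <= x <= e -> 0 <= x <= l.
  by move=> /andP[-> h]; rewrite (le_trans h (ltW el)).
have cz : cts e l (ze s ^~ t).
  by have h := @cts_ze t l t0; apply: ctsS h => //; exact: ltW.
have cow : cts e l (fun x => om s x t * w x).
  apply: ctsM; first by have h := @cts_om t l t0; apply: ctsS h => //; exact: ltW.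
  apply: (is_derive_cts (df := fun y => - q y)) => y /andP[ey yl].
  by apply: (w_derive W); rewrite yl (lt_le_trans e0 ey).
have [G cG [GE GP]] := @rint_tail_parts R e l (th s ^~ t) (ze s ^~ t) _ el
  (fun x _ => dth x t t0) cz cow.
have L1 : pi^-1 * rint e l (fun x => ze s x t * G x) <= rint e l (fun x => tht s x t * w x).
  rewrite -rintZ; last exact: ctsM.
  apply: le_rint.
  - by apply: ctsZ; exact: ctsM.
  - by have h := cI; apply: ctsS h => //; exact: ltW.
  - move=> x xI; rewrite thtE//; last by apply: half; exact: xe.
    have xI' : 0 < x <= l by case/andP: xI => h ->; rewrite (lt_le_trans e0 h).
    have h := velocity_lower xI' tI; rewrite -GE// in h.
    have h2 := ler_wpM2l (ze_ge0 (xe x xI) tI') h.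
    by have := h2; rewrite !mulrA (mulrC _ (pi^-1)) => /le_trans; apply; rewrite le_eqVlt; apply/orP; left; apply/eqP; ring.
have omwA x : 0 <= x <= l -> `|om s x t * w x| <= A * C.
  move=> /half xI; have [h1 _ _ _ _] := HA x t xI tI'; have [h2 _] := HC x xI.
  rewrite normrM; apply: le_trans (ler_wpM2r (normr_ge0 _) h1) _.
  by rewrite -mulrA (mulrC `|x|); exact: ler_wpM2l.
have thA x : 0 <= x <= l -> th s x t <= A * x ^+ 2.
  move=> xI; have [_ _ h _ _] := HA x t (half xI) tI'.
  apply: le_trans (ler_norm _) _; apply: le_trans h _.
  by rewrite real_normK ?num_real.
have L2 : rint e l (fun x => om s x t * w x) <= A * C * l.
  apply: (@le_trans _ _ (A * C * (l - e))); last first.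
    by apply: ler_wpM2l; [rewrite mulr_ge0|rewrite lerBlDr lerDl ltW].
  rewrite -(rint_cst _ (ltW el)); apply: le_rint => //; first exact: cts_cst.
  by move=> x /xe xI; apply: le_trans (ler_norm _) (omwA x xI).
have L3 : rint 0 e (fun x => th s x t * om s x t * w x) <= A * A * l * l * C * e.
  have -> : A * A * l * l * C * e = A * A * l * l * C * (e - 0) by rewrite subr0.
  rewrite -(rint_cst _ (ltW e0)); apply: le_rint; [|exact: cts_cst|].
    by have h := cJ; apply: ctsS h => //; exact: ltW.
  move=> x /xe' xI; have /andP[x0 xl] := xI.
  rewrite -mulrA; apply: le_trans (ler_norm _) _; rewrite normrM.
  have -> : A * A * l * l * C = A * l ^+ 2 * (A * C) by ring.
  apply: ler_pM => //; last exact: omwA.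
  rewrite (ger0_norm (th_ge0 xI tI')); apply: le_trans (thA x xI) _.
  by apply: ler_wpM2l => //; rewrite lerXn2r ?nnegrE// ltW.
have L4 : th s e t * rint e l (fun x => om s x t * w x) <= A * A * l * l * C * e.
  have eI : 0 <= e <= l by rewrite !ltW.
  have h1 := thA e eI.
  have h2 : A * e ^+ 2 <= A * (l * e).
    by apply: ler_wpM2l => //; rewrite expr2; apply: ler_wpM2r; exact: ltW.
  apply: le_trans (ler_pM _ _ (le_trans h1 h2) L2) _.
  - exact: th_ge0.
  - by apply: rint_ge0 => x /xe xI; rewrite mulr_ge0 ?om_ge0 ?(w_ge0 W).
  - by rewrite le_eqVlt; apply/orP; left; apply/eqP; ring.
have L5 : 0 <= rint 0 e (fun x => tht s x t * w x).
  by apply: rint_ge0 => x /xe'; exact: int_ge0.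
have S1 := @rint_split R 0 l e _ _ (cts_integrable cI).
have S2 := @rint_split R 0 l e _ _ (cts_integrable cJ).
have eI : 0 <= e <= l by rewrite !ltW.
rewrite E0 (S1 eI) /J (S2 eI).
have GP' : rint e l (fun x => th s x t * om s x t * w x) =
   rint e l (fun x => ze s x t * G x) + th s e t * rint e l (fun x => om s x t * w x).
  rewrite GP subrK; apply: eq_rint => x _; by rewrite mulrA.
rewrite GP'.
have h := ler_wpM2l (ltW p0) (lerD L3 L4).
move: L1 h L5.
set a1 := rint 0 e _; set a2 := rint e l _; set a3 := rint 0 e _; set a4 := rint e l _.
set a5 := th s e t * _ => L1 h L5.
have -> : pi^-1 * (2 * (A * A * l * l * C) * l) * expR (- lam) =
  pi^-1 * (A * A * l * l * C * e + A * A * l * l * C * e) by rewrite /e; ring.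
move: h; rewrite !mulrDr; lra.
Qed.

(** Away from 0 this is the product rule with w' = - q; at 0 the product g w is O(x^2), so its
    derivative is 0, which agrees with the formula because w 0 = q 0 = 0. *)
Let d_weight (g dg : R -> R) (D : R) : 0 <= D ->
  (forall x, 0 <= x <= l -> is_derive x 1 g (dg x)) ->
  (forall x, - l <= x <= l -> `|g x| <= D * `|x| ^+ 3) ->
  forall x, 0 <= x <= l ->
  is_derive x 1 (fun x => g x * w x) (dg x * w x - g x * q x).
Proof.
move=> D0 dg1 gD x /andP[]; rewrite le_eqVlt => /predU1P[<- _|x0 xl].
  rewrite (w_at0 W) (q_at0 W) !mulr0 subr0; have [C C0 HC] := wq_bound W.
  apply: (@is_derive_quadratic _ _ _ (D * C) l) => //.
    by rewrite (w_at0 W) mulr0.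
  move=> y; rewrite subr0 => /ltW; rewrite ler_norml => yl.
  have [h _] := HC y yl; rewrite normrM.
  apply: le_trans (ler_wpM2r (normr_ge0 _) (gD y yl)) _.
  have -> : D * `|y| ^+ 3 * `|w y| = D * (`|w y| * `|y|) * `|y| ^+ 2 by ring.
  rewrite real_normK ?num_real//; apply: ler_wpM2r; first exact: sqr_ge0.
  exact: ler_wpM2l.
have xI : 0 <= x <= l by rewrite ltW.
have x0l : 0 < x <= l by rewrite x0.
apply: (isd_eq (isdM (dg1 x xI) (w_derive W x0l))); ring.
Qed.

Let rint_weight (g dg : R -> R) (D : R) : 0 <= D ->
  (forall x, 0 <= x <= l -> is_derive x 1 g (dg x)) ->
  (forall x, - l <= x <= l -> `|g x| <= D * `|x| ^+ 3) ->
  cts 0 l dg ->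
  (forall x, - l <= x <= l -> `|dg x| <= D * `|x| ^+ 2) ->
  cts 0 l (fun x => dg x * w x - g x * q x) /\
  rint 0 l (fun x => dg x * w x - g x * q x) = g l * w l.
Proof.
move=> D0 dg1 gD cdg dgD.
have cg := is_derive_cts dg1.
have c1 : cts 0 l (fun x => dg x * w x - g x * q x).
  by apply: ctsB; [exact: (@cts_weighted l D)|exact: (@ctsq l D)].
split=> //.
rewrite (rint_FTC (ltW l0) (d_weight D0 dg1 gD) c1).
by rewrite (w_at0 W) mulr0 subr0.
Qed.

Let q_ge0 x : 0 <= x <= l -> 0 <= q x.
Proof.
by move=> xI; apply: le_trans (q_ge W xI); rewrite mulr_ge0 ?sqr_ge0// ltW.
Qed.

Let convol_continuousD (f k : R -> R) : cts 0 l f -> continuous k ->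
  continuous (fun x => rint 0 l (fun y => f y * k (y + x))).
Proof.
move=> cf ck x.
have ckN : continuous (fun z => k (- z)).
  move=> z; apply: (@continuous_comp _ _ _ (fun z : R => - z) k); last exact: ck.
  exact: opp_continuous.
have H := @convol_continuous R 0 l f _ cf ckN.
have E : (fun x => rint 0 l (fun y => f y * k (y + x))) =
  (fun z => rint 0 l (fun y => f y * k (- (z - y)))) \o (fun x => - x).
  apply/funext => z /=; apply: eq_rint => y _; congr (_ * k _); ring.
rewrite E; apply: continuous_comp; first exact: opp_continuous.
exact: H.
Qed.

(* Symmetrisation: for x >= y the weight th x >= th y multiplies the
   nonpositive quantity H x y, and H x y + H y x <= 0. *)
Let kernel_sign lam t : 0 < lam -> 0 < t < T ->
  0 <= rint 0 l (fun x =>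
    vel l (kd' lam) (om s ^~ t) x * (th s x t * om s x t * w x) -
    vel l (kd lam) (om s ^~ t) x * (th s x t * om s x t * q x)).
Proof.
move=> lam0 tI; have tI' := clo tI; have /andP[t0 tT] := tI'.
have /andP[p0 p1] := @pi_inv_bound R.
have [A A1 HA] := bounds.
have ck := ckd lam0; have ck' := kf_continuous KF lam0.
pose Wf x := th s x t * om s x t * w x; pose Zf x := th s x t * om s x t * q x.
have cW : cts 0 l Wf := cts_J tI'.
have co := @cts_om t l t0.
have cZ : cts 0 l Zf.
  apply: (@ctsq l (A * A)) => //.
  - by rewrite mulr_ge0.
  - by apply: ctsM => //; exact: cts_th.
  - move=> x xI; have [h1 _ h2 _ _] := HA x t xI tI'; rewrite normrM.
    apply: le_trans (ler_pM _ _ h2 h1) _ => //.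
    by rewrite le_eqVlt; apply/orP; left; apply/eqP; ring.
(* Phi x y is theta(x) omega(x) omega(y) H x y, where H x y is the x-derivative of w x * (kd lam (x
   + y) - kd lam (x - y)), as w' = - q. *)
pose Phi x y := om s y t * (Wf x * (kd' lam (x + y) - kd' lam (x - y)) -
   Zf x * (kd lam (x + y) - kd lam (x - y))).
have cadd (k : R -> R) x : continuous k -> cts 0 l (fun y => k (x + y)).
  move=> ckk; apply: continuous_cts => y.
  apply: (@continuous_comp _ _ _ (fun y => x + y) k); last exact: ckk.
  exact: is_derive_continuous (isdD (isd_cst y x) (isd_id y)).
have csub (k : R -> R) x : continuous k -> cts 0 l (fun y => k (x - y)).
  by move=> ckk; apply: continuous_cts; exact: continuous_subr.
have cK (k : R -> R) x : continuous k -> cts 0 l (fun y => k (x + y) - k (x - y)).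
  by move=> ckk; apply: ctsB; [exact: cadd|exact: csub].
have cPhi x : cts 0 l (Phi x).
  apply: ctsM => //; apply: ctsB; apply: ctsZ; exact: cK.
have vE x : vel l (kd' lam) (om s ^~ t) x * Wf x - vel l (kd lam) (om s ^~ t) x * Zf x
    = - (pi^-1 * rint 0 l (Phi x)).
  rewrite (velE _ ck tI') (velE _ ck' tI').
  have -> : rint 0 l (Phi x) =
     Wf x * rint 0 l (fun y => om s y t * (kd' lam (x + y) - kd' lam (x - y))) -
     Zf x * rint 0 l (fun y => om s y t * (kd lam (x + y) - kd lam (x - y))).
    have c1 : cts 0 l (fun y => om s y t * (kd' lam (x + y) - kd' lam (x - y))).
      by apply: ctsM => //; exact: cK.
    have c2 : cts 0 l (fun y => om s y t * (kd lam (x + y) - kd lam (x - y))).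
      by apply: ctsM => //; exact: cK.
    rewrite -(rintZ _ c1) -(rintZ _ c2) -rintB; [|exact: ctsZ|exact: ctsZ].
    by apply: eq_rint => y _; rewrite /Phi; ring.
  by ring.
have cvel (k : R -> R) : continuous k -> cts 0 l (vel l k (om s ^~ t)).
  move=> ckk; apply: ctsZ; apply: continuous_cts; apply: convol_continuous => //.
  exact: com.
(* Continuity of the inner integral is inherited from the velocities through [vE], solved for the
   integral. *)
have cS1 : cts 0 l (fun x => rint 0 l (Phi x)).
  have -> : (fun x => rint 0 l (Phi x)) = (fun x => - pi *
     (vel l (kd' lam) (om s ^~ t) x * Wf x - vel l (kd lam) (om s ^~ t) x * Zf x)).
    apply/funext => x; rewrite vE mulrNN mulrA divff ?mul1r//.
    by rewrite gt_eqF// pi_gt0.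
  apply: ctsZ; apply: ctsB; apply: ctsM => //; exact: cvel.
have S2E x : rint 0 l (Phi ^~ x) = om s x t *
   ((rint 0 l (fun y => Wf y * kd' lam (y + x)) + rint 0 l (fun y => Wf y * kd' lam (x - y))) -
    (rint 0 l (fun y => Zf y * kd lam (y + x)) - rint 0 l (fun y => Zf y * kd lam (x - y)))).
  have caddr (k : R -> R) : continuous k -> cts 0 l (fun y => k (y + x)).
    move=> ckk; have -> : (fun y => k (y + x)) = (fun y => k (x + y)).
      by apply/funext => y; rewrite addrC.
    exact: cadd.
  have c1 : cts 0 l (fun y => Wf y * kd' lam (y + x)) by apply: ctsM => //; exact: caddr.
  have c2 : cts 0 l (fun y => Wf y * kd' lam (x - y)) by apply: ctsM => //; exact: csub.
  have c3 : cts 0 l (fun y => Zf y * kd lam (y + x)) by apply: ctsM => //; exact: caddr.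
  have c4 : cts 0 l (fun y => Zf y * kd lam (x - y)) by apply: ctsM => //; exact: csub.
  rewrite -(rintD c1 c2) -(rintB c3 c4) -(rintB (ctsD c1 c2) (ctsB c3 c4)).
  rewrite -(rintZ _ (ctsB (ctsD c1 c2) (ctsB c3 c4))).
  apply: eq_rint => y _; rewrite /Phi.
  have -> : kd' lam (y - x) = - kd' lam (x - y) by rewrite -(kf_odd KF) opprB.
  have -> : kd lam (y - x) = kd lam (x - y) by rewrite -(kf_even KF) opprB.
  by ring.
have cS2 : cts 0 l (fun x => rint 0 l (Phi ^~ x)).
  have -> : (fun x => rint 0 l (Phi ^~ x)) = (fun x => om s x t *
   ((rint 0 l (fun y => Wf y * kd' lam (y + x)) + rint 0 l (fun y => Wf y * kd' lam (x - y))) -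
    (rint 0 l (fun y => Zf y * kd lam (y + x)) - rint 0 l (fun y => Zf y * kd lam (x - y))))).
    by apply/funext => x; exact: S2E.
  apply: ctsM => //; apply: ctsB; [apply: ctsD|apply: ctsB]; apply: continuous_cts.
  - exact: convol_continuousD.
  - exact: convol_continuous.
  - exact: convol_continuousD.
  - exact: convol_continuous.
have cPhi2 x : cts 0 l (Phi ^~ x).
  have cadd2 (k : R -> R) : continuous k -> cts 0 l (fun y => k (y + x)).
    move=> ckk; have -> : (fun y => k (y + x)) = (fun y => k (x + y)).
      by apply/funext => y; rewrite addrC.
    exact: cadd.
  have csub2 (k : R -> R) : continuous k -> cts 0 l (fun y => k (y - x)).
    by move=> ckk; apply: continuous_cts; exact: continuous_subl.
  by apply: ctsZ; apply: ctsB; apply: ctsM => //; apply: ctsB; (exact: cadd2 || exact: csub2).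
have swap : rint 0 l (fun x => rint 0 l (Phi x)) = rint 0 l (fun y => rint 0 l (Phi ^~ y)).
  have [B0 [B00 HB0]] := cts_bounded co.
  have [B1 [B10 HB1]] := cts_bounded cW.
  have [B2 [B20 HB2]] := cts_bounded cZ.
  have [B3 [B30 HB3]] := cts_bounded (continuous_cts (a := - l) (b := l + l) ck').
  have [B4 [B40 HB4]] := cts_bounded (continuous_cts (a := - l) (b := l + l) ck).
  apply: (@rint_swap R 0 l 0 l Phi (B0 * (B1 * (B3 + B3) + B2 * (B4 + B4)))).
    have mD : measurable (`[0, l] `*` `[0, l] : set (MR * MR)) by exact: measurableX.
    have [m1 m2] := measurable_convol mD ck; have [m3 m4] := measurable_convol mD ck'.
    apply: measurable_funM; first exact: (measurable_snd_cts co).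
    by apply: measurable_funB; apply: measurable_funM;
      (exact: (measurable_fst_cts cW) || exact: (measurable_fst_cts cZ) ||
       exact: measurable_funB).
  move=> x y xI yI; have /andP[x0 xl] := xI; have /andP[y0 yl] := yI.
  have i1 : - l <= x + y <= l + l.
    by rewrite lerD// andbT (le_trans _ (addr_ge0 x0 y0))// oppr_le0 ltW.
  have i2 : - l <= x - y <= l + l.
    apply/andP; split; first by rewrite lerBrDr (le_trans _ x0)// addrC subr_le0.
    by rewrite lerBlDr (le_trans xl)// -addrA lerDl addr_ge0// ltW.
  rewrite /Phi normrM; apply: ler_pM => //; first exact: HB0.
  apply: le_trans (ler_normB _ _) _; rewrite (normrM (Wf x)) (normrM (Zf x)).
  apply: lerD; apply: ler_pM => //; [exact: HB1| |exact: HB2|].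
    by apply: le_trans (ler_normB _ _) _; apply: lerD; exact: HB3.
  by apply: le_trans (ler_normB _ _) _; apply: lerD; exact: HB4.
have sym x y : 0 <= x <= l -> 0 <= y <= l -> y <= x -> Phi x y + Phi y x <= 0.
  move=> xI yI yx; have /andP[x0 xl] := xI.
  have ox := om_ge0 xI tI'; have oy := om_ge0 yI tI'.
  (* The kernel inequalities ask for positive arguments; at y = 0 both terms vanish with omega. *)
  have [y0|y0] := eqVneq y 0.
    rewrite /Phi y0 /Wf /Zf (om0 tI') !mulr0 !mul0r subr0 mulr0 addr0.
    exact: lexx.
  have yp : 0 < y by rewrite lt_neqAle eq_sym y0; case/andP: yI.
  have xp : 0 < x by exact: lt_le_trans yx.
  have h1 : w x * (kd' lam (x + y) - kd' lam (x - y)) -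
    q x * (kd lam (x + y) - kd lam (x - y)) <= 0.
    by refine (H_le0 W lam0 _ xl); rewrite yp.
  have h2 : (w x * (kd' lam (x + y) - kd' lam (x - y)) -
     q x * (kd lam (x + y) - kd lam (x - y))) +
    (w y * (kd' lam (y + x) - kd' lam (y - x)) -
     q y * (kd lam (y + x) - kd lam (y - x))) <= 0.
    by refine (H_sym W lam0 _ _); [rewrite xp|rewrite yp; case/andP: yI].
  have ty := th_ge0 yI tI'.
  have /andP[yy0 yyl] := yI.
  have txy : th s y t <= th s x t := th_mono yy0 yx xl tI'.
  move: h1 h2; set a := _ - _ => h1; set b := w y * _ - _ => h2.
  have -> : Phi x y + Phi y x = om s x t * om s y t * (th s x t * a + th s y t * b).
    by rewrite /Phi /Wf /Zf /a /b; ring.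
  apply: mulr_ge0_le0; first exact: mulr_ge0.
  have h3 : (th s x t - th s y t) * a <= 0 by rewrite mulr_ge0_le0 ?subr_ge0.
  have h4 : th s y t * (a + b) <= 0 by rewrite mulr_ge0_le0.
  have -> : th s x t * a + th s y t * b = (th s x t - th s y t) * a + th s y t * (a + b) by ring.
  by rewrite -oppr_ge0 opprD addr_ge0 ?oppr_ge0.
have sym' x y : 0 <= x <= l -> 0 <= y <= l -> Phi x y + Phi y x <= 0.
  move=> xI yI; have [yx|xy] := leP y x; first exact: sym.
  by rewrite addrC; exact: (sym y x yI xI (ltW xy)).
have S0 : rint 0 l (fun x => rint 0 l (Phi x)) + rint 0 l (fun x => rint 0 l (Phi ^~ x)) <= 0.
  rewrite -(rintD cS1 cS2) -oppr_ge0 -rintN; last exact: ctsD.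
  apply: rint_ge0 => x xI; rewrite -(rintD (cPhi x) (cPhi2 x)).
  rewrite -(rintN (ctsD (cPhi x) (cPhi2 x))).
  by apply: rint_ge0 => y yI; rewrite oppr_ge0; exact: sym'.
rewrite -swap in S0.
have -> : rint 0 l (fun x =>
    vel l (kd' lam) (om s ^~ t) x * (th s x t * om s x t * w x) -
    vel l (kd lam) (om s ^~ t) x * (th s x t * om s x t * q x)) =
   - (pi^-1 * rint 0 l (fun x => rint 0 l (Phi x))).
  rewrite -(rintZ _ cS1) -rintN; last exact: ctsZ.
  by apply: eq_rint => x _; exact: vE.
rewrite oppr_ge0; apply: mulr_ge0_le0; first exact: ltW.
by move: S0; rewrite -mulr2n pmulrn_lle0.
Qed.

(** Since (theta omega)_t = - u (theta omega)_x + theta theta_x, integrating by parts against w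
    gives the integral of theta omega (u w)_x, nonnegative by [kernel_sign], plus half the integral
    of theta^2 q and a boundary term theta(l)^2 w(l) / 2. Then q >= c w^2 and Cauchy-Schwarz on
    [0, m0] produce I^2 and the constant c / (2 m0). *)
Let J_lower t : 0 < t < T -> c / (2 * m0) * I t ^+ 2 <= J' t.
Proof.
move=> tI; have tI' := clo tI; have /andP[t0 tT] := tI'.
have [A A1 HA] := bounds; have [C C0 HC] := u_approx s.
have [_ _ _ dth _] := C1_th s; have [_ _ _ dom _] := C1_om s.
pose g1 x := u s x t * (th s x t * om s x t).
pose dg1 x := ux s x t * (th s x t * om s x t) +
   u s x t * (ze s x t * om s x t + th s x t * omx s x t).
pose g2 x := th s x t * th s x t.
pose dg2 x := ze s x t * th s x t + th s x t * ze s x t.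
pose D := 3 * A * A * A * l + A * A * A * l + 2 * A * A * l.
have l1 := ltW l0.
have D0 : 0 <= D by rewrite !(addr_ge0, mulr_ge0).
have cth := @cts_th t l t0; have com' := @cts_om t l t0; have cze := @cts_ze t l t0.
have comx := @cts_omx t l t0; have cu := cts_u tI; have cux := cts_ux' tI.
have B3 x : - l <= x <= l -> `|th s x t * om s x t| <= A * A * `|x| ^+ 3.
  move=> xI; have [h1 _ h2 _ _] := HA x t xI tI'; rewrite normrM.
  apply: le_trans (ler_pM _ _ h2 h1) _ => //.
  by rewrite le_eqVlt; apply/orP; left; apply/eqP; ring.
have [c1 P1] : cts 0 l (fun x => dg1 x * w x - g1 x * q x) /\
    rint 0 l (fun x => dg1 x * w x - g1 x * q x) = g1 l * w l.
  apply: (rint_weight (D := D)) => //.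
  - move=> x xI; apply: isdM; first by apply: d_u => //; exact: half.
    by apply: isdM; [exact: dth|exact: dom].
  - move=> x xI; have [_ _ _ _ [_ /(_ tI)[h _]]] := HA x t xI tI'.
    rewrite /g1 normrM; apply: le_trans (ler_pM _ _ h (B3 x xI)) _ => //.
    have -> : A * `|x| * (A * A * `|x| ^+ 3) = A * A * A * `|x| * `|x| ^+ 3 by ring.
    apply: ler_wpM2r; first exact: exprn_ge0.
    apply: (@le_trans _ _ (A * A * A * l)).
      by apply: ler_wpM2l; [rewrite !mulr_ge0|exact: nl].
    have -> : D = A * A * A * l + (3 * A * A * A * l + 2 * A * A * l).
      by rewrite /D; ring.
    by rewrite lerDl !(addr_ge0, mulr_ge0).
  - by apply: ctsD; apply: ctsM => //; [exact: ctsM|apply: ctsD; exact: ctsM].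
  - move=> x xI; have [h1 h2 h3 [h4 _] [_ /(_ tI)[h5 h6]]] := HA x t xI tI'.
    have xl := nl xI; have x0 := normr_ge0 x.
    have E1 : `|ux s x t * (th s x t * om s x t)| <= A * (A * A * `|x| ^+ 3).
      by rewrite normrM; apply: ler_pM => //; exact: B3.
    have E2 : `|ze s x t * om s x t| <= A * `|x| * (A * `|x|).
      by rewrite normrM; apply: ler_pM.
    have E3 : `|th s x t * omx s x t| <= A * `|x| ^+ 2 * A.
      by rewrite normrM; apply: ler_pM.
    have E4 : `|u s x t * (ze s x t * om s x t + th s x t * omx s x t)| <=
       A * `|x| * (A * `|x| * (A * `|x|) + A * `|x| ^+ 2 * A).
      rewrite normrM; apply: ler_pM => //.
      by apply: le_trans (ler_normD _ _) _; exact: lerD.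
    apply: le_trans (ler_normD _ _) _; apply: le_trans (lerD E1 E4) _.
    have -> : A * (A * A * `|x| ^+ 3) + A * `|x| * (A * `|x| * (A * `|x|) + A * `|x| ^+ 2 * A) =
       3 * A * A * A * `|x| * `|x| ^+ 2 by ring.
    apply: ler_wpM2r; first exact: sqr_ge0.
    apply: (@le_trans _ _ (3 * A * A * A * l)).
      by apply: ler_wpM2l; [rewrite !mulr_ge0|].
    by rewrite /D -addrA lerDl !(addr_ge0, mulr_ge0).
have [c2 P2] : cts 0 l (fun x => dg2 x * w x - g2 x * q x) /\
    rint 0 l (fun x => dg2 x * w x - g2 x * q x) = g2 l * w l.
  apply: (rint_weight (D := D)) => //.
  - by move=> x xI; apply: isdM; exact: dth.
  - move=> x xI; have [_ _ h _ _] := HA x t xI tI'.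
    rewrite /g2 normrM; apply: le_trans (ler_pM _ _ h h) _ => //.
    have -> : A * `|x| ^+ 2 * (A * `|x| ^+ 2) = A * A * `|x| * `|x| ^+ 3 by ring.
    apply: ler_wpM2r; first exact: exprn_ge0.
    apply: (@le_trans _ _ (A * A * l)).
      by apply: ler_wpM2l; [rewrite !mulr_ge0|exact: nl].
    have h0 : 0 <= A * A * l by rewrite !mulr_ge0.
    have -> : D = A * A * l + (4 * A * A * A * l + A * A * l) by rewrite /D; ring.
    by rewrite lerDl !(addr_ge0, mulr_ge0).
  - by apply: ctsD; exact: ctsM.
  - move=> x xI; have [_ h1 h2 _ _] := HA x t xI tI'.
    apply: le_trans (ler_normD _ _) _; rewrite !normrM.
    apply: le_trans (lerD (ler_pM _ _ h1 h2) (ler_pM _ _ h2 h1)) _ => //.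
    have -> : A * `|x| * (A * `|x| ^+ 2) + A * `|x| ^+ 2 * (A * `|x|) =
      2 * A * A * `|x| * `|x| ^+ 2 by ring.
    apply: ler_wpM2r; first exact: sqr_ge0.
    apply: (@le_trans _ _ (2 * A * A * l)).
      by apply: ler_wpM2l; [rewrite !mulr_ge0|exact: nl].
    by rewrite /D lerDr !(addr_ge0, mulr_ge0).
pose Wf x := th s x t * om s x t * w x; pose Zf x := th s x t * om s x t * q x.
have cW : cts 0 l Wf := cts_J tI'.
have cZ : cts 0 l Zf.
  apply: (@ctsq l (A * A)) => //; first by rewrite mulr_ge0.
  exact: ctsM.
have cK : cts 0 l (fun x => ux s x t * Wf x - u s x t * Zf x).
  by apply: ctsB; exact: ctsM.
have cg2q : cts 0 l (fun x => g2 x * q x).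
  apply: (@ctsq l (A * A * l)) => //; first by rewrite !mulr_ge0.
    exact: ctsM.
  move=> x xI; have [_ _ h _ _] := HA x t xI tI'.
  rewrite /g2 normrM; apply: le_trans (ler_pM _ _ h h) _ => //.
  have -> : A * `|x| ^+ 2 * (A * `|x| ^+ 2) = A * A * `|x| * `|x| ^+ 3 by ring.
  apply: ler_wpM2r; first exact: exprn_ge0.
  by apply: ler_wpM2l; [rewrite !mulr_ge0|exact: nl].
(* The four terms: minus the exact derivative of u theta omega w, the integral of theta omega (u
   w)_x, half the exact derivative of theta^2 w, and half of theta^2 q. *)
have JE : J' t = - rint 0 l (fun x => dg1 x * w x - g1 x * q x) +
   (rint 0 l (fun x => ux s x t * Wf x - u s x t * Zf x) +
    (2^-1 * rint 0 l (fun x => dg2 x * w x - g2 x * q x) +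
     2^-1 * rint 0 l (fun x => g2 x * q x))).
  have d1 := ctsN c1.
  have d2 : cts 0 l (fun x => 2^-1 * (dg2 x * w x - g2 x * q x)) by exact: ctsZ.
  have d3 : cts 0 l (fun x => 2^-1 * (g2 x * q x)) by exact: ctsZ.
  rewrite -(rintN c1) -(rintZ _ c2) -(rintZ _ cg2q) -(rintD d2 d3).
  rewrite -(rintD cK (ctsD d2 d3)) -(rintD d1 (ctsD cK (ctsD d2 d3))).
  apply: eq_rint => x xI; have xI' := half xI.
  rewrite thtE//.
  have -> : omt s x t = ze s x t - u s x t * omx s x t.
    by rewrite -(eq_om s xI' tI); ring.
  by rewrite /dg1 /g1 /dg2 /g2 /Wf /Zf; field.
have K0 : 0 <= rint 0 l (fun x => ux s x t * Wf x - u s x t * Zf x).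
  apply: (@le_of_exp_error _ _ (C * rint 0 l (fun x => Wf x + Zf x))) => lam lam0.
  have ck := ckd lam0; have ck' := kf_continuous KF lam0.
  have cvel (k : R -> R) : continuous k -> cts 0 l (vel l k (om s ^~ t)).
    move=> ckk; apply: ctsZ; apply: continuous_cts; apply: convol_continuous => //.
    exact: com.
  have KS := kernel_sign lam0 tI.
  apply: le_trans KS _.
  have cWZ : cts 0 l (fun x => C * expR (- lam) * (Wf x + Zf x)).
    by apply: ctsZ; exact: ctsD.
  have -> : C * rint 0 l (fun x => Wf x + Zf x) * expR (- lam) =
      rint 0 l (fun x => C * expR (- lam) * (Wf x + Zf x)).
    by rewrite rintZ; [ring|exact: ctsD].
  rewrite -(rintD cK cWZ); apply: le_rint.
  - by apply: ctsB; apply: ctsM => //; exact: cvel.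
  - exact: ctsD.
  - move=> x xI; have [h1 h2] := HC lam x t lam0 (half xI) tI.
    have tx : 0 <= th s x t * om s x t by rewrite mulr_ge0 ?th_ge0 ?om_ge0.
    have W0 : 0 <= Wf x by rewrite mulr_ge0// (w_ge0 W).
    have Z0 : 0 <= Zf x by rewrite mulr_ge0// q_ge0.
    have k2 : vel l (kd' lam) (om s ^~ t) x - ux s x t <= C * expR (- lam).
      by apply: le_trans (ler_norm _) _; rewrite distrC.
    have k1 : u s x t - vel l (kd lam) (om s ^~ t) x <= C * expR (- lam).
      exact: le_trans (ler_norm _) h1.
    have := lerD (ler_wpM2r W0 k2) (ler_wpM2r Z0 k1).
    rewrite -mulrDr -subr_ge0 => H; rewrite -subr_ge0; apply: le_trans H _.
    rewrite le_eqVlt; apply/orP; left; apply/eqP; rewrite -/(Wf x) -/(Zf x); ring.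
have g1l : g1 l = 0 by rewrite /g1 oml// !mulr0.
have Q1 : c / m0 * I t ^+ 2 <= rint 0 l (fun x => g2 x * q x).
  have cthw : cts 0 l (fun x => th s x t * w x).
    apply: (@cts_weighted l A) => //.
    by move=> x xI; have [_ _ h _ _] := HA x t xI tI'.
  have cthw2 : cts 0 l (fun x => (th s x t * w x) ^+ 2).
    by move=> x xI; apply: (@continuousM _ _ (fun x => th s x t * w x) _ x); exact: cthw.
  have cthw0 : cts 0 m0 (fun x => th s x t * w x) by have h := cthw; apply: ctsS h.
  have h1 := rint_sqr_le (ltW m00) cthw0; rewrite subr0 in h1.
  have h2 : rint 0 m0 (fun x => (th s x t * w x) ^+ 2) <= rint 0 l (fun x => (th s x t * w x) ^+ 2).
    rewrite [leRHS](@rint_split _ _ _ m0) ?(ltW m00)//; last exact: cts_integrable.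
    by rewrite lerDl; apply: rint_ge0 => x _; exact: sqr_ge0.
  have h3 : c * rint 0 l (fun x => (th s x t * w x) ^+ 2) <= rint 0 l (fun x => g2 x * q x).
    rewrite -rintZ//; apply: le_rint => //; first exact: ctsZ.
    move=> x xI; rewrite /g2 exprMn mulrCA -expr2; apply: ler_wpM2l; first exact: sqr_ge0.
    exact: (q_ge W).
  apply: le_trans h3; rewrite -mulrA; apply: ler_wpM2l; first exact: ltW.
  rewrite ler_pdivrMl//; apply: le_trans h1 _; apply: ler_wpM2l => //; exact: ltW.
have g2l : 0 <= g2 l * w l.
  by rewrite mulr_ge0 ?(w_ge0 W) ?l1 ?lexx// /g2 -expr2 sqr_ge0.
rewrite JE P1 P2 g1l mul0r oppr0 add0r.
have -> : c / (2 * m0) * I t ^+ 2 = 2^-1 * (c / m0 * I t ^+ 2).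
  by rewrite invfM; ring.
apply: le_trans (_ : 2^-1 * rint 0 l (fun x => g2 x * q x) <= _).
  by apply: ler_wpM2l Q1; rewrite invr_ge0.
rewrite addrA lerDr addr_ge0// mulr_ge0// invr_ge0//.
Qed.

Lemma hl_blowup : False.
Proof.
have [cI dI] := I_diff; have [cJ dJ] := J_diff.
have T00 : 0 <= (0 : R) <= T by rewrite lexx ltW.
apply: (@ode_blowup R T pi^-1 (c / (2 * m0)) A0 I I' J J') => //.
- by rewrite invr_gt0 pi_gt0.
- by rewrite divr_gt0// mulr_gt0.
- apply: rint_ge0 => x xI; rewrite om_init ?mulr0 ?mul0r//.
  exact: half.
Qed.

End blowup.

(** * Inverse square root singularities; derivatives of uniform limits *)

Section singular_integrals.
Context {R : realType}.
Implicit Types (a b c x y z t lam r : R) (f g : R -> R).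
Notation mu := (@lebesgue_measure R).
Notation MR := (measurableTypeR R).

(* |y - c|^(-1/2), equal to 1 at y = c because ln 0 = 0. *)
Definition isqrt c y : R := expR (- (2^-1 * ln `|y - c|)).

Lemma measurable_isqrt c (D : set MR) : measurable D ->
  measurable_fun D (isqrt c : MR -> R).
Proof.
move=> mD; apply: (@measurable_funS _ _ _ _ setT) => //.
apply: measurableT_comp; first exact: measurable_expR.
apply: measurableT_comp; first exact: oppr_measurable.
apply: measurable_funM => //.
apply: measurableT_comp; first exact: measurable_ln.
apply: measurableT_comp; first exact: normr_measurable.
by apply: measurable_funB.
Qed.

(** Monotone convergence: a half-open interval ending at the singularity is exhausted by compact
    ones, on which the fundamental theorem applies. *)
Lemma set_limit_bound (F : nat -> set MR) (f : MR -> \bar R) (M : \bar R) :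
  nondecreasing_seq F -> (forall n, measurable (F n)) ->
  (forall n, measurable_fun (F n) f) -> (forall x, (0 <= f x)%E) ->
  (forall n, (\int[mu]_(x in F n) f x <= M)%E) ->
  (\int[mu]_(x in \bigcup_n F n) f x <= M)%E.
Proof.
move=> nF mF mf f0 FM.
have H := @ge0_nondecreasing_set_cvg_integral _ _ _ F f mu nF mF mf (fun _ x _ => f0 x).
have <- : limn (fun i => \int[mu]_(x in F i) f x)%E = (\int[mu]_(x in \bigcup_n F n) f x)%E.
  exact: cvg_lim H.
apply: lime_le; first by apply/cvg_ex; eexists; exact: H.
by apply: nearW => n; exact: FM.
Qed.

(** The primitive is 2 sqrt(y - c), written with exp and ln, so the bound is 2 sqrt r. *)
Lemma isqrt_right c (r : R) : 0 < r ->
  (\int[mu]_(y in `]c, (c + r)%R]) (isqrt c y)%:E <=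
    (2 * expR (2^-1 * ln r))%R%:E)%E.
Proof.
move=> r0.
pose F n : set MR := `[(c + r / n.+1%:R), (c + r)]%classic.
have FU : \bigcup_n F n = `]c, (c + r)]%classic.
  apply/seteqP; split => y.
    move=> [n _]; rewrite /F/= !in_itv/= => /andP[h ->]; rewrite andbT.
    by apply: lt_le_trans h; rewrite ltrDl divr_gt0.
  rewrite /= in_itv/= => /andP[cy yr].
  exists (Num.bound (r / (y - c))) => //; rewrite /F/= in_itv/= yr andbT.
  have yc : 0 < y - c by rewrite subr_gt0.
  have h : 0 <= r / (y - c) by rewrite divr_ge0// ltW.
  have := archi_boundP h; set n := Num.bound _ => hn.
  rewrite addrC -lerBrDr ler_pdivrMr// mulrC -ler_pdivrMr//.
  by apply: le_trans (ltW hn) _; rewrite ler_nat.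
rewrite -FU; apply: set_limit_bound.
- move=> m n mn; apply/subsetPset => y; rewrite /F/= !in_itv/= => /andP[h ->].
  rewrite andbT; apply: le_trans h; rewrite lerD2l ler_pM2l// lef_pV2 ?posrE// ler_nat.
  by [].
- by move=> n; exact: measurable_itv.
- by move=> n; apply/measurable_EFinP; apply: measurable_isqrt; exact: measurable_itv.
- by move=> y; rewrite lee_fin expR_ge0.
move=> n; pose p := c + r / n.+1%:R.
have p0 : c < p by rewrite ltrDl divr_gt0.
have pr : p <= c + r by rewrite lerD2l ler_pdivrMr// ler_peMr ?ler1n// ltW.
have dF y : p <= y <= c + r -> is_derive y 1 (fun y => 2 * expR (2^-1 * ln (y - c))) (isqrt c y).
  move=> /andP[py _]; have yc : 0 < y - c by rewrite subr_gt0 (lt_le_trans p0).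
  have d1 := isdB (isd_id y) (isd_cst y c).
  have d2 := isd_comp d1 (is_derive1_ln yc).
  have d3 := isd_comp (isdZ 2^-1 d2) (is_derive_expR _).
  apply: (isd_eq (isdZ 2 d3)).
  rewrite /isqrt gtr0_norm// subr0 mulr1.
  have -> : - (2^-1 * ln (y - c)) = 2^-1 * ln (y - c) - ln (y - c) by field.
  rewrite expRD expRN lnK ?posrE//; field; rewrite gt_eqF//.
have cF : cts p (c + r) (isqrt c).
  move=> y yI; have /andP[py _] := yI.
  have yc : 0 < y - c by rewrite subr_gt0 (lt_le_trans p0).
  have d1 := isdB (isd_id y) (isd_cst y c).
  have d2 := isd_comp d1 (is_derive1_ln yc).
  have d3 := isd_comp (isdN (isdZ 2^-1 d2)) (is_derive_expR _).
  have N : \forall z \near y, expR (- (2^-1 * ln (z - c))) = isqrt c z.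
    near=> z; rewrite /isqrt gtr0_norm// subr_gt0; near: z.
    exact: (@cvgr_gt _ _ _ _ id y cvg_id c (lt_le_trans p0 py)).
  exact: is_derive_continuous (near_eq_is_derive N d3).
have E := rint_FTC pr dF cF.
have I := cts_integrable cF.
have -> : (\int[mu]_(x in F n) (isqrt c x)%:E)%E = (rint p (c + r) (isqrt c))%:E.
  rewrite /rint /Rintegral fineK//; apply: integrable_fin_num => //.
have cr : c + r - c = r by ring.
by rewrite lee_fin E cr lerBlDr lerDl mulr_ge0// expR_ge0.
Unshelve. all: end_near. Qed.

Lemma isqrt_left c (r : R) : 0 < r ->
  (\int[mu]_(y in `[(c - r)%R, c[) (isqrt c y)%:E <=
    (2 * expR (2^-1 * ln r))%R%:E)%E.
Proof.
move=> r0.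
pose F n : set MR := `[(c - r), (c - r / n.+1%:R)]%classic.
have FU : \bigcup_n F n = `[(c - r), c[%classic.
  apply/seteqP; split => y.
    move=> [n _]; rewrite /F/= !in_itv/= => /andP[-> h].
    by apply: le_lt_trans h _; rewrite ltrBlDr ltrDl divr_gt0.
  rewrite /= in_itv/= => /andP[yr cy].
  exists (Num.bound (r / (c - y))) => //; rewrite /F/= in_itv/= yr/=.
  have yc : 0 < c - y by rewrite subr_gt0.
  have h : 0 <= r / (c - y) by rewrite divr_ge0// ltW.
  have := archi_boundP h; set n := Num.bound _ => hn.
  rewrite lerBrDr -lerBrDl ler_pdivrMr// mulrC -ler_pdivrMr//.
  by apply: le_trans (ltW hn) _; rewrite ler_nat.
rewrite -FU; apply: set_limit_bound.
- move=> m n mn; apply/subsetPset => y; rewrite /F/= !in_itv/= => /andP[-> h].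
  apply: le_trans h _; rewrite lerD2l lerN2 ler_pM2l// lef_pV2 ?posrE// ler_nat.
  by [].
- by move=> n; exact: measurable_itv.
- by move=> n; apply/measurable_EFinP; apply: measurable_isqrt; exact: measurable_itv.
- by move=> y; rewrite lee_fin expR_ge0.
move=> n; pose p := c - r / n.+1%:R.
have p0 : p < c by rewrite ltrBlDr ltrDl divr_gt0.
have pr : c - r <= p by rewrite lerD2l lerN2 ler_pdivrMr// ler_peMr ?ler1n// ltW.
have dF y : c - r <= y <= p ->
    is_derive y 1 (fun y => - (2 * expR (2^-1 * ln (c - y)))) (isqrt c y).
  move=> /andP[_ py]; have yc : 0 < c - y by rewrite subr_gt0 (le_lt_trans py).
  have d1 := isdB (isd_cst y c) (isd_id y).
  have d2 := isd_comp d1 (is_derive1_ln yc).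
  have d3 := isd_comp (isdZ 2^-1 d2) (is_derive_expR _).
  apply: (isd_eq (isdN (isdZ 2 d3))).
  rewrite /isqrt distrC gtr0_norm// sub0r.
  have -> : - (2^-1 * ln (c - y)) = 2^-1 * ln (c - y) - ln (c - y) by field.
  rewrite expRD expRN lnK ?posrE//; field; rewrite gt_eqF//.
have cF : cts (c - r) p (isqrt c).
  move=> y yI; have /andP[_ py] := yI.
  have yc : 0 < c - y by rewrite subr_gt0 (le_lt_trans py).
  have d1 := isdB (isd_cst y c) (isd_id y).
  have d2 := isd_comp d1 (is_derive1_ln yc).
  have d3 := isd_comp (isdN (isdZ 2^-1 d2)) (is_derive_expR _).
  have N : \forall z \near y, expR (- (2^-1 * ln (c - z))) = isqrt c z.
    near=> z; rewrite /isqrt distrC gtr0_norm// subr_gt0; near: z.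
    exact: (@cvgr_lt _ _ _ _ id y cvg_id c (le_lt_trans py p0)).
  exact: is_derive_continuous (near_eq_is_derive N d3).
have E := rint_FTC pr dF cF.
have I := cts_integrable cF.
have -> : (\int[mu]_(x in F n) (isqrt c x)%:E)%E = (rint (c - r) p (isqrt c))%:E.
  rewrite /rint /Rintegral fineK//; apply: integrable_fin_num => //.
have cr : c - (c - r) = r by ring.
by rewrite lee_fin E opprK cr gerDr oppr_le0 mulr_ge0// expR_ge0.
Unshelve. all: end_near. Qed.

Lemma isqrt_int a b c (r : R) : 0 < r -> c - r <= a -> b <= c + r ->
  (\int[mu]_(y in `[a, b]) (isqrt c y)%:E <=
    (4 * expR (2^-1 * ln r))%R%:E)%E.
Proof.
move=> r0 ca bc.
pose A : set MR := `[(c - r), c]%classic; pose B : set MR := `]c, (c + r)]%classic.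
have mA : measurable A by exact: measurable_itv.
have mB : measurable B by exact: measurable_itv.
have mi D : measurable D -> measurable_fun D (fun y : MR => (isqrt c y)%:E).
  by move=> mD; apply/measurable_EFinP; exact: measurable_isqrt.
have i0 y : (0 <= (isqrt c y)%:E)%E by rewrite lee_fin expR_ge0.
apply: (@le_trans _ _ (\int[mu]_(y in A `|` B) (isqrt c y)%:E)%E).
  apply: ge0_subset_integral => //.
  - exact: measurableU.
  - by apply: mi; exact: measurableU.
  - move=> y; rewrite /A /B/= !in_itv/= => /andP[ay yb].
    have [yc|cy] := leP y c; [left|right]; rewrite ?yc/= ?cy.
      by rewrite (le_trans ca ay).
    exact: le_trans yb bc.
rewrite ge0_integral_setU//; last 2 first.
- by apply: mi; exact: measurableU.
- rewrite disj_set2E; apply/eqP/seteqP; split => y //=.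
  by rewrite /A /B/= !in_itv/= => -[/andP[_ h1] /andP[h2 _]]; move: (le_lt_trans h1 h2); rewrite ltxx.
have -> : (4 * expR (2^-1 * ln r))%:E =
  ((2 * expR (2^-1 * ln r))%:E + (2 * expR (2^-1 * ln r))%:E)%E.
  by rewrite -EFinD; congr EFin; ring.
apply: leeD; last exact: isqrt_right.
rewrite /A -integral_itv_bndo_bndc; first exact: isqrt_left.
by apply: mi; exact: measurable_itv.
Qed.

(** Functions and derivatives converge uniformly at rate exp(- lam). The mean value theorem for
    [fl lam], followed by lam -> +oo at fixed h, gives |f(x + h) - f x - g x * h| <= e |h| as soon
    as g varies by at most e within |h| of x. *)
Lemma limit_derive (f g : R -> R) (fl gl : R -> R -> R) (C p q : R) :
  (forall lam x, 0 < lam -> p < x < q ->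
     `|f x - fl lam x| <= C * expR (- lam) /\ `|g x - gl lam x| <= C * expR (- lam)) ->
  (forall lam x, 0 < lam -> p < x < q -> is_derive x 1 (fl lam) (gl lam x)) ->
  (forall lam x, 0 < lam -> p < x < q -> {for x, continuous (gl lam)}) ->
  forall x, p < x < q -> is_derive x 1 f (g x) /\ {for x, continuous g}.
Proof.
move=> H df cg x xI.
have C0 : 0 <= C.
  have [h _] := H 1 x ltr01 xI; have := le_trans (normr_ge0 _) h.
  by rewrite pmulr_lge0// expR_gt0.
have /andP[px xq] := xI.
have nearI : \forall y \near x, p < y < q.
  near=> y; apply/andP; split; near: y.
    exact: (@cvgr_gt _ _ _ _ id x cvg_id).
  exact: (@cvgr_lt _ _ _ _ id x cvg_id).
have expsmall e : 0 < e -> exists2 lam, 0 < lam & C * expR (- lam) <= e.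
  move=> e0; exists (C / e + 1); first by rewrite ltr_wpDl// divr_ge0// ltW.
  have h : 0 <= C / e + 1 by rewrite addr_ge0// divr_ge0// ltW.
  have h1 : 0 < 1 + (C / e + 1) by rewrite ltr_pwDl.
  have := expRN_le h; rewrite -ler_pdivlMr// mul1r => h2.
  apply: le_trans (ler_wpM2l C0 h2) _.
  rewrite ler_pdivrMr// mulrDr mulr1 mulrDr mulrCA divff ?mulr1 ?gt_eqF//.
  by lra.
have cgx : {for x, continuous g}.
  apply/cvgrPdist_le => e e0; have [lam lam0 He] := expsmall (e / 3) (divr_gt0 e0 (ltr0n _ 3)).
  have e3 : 0 < e / 3 by rewrite divr_gt0.
  have := cg lam x lam0 xI => /cvgrPdist_le/(_ _ e3) Hn.
  near=> y.
  have h1 : `|gl lam x - gl lam y| <= e / 3 by near: y; exact: Hn.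
  have yI : p < y < q by near: y.
  have [_ h2] := H lam x lam0 xI; have [_ h3] := H lam y lam0 yI.
  have -> : g x - g y = (g x - gl lam x) + (gl lam x - gl lam y) - (g y - gl lam y) by ring.
  apply: le_trans (ler_normB _ _) _; apply: le_trans (lerD (ler_normD _ _) (lexx _)) _.
  by have := le_trans h2 He; have := le_trans h3 He; lra.
split=> //.
have K : h^-1 *: (f (h *: 1 + x) - f x) @[h --> 0^'] --> g x.
  apply/cvgrPdist_le => e e0.
  have := cgx => /cvgrPdist_le/(_ _ e0)/nbhs_ballP[d /= d0 Hd].
  have /nbhs_ballP[d' /= d'0 Hd'] := nearI.
  near=> h.
  have h0 : h != 0 by near: h; exact: nbhs_dnbhs_neq.
  have hd : `|h| < d by near: h; exact: (@dnbhs0_lt _ R^o).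
  have hd' : `|h| < d' by near: h; exact: (@dnbhs0_lt _ R^o).
  have ball_in y : `|y - x| <= `|h| -> p < y < q /\ `|g x - g y| <= e.
    move=> yh; split.
      by apply: Hd'; rewrite /ball/= distrC (le_lt_trans yh).
    by apply: Hd; rewrite /ball/= distrC (le_lt_trans yh).
  rewrite scaler1.
  have hx0 : `|h + x - x| <= `|h| by rewrite addrK.
  have key : `|f (h + x) - f x - g x * h| <= e * `|h|.
    apply: (@le_of_exp_error _ _ _ (2 * C + C * `|h|)) => lam lam0.
    have [hI _] := ball_in _ hx0.
    have [e1 _] := H lam _ lam0 xI; have [e2 _] := H lam _ lam0 hI.
    have [z zh zE] : exists2 z, `|z - x| <= `|h| & fl lam (h + x) - fl lam x = gl lam z * h.
      have cont u v : p < u -> v < q -> {within `[u, v], continuous (fl lam)}.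
        move=> pu vq; apply: cts_within => w /andP[uw wv].
        by apply: is_derive_continuous (df lam w lam0 _); rewrite (lt_le_trans pu uw) (le_lt_trans wv vq).
      have der u v w : p < u -> v < q -> w \in `]u, v[ -> is_derive w 1 (fl lam) (gl lam w).
        rewrite in_itv/= => pu vq /andP[uw wv]; apply: df => //.
        by rewrite (lt_trans pu uw) (lt_trans wv vq).
      have /andP[hp hq] := hI.
      have [hpos|hneg|h00] := ltgtP 0 h; last by move: h0; rewrite -h00 eqxx.
        have lt1 : x < h + x by rewrite ltrDr.
        have [z] := MVT lt1 (fun w => @der x (h + x) w px hq) (cont _ _ px hq).
        rewrite in_itv/= addrK => /andP[z1 z2] ->; exists z => //.
        by rewrite !gtr0_norm ?subr_gt0// lerBlDr ltW.
      have lt1 : h + x < x by rewrite gtrDr.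
      have [z] := MVT lt1 (fun w => @der (h + x) x w hp xq) (cont _ _ hp xq).
      rewrite in_itv/= => /andP[z1 z2] E; exists z; last by rewrite -opprB E; ring.
      by rewrite !ltr0_norm ?subr_lt0// lerN2 lerBrDr ltW.
    have [zI ze] := ball_in _ zh.
    have [_ e3] := H lam _ lam0 zI.
    have -> : f (h + x) - f x - g x * h = (f (h + x) - fl lam (h + x)) - (f x - fl lam x) -
       (g z - gl lam z) * h - (g x - g z) * h + (fl lam (h + x) - fl lam x - gl lam z * h) by ring.
    rewrite zE subrr addr0.
    apply: le_trans (ler_normB _ _) _; rewrite [leRHS]addrC; apply: lerD; last first.
      by rewrite normrM; apply: ler_wpM2r.
    apply: le_trans (ler_normB _ _) _; rewrite [leRHS]mulrDl; apply: lerD.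
      apply: le_trans (ler_normB _ _) _.
      by have := lerD e2 e1; rewrite -mulrA mulr2n mulrDl !mul1r.
    by rewrite normrM mulrAC; apply: ler_wpM2r.
  have -> : g x - h^-1 *: (f (h + x) - f x) = - (h^-1 * (f (h + x) - f x - g x * h)).
    have -> : h^-1 *: (f (h + x) - f x) = h^-1 * (f (h + x) - f x) by [].
    by field.
  rewrite normrN normrM normfV ler_pdivrMl ?normr_gt0// [leRHS]mulrC.
  exact: key.
apply: DeriveDef; first by apply/cvg_ex; exists (g x); exact: K.
exact: cvg_lim K.
Unshelve. all: end_near. Qed.

End singular_integrals.

(** * Logarithmic kernels, regularised and singular *)

Section regularised_kernels.
Context {R : realType}.
Implicit Types (b c x y z t lam r : R) (f g : R -> R).
Notation mu := (@lebesgue_measure R).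
Notation MR := (measurableTypeR R).

(** Origin of the logarithmic loss: for d = exp(- 2 lam) the bound is affine in [lam]. *)
Lemma inv_int a b c (r d : R) : 0 < d -> a <= b -> c - r <= a -> b <= c + r ->
  rint a b (fun y => (`|y - c| + d)^-1) <= 2 * (ln (r + d) - ln d).
Proof.
move=> d0 ab ca bc.
have r0 : 0 <= r by lra.
pose f y := (`|y - c| + d)^-1.
have f0 y : 0 <= f y by rewrite invr_ge0 addr_ge0// ltW.
have cf : continuous f.
  move=> y; apply: cvgV; first by rewrite gt_eqF// ltr_wpDl.
  apply: cvgD; last exact: cvg_cst.
  apply: cvg_norm.
  exact: is_derive_continuous (isdB (isd_id y) (isd_cst y c)).
have I p q : mu.-integrable `[p, q] (EFin \o f).
  by apply: cts_integrable; exact: continuous_cts.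
have S1 := @rint_split R (c - r) (c + r) a f _ (I _ _).
have S2 := @rint_split R a (c + r) b f _ (I _ _).
have S3 := @rint_split R (c - r) (c + r) c f _ (I _ _).
have P1 : 0 <= rint (c - r) a f by exact: rint_ge0.
have P2 : 0 <= rint b (c + r) f by exact: rint_ge0.
have L : rint (c - r) c f = ln (r + d) - ln d.
  have -> : rint (c - r) c f = rint (c - r) c (fun y => (c - y + d)^-1).
    apply: eq_rint => y /andP[_ yc]; rewrite /f distrC ger0_norm// subr_ge0//.
  have dF y : c - r <= y <= c -> is_derive y 1 (fun y => - ln (c - y + d)) ((c - y + d)^-1).
    move=> /andP[_ yc]; have p : 0 < c - y + d by rewrite ltr_wpDl// subr_ge0.
    have h := isdN (isd_comp (isdD (isdB (isd_cst y c) (isd_id y)) (isd_cst y d)) (is_derive1_ln p)).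
    by apply: (isd_eq h); ring.
  have cF : cts (c - r) c (fun y => (c - y + d)^-1).
    move=> y /andP[_ yc]; have p : 0 < c - y + d by rewrite ltr_wpDl// subr_ge0.
    apply: cvgV; first by rewrite gt_eqF.
    exact: is_derive_continuous (isdD (isdB (isd_cst y c) (isd_id y)) (isd_cst y d)).
  have E := rint_FTC (_ : c - r <= c) dF cF.
  rewrite E; last by rewrite lerBlDr lerDl.
  have -> : c - c + d = d by ring.
  have -> : c - (c - r) + d = r + d by ring.
  by ring.
have Rr : rint c (c + r) f = ln (r + d) - ln d.
  have -> : rint c (c + r) f = rint c (c + r) (fun y => (y - c + d)^-1).
    by apply: eq_rint => y /andP[cy _]; rewrite /f ger0_norm// subr_ge0.
  have dF y : c <= y <= c + r -> is_derive y 1 (fun y => ln (y - c + d)) ((y - c + d)^-1).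
    move=> /andP[cy _]; have p : 0 < y - c + d by rewrite ltr_wpDl// subr_ge0.
    have h := isd_comp (isdD (isdB (isd_id y) (isd_cst y c)) (isd_cst y d)) (is_derive1_ln p).
    by apply: (isd_eq h); ring.
  have cF : cts c (c + r) (fun y => (y - c + d)^-1).
    move=> y /andP[cy _]; have p : 0 < y - c + d by rewrite ltr_wpDl// subr_ge0.
    apply: cvgV; first by rewrite gt_eqF.
    exact: is_derive_continuous (isdD (isdB (isd_id y) (isd_cst y c)) (isd_cst y d)).
  have E := rint_FTC (_ : c <= c + r) dF cF.
  rewrite E; last by rewrite lerDl.
  have -> : c - c + d = d by ring.
  by have -> : c + r - c + d = r + d by ring.
rewrite L Rr in S3.
have := S3 _; rewrite lerBlDr lerDl r0 => /(_ isT).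
have := S1 _; rewrite ca (le_trans ab bc) => /(_ isT).
have := S2 _; rewrite ab bc => /(_ isT).
rewrite -/f; lra.
Qed.

Variables (sg sg' : R -> R) (l a B B3 : R).
Hypotheses (l0 : 0 < l) (a0 : 0 < a).
Hypothesis dsg : forall z, is_derive z 1 sg (sg' z).
Hypothesis csg' : continuous sg'.
Hypothesis sgB : forall z, `|sg' z| <= B.
Hypothesis sg_odd : forall z, sg (- z) = - sg z.
Hypothesis sg'_even : forall z, sg' (- z) = sg' z.
(* The zeros of sg in [-3l, 3l] lie among 0, 2l and -2l; for sg = id the first
   alternative always holds. *)
Hypothesis sg_low : forall z, `|z| <= 3 * l -> [\/ a * `|z - 0| <= `|sg z|,
  a * `|z - 2 * l| <= `|sg z| | a * `|z - - (2 * l)| <= `|sg z|].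
Hypothesis sgB3 : forall z, `|z| <= 3 * l -> `|sg z| <= B3.

Definition reg lam z : R := sg z ^+ 2 + expR (- (4 * lam)).
Definition ker lam z : R := 2^-1 * ln (reg lam z).
Definition ker' lam z : R := sg z * sg' z / reg lam z.
Definition sker z : R := ln `|sg z|.

Let ll : - l <= l. Proof. by have := l0; lra. Qed.

Let reg_gt0 lam z : 0 < reg lam z.
Proof. by rewrite /reg ltr_wpDl ?sqr_ge0// expR_gt0. Qed.

Let csg : continuous sg.
Proof. by move=> z; exact: is_derive_continuous (dsg z). Qed.

Let dreg lam z : is_derive z 1 (reg lam) (2 * sg z * sg' z).
Proof.
by apply: (isd_eq (isdD (isd_sqr (dsg z)) (isd_cst z _))); rewrite addr0.
Qed.

Lemma ker_derive lam z : is_derive z 1 (ker lam) (ker' lam z).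
Proof.
apply: (isd_eq (isdZ 2^-1 (isd_comp (dreg lam z) (is_derive1_ln (reg_gt0 lam z))))).
by rewrite /ker'; field; rewrite gt_eqF.
Qed.

Lemma ker'_continuous lam : continuous (ker' lam).
Proof.
move=> z; apply: cvgM; first by apply: cvgM; [exact: csg|exact: csg'].
apply: cvgV; first by rewrite gt_eqF.
exact: is_derive_continuous (dreg lam z).
Qed.

Let ker_continuous lam : continuous (ker lam).
Proof. by move=> z; exact: is_derive_continuous (ker_derive lam z). Qed.

Lemma ker_even lam z : ker lam (- z) = ker lam z.
Proof. by rewrite /ker /reg sg_odd sqrrN. Qed.

Lemma ker'_odd lam z : ker' lam (- z) = - ker' lam z.
Proof. by rewrite /ker' /reg sg_odd sqrrN sg'_even !mulNr. Qed.

Let ker_bound : exists2 K, 0 <= K & forall lam z, 0 < lam -> `|z| <= 2 * l ->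
  `|ker lam z| <= K * (1 + lam).
Proof.
have L0 : 0 <= ln (B3 ^+ 2 + 1) by rewrite ln_ge0// lerDr sqr_ge0.
exists (ln (B3 ^+ 2 + 1) + 2); first by rewrite addr_ge0.
move=> lam z lam0 z2.
have e0 := expR_gt0 (- (4 * lam)).
have e1 : expR (- (4 * lam)) <= 1 by rewrite -[leRHS]expR0 ler_expR; lra.
have s3 : sg z ^+ 2 <= B3 ^+ 2.
  rewrite -[leLHS]real_normK ?num_real// lerXn2r// ?nnegrE//.
    by apply: le_trans (sgB3 (z := 0) _); rewrite ?normr0// mulr_ge0// ltW.
  by apply: sgB3; apply: le_trans z2 _; apply: ler_wpM2r; [exact: ltW|lra].
have h1 : ln (reg lam z) <= ln (B3 ^+ 2 + 1).
  rewrite ler_ln ?posrE//; first by rewrite /reg; lra.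
  by rewrite ltr_wpDl ?sqr_ge0.
have h2 : - (4 * lam) <= ln (reg lam z).
  rewrite -[leLHS]expRK ler_ln ?posrE//.
  by rewrite /reg lerDr sqr_ge0.
have h3 : 0 <= ln (B3 ^+ 2 + 1) * lam by rewrite mulr_ge0// ltW.
rewrite /ker ler_norml; apply/andP; split; lra.
Qed.

(** With p = |sg z| and regularisation length d, p / (p^2 + d^2) <= 2 / (p + d), and p is at least
    [a] times the distance to one of the three possible zeros. Summing over all three removes the
    alternative; the minimum with 1 makes the lower bound cover d too. *)
Let ker'_pointwise lam z : 0 < lam -> `|z| <= 3 * l ->
  `|ker' lam z| <= 2 * B / Num.min a 1 *
    ((`|z - 0| + expR (- (2 * lam)))^-1 + (`|z - 2 * l| + expR (- (2 * lam)))^-1 +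
     (`|z - - (2 * l)| + expR (- (2 * lam)))^-1).
Proof.
move=> lam0 z3; set d := expR (- (2 * lam)).
have d0 : 0 < d by exact: expR_gt0.
have d2 : expR (- (4 * lam)) = d ^+ 2 by rewrite expr2 /d -expRD; congr expR; ring.
have B0 : 0 <= B by apply: le_trans (sgB 0).
set a1 := Num.min a 1.
have a10 : 0 < a1 by rewrite lt_min a0 ltr01.
have a1a : a1 <= a by rewrite ge_min lexx.
have a11 : a1 <= 1 by rewrite ge_min lexx orbT.
have C0 : 0 <= 2 * B / a1 by rewrite divr_ge0 ?mulr_ge0// ltW.
have i0 (v : R) : 0 <= (`|v| + d)^-1 by rewrite invr_ge0 addr_ge0// ltW.
have step (v : R) : a * `|v| <= `|sg z| -> `|ker' lam z| <= 2 * B / a1 * (`|v| + d)^-1.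
  move=> h.
  rewrite /ker' /reg normrM normfV d2 (gtr0_norm (_ : 0 < sg z ^+ 2 + d ^+ 2)); last first.
    by rewrite ltr_wpDl ?sqr_ge0// exprn_gt0.
  rewrite normrM -[in X in _ / X](real_normK (num_real (sg z))).
  set p := `|sg z| in h *; have p0 : 0 <= p by exact: normr_ge0.
  have q0 : 0 < p ^+ 2 + d ^+ 2 by rewrite ltr_wpDl ?sqr_ge0// exprn_gt0.
  have v0 : 0 < `|v| + d by rewrite ltr_wpDl.
  rewrite ler_pdivrMr//.
  have h1 : a1 * (`|v| + d) <= p + d.
    rewrite mulrDr; apply: lerD; last by rewrite -[leRHS]mul1r; apply: ler_wpM2r => //; exact: ltW.
    by apply: le_trans h; apply: ler_wpM2r.
  have h2 : p * (p + d) <= 2 * (p ^+ 2 + d ^+ 2).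
    have := sqr_ge0 (p - d); have := sqr_ge0 d; have := sqr_ge0 p; rewrite sqrrB mulrDr -expr2; lra.
  have h3 : p * `|sg' z| <= p * B by apply: ler_wpM2l => //; exact: sgB.
  apply: le_trans h3 _.
  have -> : 2 * B / a1 * (`|v| + d)^-1 * (p ^+ 2 + d ^+ 2) =
      2 * (p ^+ 2 + d ^+ 2) / (a1 * (`|v| + d)) * B by field; rewrite !gt_eqF.
  apply: ler_wpM2r => //; rewrite ler_pdivlMr ?mulr_gt0//.
  by apply: le_trans h2; apply: ler_wpM2l.
have i1 := i0 (z - 0); have i2 := i0 (z - 2 * l); have i3 := i0 (z - - (2 * l)).
have [h|h|h] := sg_low z3; apply: le_trans (step _ h) _; apply: ler_wpM2l => //; lra.
Qed.


Lemma kernel_family_ker : kernel_family l ker ker'.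
Proof.
have B0 : 0 <= B by apply: le_trans (sgB 0).
have [K1 K10 HK1] := ker_bound.
set C := 2 * B / Num.min a 1.
have C0 : 0 <= C by rewrite divr_ge0 ?mulr_ge0// le_min ltW//= ler01.
have L0 : 0 <= ln (4 * l + 1) by apply: ln_ge0; have := l0; lra.
set K2 := C * (6 * (ln (4 * l + 1) + 2)).
have K20 : 0 <= K2 by rewrite mulr_ge0// mulr_ge0// addr_ge0.
split.
- by move=> lam z _; exact: ker_derive.
- by move=> lam _; exact: ker'_continuous.
- exact: ker_even.
- exact: ker'_odd.
exists (K1 + K2); first by rewrite addr_ge0.
move=> lam lam0; have l1 : 0 <= 1 + lam by rewrite addr_ge0// ltW.
split.
  move=> z z2; apply: le_trans (HK1 lam z lam0 z2) _.
  by apply: ler_wpM2r => //; rewrite lerDl.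
move=> x xI; set d := expR (- (2 * lam)).
have d0 : 0 < d by exact: expR_gt0.
pose g c y := (`|y - c| + d)^-1.
have cg c : cts (- l) l (g c).
  move=> y _; apply: cvgV; first by rewrite gt_eqF// ltr_wpDl.
  apply: cvgD; last exact: cvg_cst.
  apply: cvg_norm.
  exact: is_derive_continuous (isdB (isd_id y) (isd_cst y c)).
have gI c : `|c| <= 3 * l -> rint (- l) l (g c) <= 2 * (ln (4 * l + 1) + 2 * lam).
  rewrite ler_norml => /andP[c1 c2].
  apply: le_trans (inv_int d0 ll (_ : c - 4 * l <= - l) (_ : l <= c + 4 * l)) _; try lra.
  have -> : ln d = - (2 * lam) by rewrite /d expRK.
  rewrite opprK; apply: ler_wpM2l => //; rewrite lerD2r ler_ln ?posrE; last 2 first.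
  - by have := l0; have := d0; lra.
  - by have := l0; lra.
  by rewrite lerD2l /d -[leRHS]expR0 ler_expR; lra.
have ck : cts (- l) l (fun y => `|ker' lam (x - y)|).
  apply: cts_norm => y _.
  apply: (@continuous_comp _ _ _ (fun y => x - y) (ker' lam)); last exact: ker'_continuous.
  exact: is_derive_continuous (isdB (isd_cst y x) (isd_id y)).
have cs : cts (- l) l (fun y => g x y + g (x - 2 * l) y + g (x + 2 * l) y).
  by apply: ctsD => //; apply: ctsD.
apply: (@le_trans _ _ (rint (- l) l (fun y => C * (g x y + g (x - 2 * l) y + g (x + 2 * l) y)))).
  apply: le_rint => //; first exact: ctsZ.
  move=> y yI; have y3 : `|x - y| <= 3 * l.
    by rewrite ler_norml; move: xI yI (l0) => /andP[? ?] /andP[? ?] ?; apply/andP; split; lra.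
  apply: le_trans (ker'_pointwise lam0 y3) _; rewrite -/C -/d; apply: ler_wpM2l => //.
  have E (p q : R) : p = - q -> `|p| = `|q| by move=> ->; rewrite normrN.
  rewrite /g (E (x - y - 0) (y - x)); last by ring.
  rewrite (E (x - y - 2 * l) (y - (x - 2 * l))); last by ring.
  by rewrite (E (x - y - - (2 * l)) (y - (x + 2 * l)))//; ring.
rewrite rintZ// rintD//; last by apply: ctsD.
rewrite rintD//.
have g1 : rint (- l) l (g x) <= 2 * (ln (4 * l + 1) + 2 * lam).
  by apply: gI; rewrite ler_norml; move: xI (l0) => /andP[? ?] ?; apply/andP; split; lra.
have g2 : rint (- l) l (g (x - 2 * l)) <= 2 * (ln (4 * l + 1) + 2 * lam).
  by apply: gI; rewrite ler_norml; move: xI (l0) => /andP[? ?] ?; apply/andP; split; lra.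
have g3 : rint (- l) l (g (x + 2 * l)) <= 2 * (ln (4 * l + 1) + 2 * lam).
  by apply: gI; rewrite ler_norml; move: xI (l0) => /andP[? ?] ?; apply/andP; split; lra.
apply: (@le_trans _ _ (K2 * (1 + lam))); last by apply: ler_wpM2r => //; rewrite lerDr.
rewrite /K2 -mulrA; apply: ler_wpM2l => //.
have p : 0 <= ln (4 * l + 1) * lam by rewrite mulr_ge0// ltW.
by move: g1 g2 g3 p L0 lam0; lra.
Qed.

Let sing z := isqrt 0 z + isqrt (2 * l) z + isqrt (- (2 * l)) z.

(** With [t] the ratio exp(- lam) / |sg z|^(1/2), the regularised argument is |sg z|^2 (1 + t^4),
    and ln(1 + t^4) <= 4 ln(1 + t) <= 4 t. The square root in t is what makes the error integrable
    in z. *)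
Let sker_approx lam z : 0 < lam -> `|z| <= 3 * l ->
  z != 0 -> z != 2 * l -> z != - (2 * l) ->
  `|sker z - ker lam z| <= 2 * expR (- (2^-1 * ln a)) * expR (- lam) * sing z.
Proof.
move=> lam0 z3 n1 n2 n3.
have e0 c y : 0 <= isqrt c y by exact: expR_ge0.
suff step c : z != c -> a * `|z - c| <= `|sg z| ->
    `|sker z - ker lam z| <= 2 * expR (- (2^-1 * ln a)) * expR (- lam) * isqrt c z.
  have C0 : 0 <= 2 * expR (- (2^-1 * ln a)) * expR (- lam).
    by rewrite mulr_ge0 ?mulr_ge0 ?expR_ge0.
  have i1 := e0 0 z; have i2 := e0 (2 * l) z; have i3 := e0 (- (2 * l)) z.
  have [h|h|h] := sg_low z3; (apply: le_trans (step _ _ h) _ => //;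
    apply: ler_wpM2l => //; rewrite /sing; lra).
move=> zc h.
have v0 : 0 < `|z - c| by rewrite normr_gt0 subr_eq0.
have s0 : 0 < `|sg z| by apply: lt_le_trans h; rewrite mulr_gt0.
set t := expR (- lam - 2^-1 * ln `|sg z|).
have t0 : 0 < t by exact: expR_gt0.
have rE : reg lam z = `|sg z| ^+ 2 * (1 + t ^+ 4).
  have -> : t ^+ 4 = expR (- (4 * lam)) / `|sg z| ^+ 2.
    have sP : `|sg z| \is Num.pos by rewrite posrE.
    rewrite /t -expRM_natl -[in RHS](lnK sP).
    by rewrite -expRM_natl -expRN -expRD; congr expR; field.
  rewrite /reg.
  have -> : sg z ^+ 2 = `|sg z| ^+ 2 by rewrite real_normK// num_real.
  by field; rewrite gt_eqF.
have t4 : 0 <= t ^+ 4 by rewrite exprn_ge0// ltW.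
have kE : ker lam z = sker z + 2^-1 * ln (1 + t ^+ 4).
  rewrite /ker rE lnM ?posrE ?exprn_gt0//; last by rewrite ltr_wpDr.
  by rewrite lnXn// /sker -[ln _ *+ 2]mulr_natl; field.
rewrite kE opprD addrA subrr add0r normrN.
have L0 : 0 <= ln (1 + t ^+ 4) by rewrite ln_ge0// lerDl.
rewrite ger0_norm ?mulr_ge0//.
have L1 : ln (1 + t ^+ 4) <= 4 * t.
  apply: (@le_trans _ _ (ln ((1 + t) ^+ 4))).
    rewrite ler_ln ?posrE ?ltr_wpDr ?exprn_gt0// ?addr_gt0//.
    have t1 := ltW t0; have t2 : 0 <= t ^+ 2 by exact: sqr_ge0.
    have t3 : 0 <= t ^+ 3 by rewrite exprn_ge0.
    have -> : (1 + t) ^+ 4 = 1 + 4 * t + 6 * t ^+ 2 + 4 * t ^+ 3 + t ^+ 4 by ring.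
    lra.
  rewrite lnXn ?addr_gt0// -[ln _ *+ 4]mulr_natl; apply: ler_wpM2l => //.
  by apply: le_ln1Dx; apply: lt_trans t0; rewrite ltrN10.
have L2 : t <= expR (- (2^-1 * ln a)) * expR (- lam) * isqrt c z.
  rewrite /t /isqrt -!expRD ler_expR.
  have : ln a + ln `|z - c| <= ln `|sg z|.
    by rewrite -lnM ?posrE// ler_ln ?posrE// mulr_gt0.
  lra.
by rewrite -!mulrA; rewrite -!mulrA in L2; lra.
Qed.

Let measurable_sker : measurable_fun setT (sker : MR -> R).
Proof.
apply: measurableT_comp; first exact: measurable_ln.
apply: measurableT_comp; first exact: normr_measurable.
exact: continuous_measurable_fun.
Qed.

(** The point x ranges over ]-2l, 2l[ so that derivatives at -l and l will be two-sided; then |x -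
    y| <= 3l, which explains the range in [sg_low]. M is independent of f, x and [lam]. *)
Lemma vel_sker_approx : exists2 M, 0 <= M & forall f F, cts (- l) l f -> 0 <= F ->
  (forall y, - l <= y <= l -> `|f y| <= F) ->
  forall lam x, 0 < lam -> - (2 * l) < x < 2 * l ->
  `|vel l sker f x - vel l (ker lam) f x| <= F * M * expR (- lam).
Proof.
set Ca := 2 * expR (- (2^-1 * ln a)).
have Ca0 : 0 <= Ca by rewrite mulr_ge0// expR_ge0.
have l5 : 0 < 5 * l by rewrite mulr_gt0.
set S := 4 * expR (2^-1 * ln (5 * l)).
have S0 : 0 <= S by rewrite mulr_ge0// expR_ge0.
exists (Ca * (3 * S)); first by rewrite mulr_ge0// mulr_ge0.
move=> f F cf F0 fF lam x lam0 /andP[x1 x2].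
pose D : set MR := `[- l, l]%classic.
have mD : measurable D by exact: measurable_itv.
pose h (y : MR) := f y * sker (x - y) - f y * ker lam (x - y).
have mf : measurable_fun D (f : MR -> R) by exact: cts_measurable.
have msub : measurable_fun D (fun y : MR => x - y : MR) by apply: measurable_funB.
have ms : measurable_fun D (fun y : MR => f y * sker (x - y)).
  by apply: measurable_funM => //; exact: (measurableT_comp measurable_sker msub).
have cfk : cts (- l) l (fun y => f y * ker lam (x - y)).
  apply: ctsM => // y _.
  apply: (@continuous_comp _ _ _ (fun y => x - y) (ker lam)); last exact: ker_continuous.
  exact: is_derive_continuous (isdB (isd_cst y x) (isd_id y)).
have Ik := cts_integrable cfk.
have mh : measurable_fun D h by apply: measurable_funB => //; exact: cts_measurable.
pose g (y : MR) := F * (Ca * expR (- lam)) *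
  (isqrt x y + isqrt (x - 2 * l) y + isqrt (x + 2 * l) y).
have K0 : 0 <= F * (Ca * expR (- lam)) by rewrite mulr_ge0// mulr_ge0// expR_ge0.
have i0 c y : 0 <= isqrt c y by exact: expR_ge0.
have mi c : measurable_fun D (isqrt c : MR -> R) by exact: measurable_isqrt.
have msum : measurable_fun D (fun y : MR => isqrt x y + isqrt (x - 2 * l) y + isqrt (x + 2 * l) y).
  by apply: measurable_funD => //; apply: measurable_funD.
have mg : measurable_fun D g by apply: measurable_funM.
have le1 : (\int[mu]_(y in D) `|(h y)%:E| <= \int[mu]_(y in D) (g y)%:E)%E.
  apply: ae_ge0_le_integral => //.
  - by apply/measurable_EFinP; apply: measurableT_comp => //; exact: normr_measurable.
  - by move=> y _; rewrite lee_fin mulr_ge0// !addr_ge0.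
  - by apply/measurable_EFinP.
  (* The pointwise bound fails to apply at the possible zeros of the kernel's argument, that is, at
     three values of y, a null set. *)
  have cN : countable [set x; x - 2 * l; x + 2 * l].
    by apply: finite_set_countable; rewrite !finite_setU; do !split; exact: finite_set1.
  exists [set x; x - 2 * l; x + 2 * l]; split.
  - by apply: countable_measurable => // t; exact: measurable_set1.
  - exact: countable_lebesgue_measure0.
  move=> y /= H; apply: contrapT => ny; apply: H; rewrite /D/= in_itv/= => yI.
  have n1 : x - y != 0.
    by apply/eqP => E; apply: ny; left; left; move: E; lra.
  have n2 : x - y != 2 * l.
    by apply/eqP => E; apply: ny; left; right; move: E => /=; lra.
  have n3 : x - y != - (2 * l).
    by apply/eqP => E; apply: ny; right; move: E => /=; lra.
  have y3 : `|x - y| <= 3 * l.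
    by rewrite ler_norml; move: yI x1 x2 => /andP[? ?] ? ?; apply/andP; split; lra.
  have Hn := sker_approx lam0 y3 n1 n2 n3.
  rewrite lee_fin /h -mulrBr normrM /g -mulrA; apply: ler_pM => //; first exact: fF.
  apply: le_trans Hn _; apply: ler_wpM2l; first by rewrite mulr_ge0// expR_ge0.
  have E (c1 c2 : R) : x - y - c1 = - (y - c2) -> isqrt c1 (x - y) = isqrt c2 y.
    by rewrite /isqrt => ->; rewrite normrN.
  rewrite /sing (E 0 x); last by ring.
  rewrite (E (2 * l) (x - 2 * l)); last by ring.
  by rewrite (E (- (2 * l)) (x + 2 * l))//; ring.
have le2 : (\int[mu]_(y in D) (g y)%:E <= (F * (Ca * expR (- lam)) * (3 * S))%:E)%E.
  have I3 : (\int[mu]_(y in D) (isqrt x y + isqrt (x - 2 * l) y + isqrt (x + 2 * l) y)%:E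
      <= (3 * S)%:E)%E.
    have iS c : - (4 * l) <= c <= 4 * l -> (\int[mu]_(y in D) (isqrt c y)%:E <= S%:E)%E.
      by move=> /andP[c1 c2]; apply: isqrt_int => //; move: c1 c2; lra.
    have mE c : measurable_fun D (fun y : MR => (isqrt c y)%:E) by exact/measurable_EFinP.
    under eq_integral => y _ do rewrite !EFinD.
    rewrite ge0_integralD//; last 3 first.
    - by move=> y _; rewrite -EFinD lee_fin addr_ge0.
    - by apply/measurable_EFinP; apply: measurable_funD.
    - by move=> y _; rewrite lee_fin.
    rewrite ge0_integralD//; last 2 first.
    - by move=> y _; rewrite lee_fin.
    - by move=> y _; rewrite lee_fin.
    have -> : (3 * S)%:E = (S%:E + S%:E + S%:E)%E by rewrite -!EFinD; congr EFin; ring.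
    by apply: leeD; [apply: leeD|]; apply: iS; move: x1 x2; lra.
  rewrite /g; under eq_integral => y _ do rewrite EFinM.
  rewrite ge0_integralZl//; last 2 first.
  - by apply/measurable_EFinP.
  - by move=> y _; rewrite lee_fin !addr_ge0.
  by rewrite [leRHS]EFinM; apply: lee_wpmul2l => //; rewrite lee_fin.
have le3 := le_trans le1 le2.
have Ih : mu.-integrable D (EFin \o h).
  apply/integrableP; split; first exact/measurable_EFinP.
  exact: le_lt_trans le3 (ltry _).
(* The singular integrand is integrable as the sum of the difference [h], just bounded, and the
   regularised integrand. *)
have Is : mu.-integrable D (EFin \o (fun y => f y * sker (x - y))).
  have Isum := integrableD mD Ih Ik.
  apply: eq_integrable Isum => // y _ /=.
  by rewrite /h -EFinD; congr EFin; ring.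
have Eh : rint (- l) l (fun y => f y * sker (x - y)) -
    rint (- l) l (fun y => f y * ker lam (x - y)) = \int[mu]_(y in D) h y.
  by rewrite /rint -RintegralB.
rewrite /vel -mulrBr normrM Eh.
have /andP[p0 p1] := @pi_inv_bound R.
rewrite (gtr0_norm p0).
have N : `|\int[mu]_(y in D) h y| <= F * (Ca * (3 * S)) * expR (- lam).
  apply: le_trans (le_normr_Rintegral mD Ih) _.
  rewrite -lee_fin /Rintegral fineK; last first.
    rewrite ge0_fin_numE; first exact: le_lt_trans le3 (ltry _).
    by apply: integral_ge0 => y _; rewrite lee_fin.
  by apply: le_trans le3 _; rewrite lee_fin le_eqVlt; apply/orP; left; apply/eqP; ring.
by apply: le_trans N; rewrite ler_piMl.
Qed.

(** Integration by parts moves the derivative from the kernel to f. The singular u_x can then be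
    defined with a log kernel against f', and no principal value arises. The hypothesis on the ends
    cancels the boundary terms. *)
Let mono (f df : R -> R) lam : (forall y, - l <= y <= l -> is_derive y 1 f (df y)) ->
  cts (- l) l df ->
  (forall x, f l * ker lam (x - l) = f (- l) * ker lam (x + l)) ->
  forall x, vel l (ker' lam) f x = vel l (ker lam) df x.
Proof.
move=> fd cdf fb x; rewrite /vel; congr (_ * _).
have d1 y : - l <= y <= l -> is_derive y 1 (fun y => - ker lam (x - y)) (ker' lam (x - y)).
  move=> _; apply: (isd_eq (isdN (isd_comp (isdB (isd_cst y x) (isd_id y)) (ker_derive lam (x - y))))).
  by ring.
have cxy (k : R -> R) : continuous k -> cts (- l) l (fun y => k (x - y)).
  move=> ck y _; apply: (@continuous_comp _ _ _ (fun y => x - y) k); last exact: ck.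
  exact: is_derive_continuous (isdB (isd_cst y x) (isd_id y)).
have ck' := cxy _ (ker'_continuous (lam := lam)).
have ck := cxy _ (ker_continuous (lam := lam)).
rewrite (rint_parts ll fd d1)//=.
have -> : f l * - ker lam (x - l) - f (- l) * - ker lam (x - - l) = 0.
  by rewrite !mulrN (opprK l) fb; ring.
rewrite sub0r.
rewrite -rintN; last by apply: ctsM => //; exact: ctsN.
by apply: eq_rint => y _; rewrite mulrN opprK.
Qed.

Let vel_derive (f df : R -> R) lam : (forall y, - l <= y <= l -> is_derive y 1 f (df y)) ->
  forall x, is_derive x 1 (vel l (ker lam) f) (vel l (ker' lam) f x) /\
   {for x, continuous (vel l (ker' lam) f)}.
Proof.
move=> fd x; have cf : cts (- l) l f by exact: is_derive_cts fd.
split; last first.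
  apply: cvgM; first exact: cvg_cst.
  by apply: convol_continuous => //; exact: ker'_continuous.
have [F [F0 fF]] := cts_bounded cf.
have dk y t : is_derive t 1 (fun t => f y * ker lam (t - y)) (f y * ker' lam (t - y)).
  apply: isdZ; apply: (isd_eq (isd_comp (isdB (isd_id t) (isd_cst t y)) (ker_derive lam (t - y)))).
  by ring.
have TD : tdiff (- l) l (x - 1) (x + 1) (fun y t => f y * ker lam (t - y))
    (fun y t => f y * ker' lam (t - y)).
  have cc k : continuous k -> continuous (fun t => rint (- l) l (fun y => f y * k (t - y))).
    by move=> ck; exact: convol_continuous.
  have bnd k : continuous k -> exists2 C, 0 <= C & forall y t, - l <= y <= l -> x - 1 <= t <= x + 1 ->
      `|f y * k (t - y)| <= C.
    move=> ck.
    have [K [K0 HK]] := cts_bounded (continuous_cts (a := x - 1 - l) (b := x + 1 + l) ck).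
    exists (F * K); first exact: mulr_ge0.
    move=> y t yI tI; rewrite normrM; apply: ler_pM => //; first exact: fF.
    by apply: HK; move: yI tI => /andP[? ?] /andP[? ?]; apply/andP; split; lra.
  have [C1 C10 HC1] := bnd _ (ker_continuous (lam := lam)).
  have [C2 C20 HC2] := bnd _ (ker'_continuous (lam := lam)).
  split.
  - move=> t _; apply: ctsM => // y _.
    apply: (@continuous_comp _ _ _ (fun y => t - y) (ker lam)); last exact: ker_continuous.
    exact: is_derive_continuous (isdB (isd_cst y t) (isd_id y)).
  - move=> y _; apply: cts_within => t _; exact: is_derive_continuous (dk y t).
  - by move=> y t _ _; exact: dk.
  exists (C1 + C2); split=> y t yI tI.
    by apply: le_trans (HC1 y t yI tI) _; rewrite lerDl.
  apply: le_trans (HC2 y t yI _) _; last by rewrite lerDr.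
  by move: tI => /andP[/ltW -> /ltW ->].
have [_ H] := tdiff_rint ll TD.
by apply: isdZ; apply: H; apply/andP; split; lra.
Qed.

(** Both u = K * f and K * f' are uniform limits of regularised convolutions, and at the regularised
    level the second is the derivative of the first; [limit_derive] passes this to the limit. *)
Lemma singular_velocity : exists2 M, 0 <= M & forall (f df : R -> R) F, 0 <= F ->
  (forall y, - l <= y <= l -> is_derive y 1 f (df y)) -> cts (- l) l df ->
  (forall y, - l <= y <= l -> `|f y| <= F) -> (forall y, - l <= y <= l -> `|df y| <= F) ->
  (forall lam x, f l * ker lam (x - l) = f (- l) * ker lam (x + l)) ->
  forall x, - l <= x <= l ->
  [/\ is_derive x 1 (vel l sker f) (vel l sker df x), {for x, continuous (vel l sker df)} &
    forall lam, 0 < lam ->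
      `|vel l sker f x - vel l (ker lam) f x| <= F * M * expR (- lam) /\
      `|vel l sker df x - vel l (ker' lam) f x| <= F * M * expR (- lam)].
Proof.
have [M M0 HM] := vel_sker_approx; exists M => // f df F F0 fd cdf fF dfF fb x xI.
have cf : cts (- l) l f by exact: is_derive_cts fd.
have x2 : - (2 * l) < x < 2 * l by move: xI (l0) => /andP[? ?] ?; apply/andP; split; lra.
have A lam z : 0 < lam -> - (2 * l) < z < 2 * l ->
    `|vel l sker f z - vel l (ker lam) f z| <= F * M * expR (- lam) /\
    `|vel l sker df z - vel l (ker' lam) f z| <= F * M * expR (- lam).
  move=> lam0 zI; split; first exact: HM.
  rewrite (mono fd cdf (fb lam)); exact: HM.
have D lam z : 0 < lam -> - (2 * l) < z < 2 * l ->
    is_derive z 1 (vel l (ker lam) f) (vel l (ker' lam) f z).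
  by move=> _ _; have [] := vel_derive lam fd z.
have Cc lam z : 0 < lam -> - (2 * l) < z < 2 * l ->
    {for z, continuous (vel l (ker' lam) f)}.
  by move=> _ _; have [] := vel_derive lam fd z.
have [d c] := limit_derive A D Cc x2.
by split => // lam lam0; exact: A.
Qed.

End regularised_kernels.

(** * The weights 1/x and cot, and the kernel inequalities *)

Section weights.
Context {R : realType}.
Implicit Types (x y z t lam : R).

Lemma isdV (f : R -> R) x (df : R) : f x != 0 -> is_derive x 1 f df ->
  is_derive x 1 (fun y => (f y)^-1) (- df / f x ^+ 2).
Proof.
move=> f0 H; apply: (isd_eq (is_deriveV f0 H)).
by rewrite /GRing.scale/= mulNr mulrC mulNr.
Qed.

(** This is artanh z >= z at z = (A - B) / (A + B). The difference of the two sides, as a function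
    of t in place of A, has derivative (t - B)^2 / (2 t (t + B)^2). *)
Lemma ln_ratio (A B : R) : 0 < B -> B <= A -> (A - B) / (A + B) <= 2^-1 * ln A - 2^-1 * ln B.
Proof.
move=> B0 BA; have A0 : 0 < A by exact: lt_le_trans BA.
pose F t := 2^-1 * ln t - (t - B) / (t + B).
have dF t : B <= t <= A -> is_derive t 1 F (2^-1 * t^-1 - 2 * B / (t + B) ^+ 2).
  move=> /andP[Bt _]; have t0 : 0 < t by exact: lt_le_trans Bt.
  have tB : t + B != 0 by rewrite gt_eqF// addr_gt0.
  have d1 := isdZ 2^-1 (is_derive1_ln t0).
  have d2 := isdD (isd_id t) (isd_cst t B).
  have d3 := @isdV (fun y => y + B) t _ tB d2.
  have d4 := isdM (isdB (isd_id t) (isd_cst t B)) d3.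
  apply: (isd_eq (isdB d1 d4)); rewrite /GRing.scale/=; field.
  by rewrite (gt_eqF t0) tB.
have cF : {within `[B, A], continuous F}.
  by apply: cts_within => t tI; exact: is_derive_continuous (dF t tI).
have := nondecreasing_within cF _ _ (lexx B) BA (lexx A).
have F' t : B < t < A -> is_derive t 1 F (2^-1 * t^-1 - 2 * B / (t + B) ^+ 2).
  by move=> /andP[/ltW h1 /ltW h2]; apply: dF; rewrite h1.
move=> /(_ _ F'); rewrite /F subrr mul0r subr0 => H.
have : 2^-1 * ln B <= 2^-1 * ln A - (A - B) / (A + B).
  apply: H => t /andP[/ltW Bt _]; have t0 : 0 < t by exact: lt_le_trans Bt.
  have tB : 0 < t + B by rewrite addr_gt0.
  have -> : 2^-1 * t^-1 - 2 * B / (t + B) ^+ 2 = 2^-1 * (t - B) ^+ 2 / (t * (t + B) ^+ 2).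
    by field; rewrite !gt_eqF.
  apply: divr_ge0; apply: mulr_ge0; rewrite ?sqr_ge0//; exact: ltW.
lra.
Qed.

(* The line is k = 0, s x = x, c x = 1, m = 1; the circle is k = 1, s x = sin (m x),
   c x = cos (m x). *)
Variables (s c : R -> R) (m k l a : R).
Hypotheses (l0 : 0 < l) (m0 : 0 < m) (k0 : 0 <= k) (a0 : 0 < a).
Hypothesis s_add : forall x y, s (x + y) = s x * c y + c x * s y.
Hypothesis c_add : forall x y, c (x + y) = c x * c y - k * (s x * s y).
Hypothesis s_odd : forall x, s (- x) = - s x.
Hypothesis c_even : forall x, c (- x) = c x.
Hypothesis cs1 : forall x, c x ^+ 2 + k * s x ^+ 2 = 1.
Hypothesis ds : forall x, is_derive x 1 s (m * c x).
Hypothesis dc : forall x, is_derive x 1 c (- (k * m * s x)).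
Hypothesis c_ge0 : forall x, 0 <= x <= l -> 0 <= c x.
Hypothesis s_low : forall x, 0 <= x <= l -> a * x <= s x.

Notation kd := (ker s).
Notation kd' := (ker' s (fun x => m * c x)).

Let s0 : s 0 = 0.
Proof. by have := s_odd 0; rewrite oppr0; lra. Qed.

Let s_gt0 x : 0 < x <= l -> 0 < s x.
Proof.
move=> /andP[x0 xl]; apply: lt_le_trans (s_low _); first by rewrite mulr_gt0.
by rewrite (ltW x0).
Qed.

Let s_mono x y : 0 <= x -> x <= y -> y <= l -> s x <= s y.
Proof.
move=> x0 xy yl.
have cs : {within `[0, l], continuous s}.
  by apply: cts_within => t _; exact: is_derive_continuous (ds t).
apply: (nondecreasing_within cs (df := fun x => m * c x)) => //.
move=> t /andP[/ltW t0 /ltW tl]; apply: mulr_ge0; first exact: ltW.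
by apply: c_ge0; rewrite t0.
Qed.

Let c_le1 x : `|c x| <= 1.
Proof.
have h : c x ^+ 2 <= 1 by rewrite -(cs1 x) lerDl mulr_ge0 ?sqr_ge0.
by rewrite -(ler_pXn2r (ltn0Sn 1)) ?nnegrE// real_normK ?num_real// expr1n.
Qed.

Definition cot x : R := c x / s x.
Definition csc2 x : R := m / s x ^+ 2.

Let D lam := expR (- (4 * lam)) : R.
Let D0 lam : 0 < D lam. Proof. exact: expR_gt0. Qed.
Let N lam x y := s x ^+ 2 * c y ^+ 2 + c x ^+ 2 * s y ^+ 2 + D lam.
Let N0 lam x y : 0 < N lam x y.
Proof. by rewrite /N ltr_wpDl// addr_ge0// mulr_ge0// sqr_ge0. Qed.
Let A lam x y := reg s lam (x + y).
Let B lam x y := reg s lam (x - y).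
Let A0 lam x y : 0 < A lam x y.
Proof. by rewrite /A /reg ltr_wpDl ?sqr_ge0 ?expR_gt0. Qed.
Let B0 lam x y : 0 < B lam x y.
Proof. by rewrite /B /reg ltr_wpDl ?sqr_ge0 ?expR_gt0. Qed.

Let AE lam x y : A lam x y = (s x * c y + c x * s y) ^+ 2 + D lam.
Proof. by rewrite /A /reg s_add. Qed.
Let BE lam x y : B lam x y = (s x * c y - c x * s y) ^+ 2 + D lam.
Proof. by rewrite /B /reg s_add c_even s_odd mulrN. Qed.

Let k'E lam x y : kd' lam (x + y) =
  m * ((s x * c y + c x * s y) * (c x * c y - k * (s x * s y)) / A lam x y).
Proof. by rewrite /ker' -/(A lam x y) s_add c_add; ring. Qed.
Let k'mE lam x y : kd' lam (x - y) =
  m * ((s x * c y - c x * s y) * (c x * c y + k * (s x * s y)) / B lam x y).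
Proof.
by rewrite /ker' -/(B lam x y) s_add c_add c_even s_odd !mulrN opprK; ring.
Qed.

Let Lam lam x y := kd lam (x + y) - kd lam (x - y).

(** [ln_ratio] at the squares of s(x + y) and s(x - y), each plus D: their difference is 4 s(x) c(x)
    s(y) c(y) and their sum 2 N. The three kernel inequalities below use the logarithm through this
    bound alone. *)
Let Lam_low lam x y : 0 <= x <= l -> 0 <= y <= l ->
  0 <= 2 * (s x * c x * s y * c y) / N lam x y <= Lam lam x y.
Proof.
move=> xI yI.
have sx : 0 <= s x by rewrite -s0; move: xI => /andP[? ?]; exact: s_mono.
have sy : 0 <= s y by rewrite -s0; move: yI => /andP[? ?]; exact: s_mono.
have cx := c_ge0 xI; have cy := c_ge0 yI.
have p0 : 0 <= s x * c x * s y * c y by rewrite !mulr_ge0.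
apply/andP; split; first by apply: divr_ge0; [exact: mulr_ge0|exact: ltW].
have BA : B lam x y <= A lam x y.
  rewrite AE BE -subr_ge0.
  have -> : (s x * c y + c x * s y) ^+ 2 + D lam - ((s x * c y - c x * s y) ^+ 2 + D lam) =
    4 * (s x * c x * s y * c y) by ring.
  by rewrite mulr_ge0.
apply: le_trans (ln_ratio (B0 lam x y) BA); rewrite le_eqVlt; apply/orP; left; apply/eqP.
have n0 := N0 lam x y; have n1 : A lam x y + B lam x y = 2 * N lam x y.
  by rewrite AE BE /N; ring.
rewrite n1 AE BE; field; exact: lt0r_neq0.
Qed.

Lemma weight_cot : weight l m kd kd' cot csc2.
Proof.
split.
- by rewrite /cot s0 invr0 mulr0.
- by rewrite /csc2 s0 expr0n/= invr0 mulr0.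
- move=> x xI; have h := s_gt0 xI.
  have d := isdM (dc x) (@isdV s x _ (lt0r_neq0 h) (ds x)).
  apply: (isd_eq d); rewrite /csc2 /GRing.scale/= -[in RHS](mulr1 m) -(cs1 x).
  by field; exact: lt0r_neq0.
- move=> x xI; have h := s_gt0 xI.
  apply: cvgM; first exact: cvg_cst.
  apply: cvgV; first by rewrite lt0r_neq0// exprn_gt0.
  exact: is_derive_continuous (isd_sqr (ds x)).
- exists (a^-1 + m / a ^+ 2).
    by rewrite addr_ge0 ?invr_ge0 ?divr_ge0 ?sqr_ge0// ltW.
  move=> x /andP[xl1 xl2].
  have sl : a * `|x| <= `|s x|.
    have [x0|/ltW x0] := leP 0 x.
      by rewrite (ger0_norm x0); apply: le_trans (ler_norm _); apply: s_low; rewrite x0.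
    rewrite (ler0_norm x0) -normrN -s_odd; apply: le_trans (ler_norm _).
    by apply: s_low; rewrite oppr_ge0 x0 lerNl.
  have i0 : 0 <= a^-1 by rewrite invr_ge0 ltW.
  have i1 : 0 <= m / a ^+ 2 by rewrite divr_ge0 ?sqr_ge0// ltW.
  have [x0|x0] := eqVneq x 0.
    by rewrite x0 normr0 expr0n/= !mulr0 addr_ge0.
  have nx : 0 < `|x| by rewrite normr_gt0.
  have ns : 0 < `|s x| by apply: lt_le_trans sl; rewrite mulr_gt0.
  split.
    apply: (@le_trans _ _ a^-1); last by rewrite lerDl.
    rewrite /cot normrM normfV mulrAC ler_pdivrMr// ler_pdivlMl//.
    by apply: le_trans sl; apply: ler_wpM2l; [exact: ltW|rewrite ler_piMl].
  apply: (@le_trans _ _ (m / a ^+ 2)); last by rewrite lerDr.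
  rewrite /csc2 normrM normfV (gtr0_norm m0) normrX -mulrA; apply: ler_wpM2l; first exact: ltW.
  rewrite ler_pdivrMl ?exprn_gt0// ler_pdivlMr ?exprn_gt0// -exprMn mulrC.
  by rewrite lerXn2r ?nnegrE// mulr_ge0// ltW.
- move=> x /andP[x0 xl]; rewrite /cot divr_ge0//; first by apply: c_ge0; rewrite x0.
  by rewrite -s0; exact: s_mono.
- move=> x _; rewrite /cot /csc2 exprMn exprVn; apply: ler_wpM2l; first exact: ltW.
  rewrite ler_piMl ?invr_ge0 ?sqr_ge0//.
  by rewrite -(cs1 x) lerDl mulr_ge0 ?sqr_ge0.
- move=> lam x y _ xI yI; have /andP[h1 h2] := Lam_low lam xI yI.
  exact: le_trans h1 h2.
(* Without regularisation this is s(x)^2 c(y)^2 <= c(x)^2 s(y)^2, the monotonicity of the tangent.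
   The term d^2 from D costs at most d / (2 s(x)^2), because 2 s(x) c(y) d <= N. *)
- move=> x xI; have sx := s_gt0 xI; have /andP[x0 xl] := xI.
  have xI' : 0 <= x <= l by rewrite (ltW x0).
  exists ((2 * s x ^+ 2)^-1); first by rewrite invr_ge0 mulr_ge0// sqr_ge0.
  move=> lam y lam0 /andP[xy yl].
  have y0 : 0 < y by exact: lt_le_trans xy.
  have yI : 0 <= y <= l by rewrite (ltW y0).
  have sy : 0 < s y by apply: s_gt0; rewrite y0.
  have sxy : s x <= s y by apply: s_mono => //; exact: ltW.
  have cx := c_ge0 xI'; have cy := c_ge0 yI.
  have /andP[_ h] := Lam_low lam xI' yI.
  have wx : 0 <= cot x by rewrite /cot divr_ge0// ltW.
  apply: le_trans (ler_wpM2l wx h).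
  have n0 := N0 lam x y.
  set d := expR (- (2 * lam)); have d0 : 0 < d by exact: expR_gt0.
  have DE : D lam = d ^+ 2 by rewrite expr2 /d -expRD /D; congr expR; ring.
  have E1 : cot y - cot x * (2 * (s x * c x * s y * c y) / N lam x y) =
    c y / s y * ((s x ^+ 2 * c y ^+ 2 - c x ^+ 2 * s y ^+ 2 + d ^+ 2) / N lam x y).
    have -> : s x ^+ 2 * c y ^+ 2 - c x ^+ 2 * s y ^+ 2 + d ^+ 2 = N lam x y - 2 * (c x ^+ 2 * s y ^+ 2).
      by rewrite /N DE; ring.
    by rewrite /cot; field; rewrite !lt0r_neq0.
  have E2 : s x ^+ 2 * c y ^+ 2 <= c x ^+ 2 * s y ^+ 2.
    have h1 := cs1 x; have h2 := cs1 y.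
    have -> : c x ^+ 2 = 1 - k * s x ^+ 2 by lra.
    have -> : c y ^+ 2 = 1 - k * s y ^+ 2 by lra.
    rewrite mulrBl mulrBr mul1r mulr1.
    have -> : s x ^+ 2 * (k * s y ^+ 2) = k * s x ^+ 2 * s y ^+ 2 by ring.
    by rewrite lerD2r lerXn2r ?nnegrE// ltW.
  have E3 : 2 * (s x * c y * d) <= N lam x y.
    rewrite /N DE; have := sqr_ge0 (s x * c y - d).
    have := mulr_ge0 (sqr_ge0 (c x)) (sqr_ge0 (s y)).
    have -> : (s x * c y - d) ^+ 2 = s x ^+ 2 * c y ^+ 2 - 2 * (s x * c y * d) + d ^+ 2 by ring.
    lra.
  have dl : d <= expR (- lam) by rewrite /d ler_expR; lra.
  have E4 : cot y - cot x * (2 * (s x * c x * s y * c y) / N lam x y) <= (2 * s x ^+ 2)^-1 * d.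
    rewrite E1.
    apply: (@le_trans _ _ (c y / s y * (d ^+ 2 / N lam x y))).
      apply: ler_wpM2l; first by rewrite divr_ge0// ltW.
      by apply: ler_wpM2r; [rewrite invr_ge0 ltW|move: E2; lra].
    have -> : c y / s y * (d ^+ 2 / N lam x y) = d * (c y * d) / (s y * N lam x y).
      by field; rewrite !lt0r_neq0.
    rewrite ler_pdivrMr ?mulr_gt0// mulrC -mulrA.
    rewrite [leRHS](_ : _ = d * (s y * N lam x y) / (2 * s x ^+ 2)); last by field; exact: lt0r_neq0.
    rewrite ler_pdivlMr ?mulr_gt0 ?exprn_gt0//.
    have p1 : s x * (2 * (s x * c y * d)) <= s y * N lam x y.
      by apply: ler_pM => //; [exact: ltW|rewrite !mulr_ge0// ltW].
    have := ler_wpM2l (ltW d0) p1; congr (_ <= _); ring.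
  have i0 : 0 <= (2 * s x ^+ 2)^-1 by rewrite invr_ge0 mulr_ge0// sqr_ge0.
  by have := ler_wpM2l i0 dl; move: E4; lra.
(* The identity s(x + y) s(x - y) = X^2 - Y^2 expresses both A B and the difference of the kd' terms
   through X^2 - Y^2; after factoring out 2 m U V Y / X one compares a fraction over A B, with
   numerator at most D, to 1 / N. *)
- move=> lam x y lam0 /andP[y0 yx] xl.
  have x0 : 0 < x by exact: lt_le_trans yx.
  have sx : 0 < s x by apply: s_gt0; rewrite x0.
  have sy : 0 < s y by apply: s_gt0; rewrite y0 (le_trans yx).
  have xI : 0 <= x <= l by rewrite (ltW x0).
  have yI : 0 <= y <= l by rewrite (ltW y0) (le_trans yx).
  have cx := c_ge0 xI; have cy := c_ge0 yI.
  have syx : s y <= s x by apply: s_mono => //; exact: ltW.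
  have /andP[_ h] := Lam_low lam xI yI.
  have q0 : 0 <= csc2 x by rewrite /csc2 divr_ge0 ?sqr_ge0// ltW.
  have {}h := ler_wpM2l q0 h; rewrite -/(Lam lam x y).
  apply: le_trans (lerB (lexx _) h) _.
  have n0 := N0 lam x y; have p0 := A0 lam x y; have r0 := B0 lam x y.
  rewrite k'E k'mE.
  set X := s x in sx syx *; set Y := s y in sy syx *; set U := c x in cx *; set V := c y in cy *.
  have hx : U ^+ 2 = 1 - k * X ^+ 2 by have := cs1 x; rewrite -/U -/X; lra.
  have hy : V ^+ 2 = 1 - k * Y ^+ 2 by have := cs1 y; rewrite -/V -/Y; lra.
  have dd := D0 lam.
  have NE : N lam x y = X ^+ 2 * V ^+ 2 + U ^+ 2 * Y ^+ 2 + D lam by [].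
  have AE1 := AE lam x y; have BE1 := BE lam x y; rewrite -/X -/Y -/U -/V in AE1 BE1.
  have AB : A lam x y * B lam x y =
     (X ^+ 2 - Y ^+ 2) ^+ 2 + 2 * D lam * (N lam x y - D lam) + D lam ^+ 2.
    rewrite AE1 BE1 NE.
    have -> : X ^+ 2 - Y ^+ 2 = X ^+ 2 * V ^+ 2 - U ^+ 2 * Y ^+ 2 by rewrite hx hy; ring.
    ring.
  have hC : U ^+ 2 + k * X ^+ 2 = 1 by exact: cs1.
  have num : (X * V + U * Y) * (U * V - k * (X * Y)) * B lam x y -
      (X * V - U * Y) * (U * V + k * (X * Y)) * A lam x y =
      2 * (Y * V) * (D lam * (U ^+ 2 - k * X ^+ 2) - (X ^+ 2 - Y ^+ 2)).
    have -> : X ^+ 2 - Y ^+ 2 = (X ^+ 2 * V ^+ 2 - U ^+ 2 * Y ^+ 2) * (U ^+ 2 + k * X ^+ 2).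
      by rewrite hC mulr1 hx hy; ring.
    by rewrite AE1 BE1; ring.
  have E : cot x * (m * ((X * V + U * Y) * (U * V - k * (X * Y)) / A lam x y) -
      m * ((X * V - U * Y) * (U * V + k * (X * Y)) / B lam x y)) -
      csc2 x * (2 * (X * U * Y * V) / N lam x y) =
    2 * m * (U * V * Y) / X * ((D lam * (U ^+ 2 - k * X ^+ 2) - (X ^+ 2 - Y ^+ 2)) /
      (A lam x y * B lam x y) - (N lam x y)^-1).
    have E0 (p r : R) : m * (p / A lam x y) - m * (r / B lam x y) =
        m * ((p * B lam x y - r * A lam x y) / (A lam x y * B lam x y)).
      by field; rewrite !lt0r_neq0.
    by rewrite E0 num /cot /csc2 -/X -/U; field; rewrite !lt0r_neq0.
  rewrite E; apply: mulr_ge0_le0.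
    by rewrite divr_ge0 ?mulr_ge0// ltW.
  rewrite subr_le0 ler_pdivrMr ?mulr_gt0// ler_pdivlMl// AB.
  have Q0 : 0 <= X ^+ 2 - Y ^+ 2 by rewrite subr_ge0 lerXn2r ?nnegrE// ltW.
  have C1 : U ^+ 2 - k * X ^+ 2 <= 1.
    by have := mulr_ge0 k0 (sqr_ge0 X); move: hC; lra.
  have ND : D lam <= N lam x y.
    by rewrite NE lerDr addr_ge0// mulr_ge0// sqr_ge0.
  have e1 := ler_wpM2l (ltW dd) C1.
  have e2 : D lam * (U ^+ 2 - k * X ^+ 2) - (X ^+ 2 - Y ^+ 2) <= D lam by lra.
  have := ler_wpM2l (ltW n0) e2.
  have := ler_wpM2l (ltW dd) ND; have := sqr_ge0 (X ^+ 2 - Y ^+ 2); lra.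
(* As cot x + cot y = s(x + y) / (X Y) and cot y - cot x = s(x - y) / (X Y), the kd' terms acquire
   s(x + y)^2 / A = 1 - D / A and s(x - y)^2 / B = 1 - D / B. What remains follows from 1 / A <= 1 /
   B, from 4 / (A + B) <= 1 / A + 1 / B, and from N <= D + X^2 + Y^2. *)
- move=> lam x y lam0 xI yI.
  have sx := s_gt0 xI; have sy := s_gt0 yI; have [/andP[x0 xl] /andP[y0 yl]] := (xI, yI).
  have xI' : 0 <= x <= l by rewrite (ltW x0).
  have yI' : 0 <= y <= l by rewrite (ltW y0).
  have cx := c_ge0 xI'; have cy := c_ge0 yI'.
  have /andP[_ h] := Lam_low lam xI' yI'.
  have yxE : y - x = - (x - y) by rewrite opprB.
  have od := @ker'_odd R s (fun x => m * c x) s_odd (fun z => congr1 (fun v => m * v) (c_even z)).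
  have ev := @ker_even R s s_odd.
  rewrite (addrC y x) yxE ev od -/(Lam lam x y) opprK.
  have q0 z : 0 <= csc2 z by rewrite /csc2 divr_ge0 ?sqr_ge0// ltW.
  have {}h := ler_wpM2l (addr_ge0 (q0 x) (q0 y)) h.
  apply: (@le_trans _ _ (cot x * (kd' lam (x + y) - kd' lam (x - y)) +
     cot y * (kd' lam (x + y) + kd' lam (x - y)) -
     (csc2 x + csc2 y) * (2 * (s x * c x * s y * c y) / N lam x y))); first by move: h; lra.
  have n0 := N0 lam x y; have p0 := A0 lam x y; have r0 := B0 lam x y.
  rewrite k'E k'mE.
  set X := s x in sx *; set Y := s y in sy *; set U := c x in cx *; set V := c y in cy *.
  have hx : U ^+ 2 <= 1 by rewrite -(cs1 x) lerDl mulr_ge0 ?sqr_ge0.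
  have hy : V ^+ 2 <= 1 by rewrite -(cs1 y) lerDl mulr_ge0 ?sqr_ge0.
  have dd := D0 lam.
  have NE : N lam x y = X ^+ 2 * V ^+ 2 + U ^+ 2 * Y ^+ 2 + D lam by [].
  have AE1 := AE lam x y; have BE1 := BE lam x y; rewrite -/X -/Y -/U -/V in AE1 BE1.
  have XY0 : 0 <= k * (X * Y) by rewrite !mulr_ge0// ltW.
  have UV0 : 0 <= U * V by rewrite mulr_ge0.
  have E : cot x * (m * ((X * V + U * Y) * (U * V - k * (X * Y)) / A lam x y) -
      m * ((X * V - U * Y) * (U * V + k * (X * Y)) / B lam x y)) +
     cot y * (m * ((X * V + U * Y) * (U * V - k * (X * Y)) / A lam x y) +
      m * ((X * V - U * Y) * (U * V + k * (X * Y)) / B lam x y)) -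
     (csc2 x + csc2 y) * (2 * (X * U * Y * V) / N lam x y) =
    m / (X * Y) * ((X * V + U * Y) ^+ 2 / A lam x y * (U * V - k * (X * Y)) +
      (X * V - U * Y) ^+ 2 / B lam x y * (U * V + k * (X * Y)) -
      2 * (X ^+ 2 + Y ^+ 2) * (U * V) / N lam x y).
    by rewrite /cot /csc2 -/X -/Y -/U -/V; field; rewrite !lt0r_neq0.
  rewrite E; apply: mulr_ge0_le0; first by rewrite divr_ge0 ?mulr_ge0// ltW.
  have -> : (X * V + U * Y) ^+ 2 / A lam x y = 1 - D lam / A lam x y.
    have -> : (X * V + U * Y) ^+ 2 = A lam x y - D lam by rewrite AE1; ring.
    by field; exact: lt0r_neq0.
  have -> : (X * V - U * Y) ^+ 2 / B lam x y = 1 - D lam / B lam x y.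
    have -> : (X * V - U * Y) ^+ 2 = B lam x y - D lam by rewrite BE1; ring.
    by field; exact: lt0r_neq0.
  have i1 : (A lam x y)^-1 <= (B lam x y)^-1.
    rewrite lef_pV2 ?posrE// AE1 BE1 lerD2r -subr_ge0.
    have -> : (X * V + U * Y) ^+ 2 - (X * V - U * Y) ^+ 2 = 4 * (X * V * (U * Y)) by ring.
    by rewrite !mulr_ge0// ltW.
  have i2 : 2 / N lam x y <= (A lam x y)^-1 + (B lam x y)^-1.
    have -> : N lam x y = (A lam x y + B lam x y) / 2 by rewrite AE1 BE1 NE; field.
    rewrite -subr_ge0.
    have -> : (A lam x y)^-1 + (B lam x y)^-1 - 2 / ((A lam x y + B lam x y) / 2) =
      (A lam x y - B lam x y) ^+ 2 / (A lam x y * B lam x y * (A lam x y + B lam x y)).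
      by field; rewrite !lt0r_neq0// addr_gt0.
    by rewrite divr_ge0 ?sqr_ge0// !mulr_ge0// ltW// addr_gt0.
  have i3 : X ^+ 2 * V ^+ 2 + U ^+ 2 * Y ^+ 2 <= X ^+ 2 + Y ^+ 2.
    apply: lerD; first by rewrite ler_piMr ?sqr_ge0.
    by rewrite ler_piMl ?sqr_ge0.
  have i4 : D lam + X ^+ 2 * V ^+ 2 + U ^+ 2 * Y ^+ 2 = N lam x y by rewrite NE; ring.
  have i5 : 1 <= D lam / N lam x y + (X ^+ 2 + Y ^+ 2) / N lam x y.
    by rewrite -mulrDl ler_pdivlMr// mul1r -i4; lra.
  set ip := (A lam x y)^-1 in i1 i2 *; set iq := (B lam x y)^-1 in i1 i2 *.
  have j1 : 0 <= k * (X * Y) * (iq - ip) by rewrite mulr_ge0// subr_ge0.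
  have j2 := ler_wpM2l (mulr_ge0 UV0 (ltW dd)) i2.
  have j3 := ler_wpM2l UV0 i5.
  have j4 := mulr_ge0 (ltW dd) j1.
  set iN := (N lam x y)^-1 in j2 j3 *.
  move: j2 j3 j4; lra.
Qed.

End weights.

(** * Translation of integrals over a segment *)

Section shift.
Context {R : realType}.
Notation mu := (@lebesgue_measure R).
Notation MR := (measurableTypeR R).

Let phi (c : R) : MR -> MR := fun x => c + x.

Let mphi c : measurable_fun setT (phi c).
Proof. by apply: measurable_funD. Qed.

Lemma itv_shift (c a b : R) : phi c @^-1` `[c + a, c + b]%classic = `[a, b]%classic.
Proof. by apply/seteqP; split => x; rewrite /phi/= !in_itv/= !lerD2l. Qed.

Let shift_measure c (A : set MR) : measurable A -> pushforward mu (phi c) A = mu A.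
Proof.
move=> mA;
apply/esym; apply: (lebesgue_measure_unique (mu := pushforward mu (phi c))) => //= _ [[a b]] _ <-.
rewrite /pushforward.
have -> : phi c @^-1` `]a, b]%classic = `]a - c, b - c]%classic.
  by apply/seteqP; split => x; rewrite /phi/= !in_itv/= ltrBlDl lerBrDl.
rewrite !lebesgue_measure_itv/= !lte_fin ltrD2r -!EFinB.
by rewrite opprB addrA subrK.
Qed.

(** Positive and negative parts are translated separately, so measurability is enough and the
    logarithmic integrand can be moved as it stands. *)
Lemma Rintegral_shift (c a b : R) (f : MR -> R) : measurable_fun setT f ->
  \int[mu]_(y in `[c + a, c + b]) f y = \int[mu]_(y in `[a, b]) f (c + y).
Proof.
move=> mf; have mD : measurable (`[c + a, c + b] : set MR) by exact: measurable_itv.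
have H (g : MR -> \bar R) : measurable_fun setT g -> (forall y, (0 <= g y)%E) ->
    (\int[mu]_(y in `[(c + a)%R, (c + b)%R]) g y = \int[mu]_(y in `[a, b]) g (c + y)%R)%E.
  move=> mg g0.
  have := @ge0_integral_pushforward _ _ MR MR R (phi c) (mphi c) mu _ g mD
    (measurable_funTS mg) (fun y _ => g0 y).
  rewrite itv_shift => <-; apply: eq_measure_integral => A mA _.
  exact/esym/shift_measure.
have mE : measurable_fun setT (EFin \o f) by exact/measurable_EFinP.
rewrite /Rintegral; congr fine.
rewrite integralE [RHS]integralE; congr (_ - _)%E.
  rewrite (H _ (measurable_funepos mE) (funepos_ge0 _)).
  by apply: eq_integral => y _; rewrite !funeposE.
rewrite (H _ (measurable_funeneg mE) (funeneg_ge0 _)).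
by apply: eq_integral => y _; rewrite !funenegE.
Qed.

End shift.

(** * Blow-up for the line and the circle at once *)

Section trigonometric_blowup.
Context {R : realType}.
Implicit Types (x y z t lam : R).
Variables (s c : R -> R) (m k l a B3 : R).
Hypotheses (l0 : 0 < l) (m0 : 0 < m) (k0 : 0 <= k) (a0 : 0 < a).
Hypothesis s_add : forall x y, s (x + y) = s x * c y + c x * s y.
Hypothesis c_add : forall x y, c (x + y) = c x * c y - k * (s x * s y).
Hypothesis s_odd : forall x, s (- x) = - s x.
Hypothesis c_even : forall x, c (- x) = c x.
Hypothesis cs1 : forall x, c x ^+ 2 + k * s x ^+ 2 = 1.
Hypothesis ds : forall x, is_derive x 1 s (m * c x).
Hypothesis dc : forall x, is_derive x 1 c (- (k * m * s x)).
Hypothesis c_ge0 : forall x, 0 <= x <= l -> 0 <= c x.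
Hypothesis s_low : forall x, 0 <= x <= l -> a * x <= s x.
Hypothesis s_zeros : forall z, `|z| <= 3 * l -> [\/ a * `|z - 0| <= `|s z|,
  a * `|z - 2 * l| <= `|s z| | a * `|z - - (2 * l)| <= `|s z|].
Hypothesis s_bound : forall z, `|z| <= 3 * l -> `|s z| <= B3.

Let W := weight_cot m0 k0 a0 s_add c_add s_odd c_even cs1 ds dc c_ge0 s_low.

Let mc_continuous : continuous (fun x => m * c x).
Proof. by move=> x; exact: is_derive_continuous (isdZ m (dc x)). Qed.

Let c_le1 x : `|c x| <= 1.
Proof.
have h : c x ^+ 2 <= 1 by rewrite -(cs1 x) lerDl mulr_ge0 ?sqr_ge0.
by rewrite -(ler_pXn2r (ltn0Sn 1)) ?nnegrE// real_normK ?num_real// expr1n.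
Qed.

Let KF : kernel_family l (ker s) (ker' s (fun x => m * c x)).
Proof.
apply: (@kernel_family_ker R s (fun x => m * c x) l a m B3) => //.
- by move=> z; rewrite normrM (gtr0_norm m0) ler_piMr// ltW.
- by move=> z; rewrite c_even.
Qed.

(** On [b/4, b/2] the integrand is at least g(b/4) cot(b/2), as g increases and cot decreases;
    stopping at b/2 matters because on the circle the cotangent vanishes at l. *)
Lemma initial_moment_gt0 (b D : R) g : 0 < b <= l -> 0 <= D -> cts 0 b g ->
  (forall x, - l <= x <= l -> `|g x| <= D * `|x| ^+ 2) ->
  (forall x y, 0 <= x -> x <= y -> y <= b -> g x <= g y) -> 0 < g (b / 4) ->
  0 < c (b / 2) -> 0 < rint 0 b (fun x => g x * cot s c x).
Proof.
move=> /andP[b0 bl] D0 cg gD gm g4 c2.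
have cF : cts 0 b (fun x => g x * cot s c x) by exact: (cts_weighted l0 W bl D0 cg gD).
have s0 : s 0 = 0 by have := s_odd 0; rewrite oppr0; lra.
have sp x : 0 < x -> x <= l -> 0 < s x.
  by move=> x0 xl; apply: lt_le_trans (s_low _); rewrite ?mulr_gt0// (ltW x0).
have cp x : 0 <= x -> x <= l -> 0 <= c x by move=> x0 xl; apply: c_ge0; rewrite x0.
have sm x y : 0 <= x -> x <= y -> y <= l -> s x <= s y.
  move=> x0 xy yl; apply: (nondecreasing_within (s := 0) (T := l) (df := fun x => m * c x)) => //.
    by apply: cts_within => t _; exact: is_derive_continuous (ds t).
  by move=> t /andP[/ltW t1 /ltW t2]; apply: mulr_ge0; [exact: ltW|exact: cp].
have b4 : 0 < b / 4 by rewrite divr_gt0.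
have b2 : 0 < b / 2 by rewrite divr_gt0.
have b42 : b / 4 <= b / 2 by lra.
have b2b : b / 2 <= b by lra.
have b2l : b / 2 <= l := le_trans b2b bl.
have g0 x : 0 <= x -> x <= b -> 0 <= g x.
  move=> x0 xb; have g00 : g 0 = 0.
    apply/eqP; rewrite -normr_le0; have := gD 0; rewrite normr0 expr0n/= mulr0; apply.
    by rewrite oppr_le0 ltW.
  by rewrite -g00; apply: gm.
have F0 x : 0 <= x -> x <= b -> 0 <= g x * cot s c x.
  move=> x0 xb; rewrite mulr_ge0 ?g0// /cot divr_ge0 ?cp//; try exact: le_trans bl.
  by rewrite -s0 sm// (le_trans xb).
have b4b : 0 <= b / 4 <= b by apply/andP; split; lra.
rewrite (rint_split b4b); last exact: cts_integrable.
have cF' : cts (b / 4) b (fun x => g x * cot s c x) by apply: ctsS cF => //; lra.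
rewrite (rint_split (_ : b / 4 <= b / 2 <= b)); last 2 first.
- by rewrite b42.
- exact: cts_integrable.
have P1 : 0 <= rint 0 (b / 4) (fun x => g x * cot s c x).
  by apply: rint_ge0 => x /andP[x0 xb]; apply: F0 => //; lra.
have P3 : 0 <= rint (b / 2) b (fun x => g x * cot s c x).
  by apply: rint_ge0 => x /andP[x0 xb]; apply: F0 => //; lra.
have P2 : g (b / 4) * cot s c (b / 2) * (b / 2 - b / 4) <= rint (b / 4) (b / 2) (fun x => g x * cot s c x).
  rewrite -rint_cst//; apply: le_rint; first exact: cts_cst.
    by apply: ctsS cF' => //; lra.
  move=> x /andP[x1 x2].
  have x0 : 0 < x := lt_le_trans b4 x1; have xl : x <= l := le_trans x2 b2l.
  apply: ler_pM.
  - exact: ltW.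
  - by rewrite /cot divr_ge0 ?ltW// sp.
  - by apply: gm => //; [exact: ltW|exact: le_trans b2b].
  rewrite /cot; apply: ler_pM.
  - exact: ltW.
  - by rewrite invr_ge0 ltW// sp.
  - have h1 := cs1 x; have h2 := cs1 (b / 2).
    have e1 : s x <= s (b / 2) by apply: sm => //; exact: ltW.
    have e2 : 0 <= s x := ltW (sp _ x0 xl).
    have e3 : s x ^+ 2 <= s (b / 2) ^+ 2 by rewrite lerXn2r ?nnegrE// (le_trans e2).
    have e4 := ler_wpM2l k0 e3.
    have e5 : c (b / 2) ^+ 2 <= c x ^+ 2 by lra.
    rewrite -(ler_pXn2r (ltn0Sn 1)) ?nnegrE//; [exact: ltW|].
    by apply: cp => //; exact: ltW.
  - by rewrite lef_pV2 ?posrE ?sp//; apply: sm => //; exact: ltW.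
have P4 : 0 < g (b / 4) * cot s c (b / 2) * (b / 2 - b / 4).
  apply: mulr_gt0; last by lra.
  by apply: mulr_gt0 => //; apply: divr_gt0 => //; exact: sp.
by apply: ltr_wpDl => //; apply: ltr_pwDl => //; exact: lt_le_trans P2.
Qed.

(** Packs a solution as an [hl_sol], with u_x represented by [dx om] against the singular kernel.
    The required lifespan involves b, m and A0 and not [l]. *)
Lemma no_solution (per : bool) (T b A0 : R) (th om : R -> R -> R) :
  0 < b <= l -> Ck_spacetime 2 th -> Ck_spacetime 1 om ->
  (forall x t, 0 < t < T ->
    dt om x t + vel l (sker s) (om ^~ t) x * dx om x t = dx th x t /\
    dt th x t + vel l (sker s) (om ^~ t) x * dx th x t = 0) ->
  (per -> forall z, `|s (z + 2 * l)| = `|s z|) ->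
  (forall t, 0 < t < T ->
    (per -> om l t = om (- l) t /\ dx th l t = dx th (- l) t) /\
    (~~ per -> [/\ om l t = 0, om (- l) t = 0, dx th l t = 0 & dx th (- l) t = 0])) ->
  (forall x, om x 0 = 0) -> (forall x, dx th (- x) 0 = - dx th x 0) ->
  (forall x, 0 <= x <= l -> 0 <= dx th x 0) ->
  (forall x, b <= x <= l -> dx th x 0 = 0) -> th 0 0 = 0 ->
  0 < A0 -> A0 <= rint 0 b (fun x => th x 0 * cot s c x) ->
  4 * Num.sqrt (3 / (pi^-1 * (m / (2 * b)) * A0)) <= T -> False.
Proof.
move=> /andP[b0 bl] Cth Com sys sper bdy omi zeo zeg zes thi A00 A0I TT.
have C1th : C1_spacetime th (dx th) (dt th) := C1_spacetime_of_Ck Cth.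
have C1om : C1_spacetime om (dx om) (dt om) := C1_spacetime_of_Ck Com.
have C1ze : C1_spacetime (dx th) (dx (dx th)) (dt (dx th)).
  have [_ _ _ h _] := Cth.
  exact: (C1_spacetime_of_Ck (k := 0%N) h).
pose u x t := vel l (sker s) (om ^~ t) x.
pose ux x t := vel l (sker s) (dx om ^~ t) x.
have [M M0 HM] := @singular_velocity R s (fun x => m * c x) l a l0 a0 ds mc_continuous s_zeros.
have [F [F0 F1 F2 _]] := C1_bounded (- l) l T C1om.
have [_ _ _ dxom _] := C1om.
have [_ _ _ dxth _] := C1th.
have [_ _ _ dxze _] := C1ze.
have absE (p q lam : R) : `|s p| = `|s q| -> ker s lam p = ker s lam q.
  move=> h; rewrite /ker /reg; congr (_ * ln (_ + _)).
  by rewrite -(real_normK (num_real (s p))) h real_normK ?num_real.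
have V x t : - l <= x <= l -> 0 < t < T ->
  [/\ is_derive x 1 (u ^~ t) (ux x t), {for x, continuous (ux ^~ t)} &
    forall lam, 0 < lam ->
    `|u x t - vel l (ker s lam) (om ^~ t) x| <= F * M * expR (- lam) /\
    `|ux x t - vel l (ker' s (fun x => m * c x) lam) (om ^~ t) x| <= F * M * expR (- lam)].
  move=> xI tI; have /andP[/ltW t0 /ltW tT] := tI.
  have tI' : 0 <= t <= T by rewrite t0.
  apply: (HM (om ^~ t) (dx om ^~ t)) => //.
  - by move=> y _; exact: dxom.
  - by have [_ h _ _ _] := C1om; exact: continuous_cts (C0_slicex h t0).
  - by move=> y yI; exact: F1.
  - by move=> y yI; exact: F2.
  move=> lam z; have [b1 b2] := bdy t tI.
  have [pe|pe] : per \/ ~~ per by case: (per); [left|right].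
    have [-> _] := b1 pe; congr (_ * _); apply: absE.
    by rewrite -(sper pe (z - l)); congr (`|s _|); ring.
  by have [-> -> _ _] := b2 pe; rewrite !mul0r.
(* The equation for theta is differentiated in x; it is assumed for all real x, so this is
   legitimate also at the ends of the window. *)
have eqze x t : - l <= x <= l -> 0 < t < T ->
    dt (dx th) x t + u x t * dx (dx th) x t + ux x t * dx th x t = 0.
  move=> xI tI; have /andP[t0 _] := tI.
  have [du _ _] := V x t xI tI.
  have d1 := mixed_partial C1th C1ze x t0.
  have d2 := isdD d1 (isdM du (dxze x t (ltW t0))).
  have E : (fun y => dt th y t + u y t * dx th y t) = (fun=> 0).
    by apply/funext => y; have [_ h] := sys y t tI.
  rewrite E in d2.
  have := @derive_val _ _ _ _ _ _ _ d2; rewrite derive_cst => h.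
  by rewrite [RHS]h; ring.
have ap : exists2 C, 0 <= C & forall lam x t, 0 < lam -> - l <= x <= l -> 0 < t < T ->
    `|u x t - vel l (ker s lam) (om ^~ t) x| <= C * expR (- lam) /\
    `|ux x t - vel l (ker' s (fun x => m * c x) lam) (om ^~ t) x| <= C * expR (- lam).
  exists (F * M); first exact: mulr_ge0.
  by move=> lam x t lam0 xI tI; have [_ _ h] := V x t xI tI; exact: h.
have bd t : 0 < t < T ->
  (per -> [/\ u l t = u (- l) t, om l t = om (- l) t & dx th l t = dx th (- l) t]) /\
  (~~ per -> [/\ om l t = 0, om (- l) t = 0, dx th l t = 0 & dx th (- l) t = 0]).
  move=> tI; have [b1 b2] := bdy t tI; split => // pe.
  have [h1 h2] := b1 pe; split => //.
  rewrite /u /vel; congr (_ * _); apply: eq_rint => y _; congr (_ * _).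
  by rewrite /sker -(sper pe (- l - y)); congr (ln `|s _|); ring.
pose S : hl_sol per l T (ker s) (ker' s (fun x => m * c x)) :=
  HLSol C1th C1ze C1om (fun x t _ tI => proj1 (sys x t tI))
    (fun x t _ tI => proj2 (sys x t tI)) eqze
    (fun x t xI tI => let: And3 h _ _ := V x t xI tI in h)
    (fun t tI x xI => let: And3 _ h _ := V x t xI tI in h) ap bd.
exact: (@hl_blowup R per l m T b A0 _ _ _ _ l0 m0 A00 b0 bl KF W S
  (fun x _ => omi x) (fun x _ => zeo x) zeg zes thi A0I TT).
Qed.

End trigonometric_blowup.

(** * Smooth functions of one variable and a lower bound for the sine *)

Section initial_data.
Context {R : realType}.
Implicit Types (f g df dg : R -> R) (x y t : R).

(** Derivatives are carried as witnesses, so that sums, products and compositions go through by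
    induction without computing iterated derivatives. *)
Fixpoint Ck1 (n : nat) f : Prop := if n is n'.+1 then
  exists2 df, (forall x, is_derive x 1 f (df x)) & Ck1 n' df else True.

Lemma derive1_isd f df : (forall x, is_derive x 1 f (df x)) -> derive1 f = df.
Proof.
move=> H; apply/funext => x.
by rewrite derive1E (@derive_val _ _ _ _ _ _ _ (H x)).
Qed.

Lemma Ck1_smooth f : (forall n, Ck1 n f) -> smooth1 f.
Proof.
move=> H n; have {}H := H n.+1.
elim: n f H => [|n IH] f [df d C] x; first exact: (@ex_derive _ _ _ _ _ _ _ (d x)).
rewrite /derive1n iterSr (derive1_isd d); exact: IH.
Qed.

Lemma Ck1W n f : Ck1 n.+1 f -> Ck1 n f.
Proof.
by elim: n f => // n IH f [df d C]; exists df => //; exact: IH.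
Qed.

Lemma Ck1_cst n (c : R) : Ck1 n (fun=> c).
Proof.
by elim: n c => // n IH c; exists (fun=> 0) => // x; exact: isd_cst.
Qed.

Lemma Ck1_id n : Ck1 n (fun x => x).
Proof.
by case: n => // n; exists (fun=> 1); [move=> x; exact: isd_id|exact: Ck1_cst].
Qed.

Lemma Ck1D n f g : Ck1 n f -> Ck1 n g -> Ck1 n (fun x => f x + g x).
Proof.
elim: n f g => // n IH f g [df d C] [dg e D]; exists (fun x => df x + dg x).
  by move=> x; exact: isdD.
exact: IH.
Qed.

Lemma Ck1M n f g : Ck1 n f -> Ck1 n g -> Ck1 n (fun x => f x * g x).
Proof.
elim: n f g => // n IH f g Cf Cg; have [df d C] := Cf; have [dg e D] := Cg.
exists (fun x => df x * g x + f x * dg x); first by move=> x; exact: isdM.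
by apply: Ck1D; apply: IH => //; exact: Ck1W.
Qed.

Lemma Ck1_comp n f g : Ck1 n f -> Ck1 n g -> Ck1 n (fun x => g (f x)).
Proof.
elim: n f g => // n IH f g Cf Cg; have [df d C] := Cf; have [dg e D] := Cg.
exists (fun x => dg (f x) * df x); first by move=> x; exact: isd_comp.
by apply: Ck1M => //; apply: IH => //; exact: Ck1W.
Qed.

Lemma Ck1_sin_cos n : Ck1 n (@sin R) /\ Ck1 n (@cos R).
Proof.
elim: n => // n [Cs Cc]; split.
  by exists (@cos R) => // x; exact: is_derive_sin.
exists (fun x => -1 * sin x); last by apply: Ck1M => //; exact: Ck1_cst.
by move=> x; rewrite mulN1r; exact: is_derive_cos.
Qed.

(* The derivatives of exp(-1/t) on t > 0 are spanned by these functions. *)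
Definition flat (j : nat) t : R := if 0 < t then t^-1 ^+ j * expR (- t^-1) else 0.

Lemma flat_ge0 j t : 0 <= flat j t.
Proof.
rewrite /flat; case: ifP => // t0.
by rewrite mulr_ge0 ?expR_ge0// exprn_ge0// invr_ge0 ltW.
Qed.

(** With r = 1 / t, exp r >= (r / n)^n for n = j + 2: j powers of r cancel the prefactor and the
    other two give t^2, hence differentiability at 0. *)
Lemma flat_bound j : exists2 C, 0 <= C & forall t, flat j t <= C * t ^+ 2.
Proof.
pose n := j.+2; exists (n%:R ^+ n); first by rewrite exprn_ge0.
move=> t; rewrite /flat; case: ifP => [t0|_]; last by rewrite mulr_ge0 ?sqr_ge0// exprn_ge0.
set r := t^-1; have r0 : 0 < r by rewrite invr_gt0.
have n0 : 0 < n%:R :> R by rewrite ltr0n.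
have -> : t = r^-1 by rewrite invrK.
have h : (r / n%:R) ^+ n <= expR r.
  have -> : r = n%:R * (r / n%:R) by rewrite mulrCA divff ?mulr1 ?gt_eqF.
  rewrite expRM_natl [X in (X / _) ^+ _ <= _]mulrCA divff ?mulr1 ?gt_eqF//.
  rewrite lerXn2r ?nnegrE ?expR_ge0 ?divr_ge0 ?ltW//.
  by apply: lt_le_trans (expR_ge1Dx _); rewrite ltrDr.
rewrite expRN ler_pdivrMr ?expR_gt0//.
apply: (@le_trans _ _ (n%:R ^+ n * r^-1 ^+ 2 * (r / n%:R) ^+ n)); last first.
  by apply: ler_wpM2l => //; rewrite mulr_ge0 ?sqr_ge0 ?exprn_ge0.
rewrite le_eqVlt; apply/orP; left; apply/eqP.
rewrite expr_div_n -[X in r ^+ X / _](addn2 j) exprD exprVn.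
have N0 : n%:R ^+ n != 0 :> R by rewrite expf_neq0// gt_eqF.
by move: N0; set N := n%:R ^+ n => N0; field; rewrite N0 gt_eqF.
Qed.

Lemma flat_derive j t : is_derive t 1 (flat j) (flat j.+2 t - j%:R * flat j.+1 t).
Proof.
have [t0|t0|t0] := ltgtP 0 t.
- have G i : is_derive t 1 (fun y => y^-1 ^+ i * expR (- y^-1))
      (t^-1 ^+ i.+2 * expR (- t^-1) - i%:R * (t^-1 ^+ i.+1 * expR (- t^-1))).
    have d1 := @isdV _ (fun y => y) t _ (lt0r_neq0 t0) (isd_id t).
    elim: i => [|i IH].
      apply: (isd_eq (isdM (isd_cst t 1) (isd_comp (isdN d1) (is_derive_expR _)))).
      by rewrite !mul0r add0r subr0 mul1r -exprVn mulN1r opprK mulrC.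
    have E : (fun y => y^-1 ^+ i.+1 * expR (- y^-1)) = (fun y => y^-1 * (y^-1 ^+ i * expR (- y^-1))).
      by apply/funext => y; rewrite exprS mulrA.
    rewrite E; apply: (isd_eq (isdM d1 IH)).
    by rewrite -exprVn mulN1r -natr1 !exprS; ring.
  have N : \forall y \near t, y^-1 ^+ j * expR (- y^-1) = flat j y.
    near=> y; rewrite /flat ifT//; near: y.
    exact: (@cvgr_gt _ _ _ _ id t cvg_id).
  by rewrite /flat t0; exact: near_eq_is_derive N (G j).
- have N : \forall y \near t, 0 = flat j y.
    near=> y; rewrite /flat ifF//; apply/negbTE; rewrite -leNgt ltW//; near: y.
    exact: (@cvgr_lt _ _ _ _ id t cvg_id).
  rewrite /flat ltNge (ltW t0)/= mulr0 subr0.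
  exact: near_eq_is_derive N (isd_cst t 0).
rewrite -t0 /flat ltxx mulr0 subr0.
have [C C0 HC] := flat_bound j.
apply: (@is_derive_quadratic _ _ _ C 1) => //; first by rewrite ltxx.
move=> y _; rewrite subr0 ger0_norm; [exact: HC|exact: flat_ge0].
Unshelve. all: end_near. Qed.

Lemma Ck1_flat n j : Ck1 n (flat j).
Proof.
elim: n j => // n IH j; exists (fun t => flat j.+2 t - j%:R * flat j.+1 t).
  by move=> x; exact: flat_derive.
apply: Ck1D => //; have := Ck1M (Ck1_cst n (- j%:R)) (IH j.+1).
by congr Ck1; apply/funext => x; rewrite mulNr.
Qed.

(** With v = x / 2 <= pi / 4, both sin v >= v cos(pi / 4) and cos v >= cos(pi / 4), so sin x = 2 sin
    v cos v >= 2 cos(pi / 4)^2 v = v. *)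
Lemma sin_ge_half x : 0 <= x <= pi / 2 -> x / 2 <= sin x.
Proof.
move=> /andP[x0 xp].
have p0 := pi_gt0 R.
set v := x / 2; have v0 : 0 <= v by rewrite divr_ge0.
have vp : v <= pi / 4 by rewrite /v; lra.
have q0 : 0 < cos (pi / 4 : R) by apply: cos_gt0_pihalf; apply/andP; split; lra.
have q2 : 2 * cos (pi / 4 : R) ^+ 2 = 1.
  have h : pi / 2 = pi / 4 + pi / 4 :> R by lra.
  have := cos_pihalf R; rewrite h cosD -!expr2; have := cos2Dsin2 (pi / 4 : R); lra.
have cm w : 0 <= w <= pi / 4 -> cos (pi / 4) <= cos w.
  move=> /andP[w0 w1]; rewrite leNgt ltr_cos; first by rewrite -leNgt.
    by rewrite in_itv/=; apply/andP; split; lra.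
  by rewrite in_itv/=; apply/andP; split; lra.
have sv : cos (pi / 4) * (v - 0) <= sin v - sin 0.
  apply: (MVT_lower v0 _ (fun t _ => is_derive_sin t)).
    by apply: cts_within => t _; exact: is_derive_continuous (is_derive_sin t).
  by move=> t /andP[/ltW t0 /ltW tv]; apply: cm; rewrite t0 (le_trans tv).
rewrite sin0 !subr0 in sv.
have cv : cos (pi / 4) <= cos v by apply: cm; rewrite v0.
have xE : x = v + v by rewrite /v; lra.
rewrite xE sinD.
have h1 : cos (pi / 4) * v * cos (pi / 4) <= sin v * cos v.
  by apply: ler_pM => //; [rewrite mulr_ge0// ltW|exact: ltW].
have h2 : cos (pi / 4) * v * cos (pi / 4) = cos (pi / 4) ^+ 2 * v by rewrite expr2; ring.
rewrite h2 in h1.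
have h3 : 2 * cos (pi / 4 : R) ^+ 2 * v = v by rewrite q2 mul1r.
by rewrite (mulrC (cos v)); move: h1 h3; lra.
Qed.

End initial_data.

(** * Translation in x of space-time regularity *)

Section translation.
Context {R : realType}.
Implicit Types (f : R -> R -> R) (g : R -> R).

Lemma derive1_translate (c : R) g x : derive1 (fun y => g (c + y)) x = derive1 g (c + x).
Proof.
rewrite /derive1; congr (lim _).
have -> // : (fun h : R => h^-1 *: (g (c + (h + x)) - g (c + x))) =
  (fun h : R => h^-1 *: (g (h + (c + x)) - g (c + x))).
by apply/funext => h; rewrite addrCA.
Qed.

Lemma Ck_translate k (c : R) f : Ck_spacetime k f ->
  Ck_spacetime k (fun x t => f (c + x) t).
Proof.
have dc (x : R) : is_derive x 1 (fun y => c + y) 1.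
  by apply: (isd_eq (isdD (isd_cst _ _) (isd_id _))); rewrite add0r.
have cc : continuous (fun y : R => c + y).
  by move=> x; exact: is_derive_continuous (dc x).
elim: k f => [|k IH] f /=; first exact: C0_compl.
move=> [f0 fx ft Cx Ct]; split; first exact: C0_compl.
- move=> x t t0; have D : is_derive (c + x) 1 (f ^~ t) (derive1 (f ^~ t) (c + x)).
    by apply: DeriveDef; [exact: fx|rewrite derive1E].
  exact: (@ex_derive _ _ _ _ _ _ _ (isd_comp (dc x) D)).
- by move=> x t t0; exact: ft.
- have -> : dx (fun x t => f (c + x) t) = (fun x t => dx f (c + x) t).
    by apply/funext => x; apply/funext => t; rewrite /dx (derive1_translate c (f ^~ t)).
  exact: IH.
- exact: (IH (dt f)).
Qed.

End translation.

(** * The periodic case *)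

Section periodic_case.
Context {R : realType}.
Implicit Types x y z t v : R.
Variable L : R.
Hypothesis L0 : 0 < L.
Let l := L / 2.
Let m := pi / L.
Let s z := sin (m * z).
Let c z := cos (m * z).

Let l0 : 0 < l. Proof. by rewrite divr_gt0. Qed.
Let m0 : 0 < m. Proof. by rewrite divr_gt0// pi_gt0. Qed.
Let ml : m * l = pi / 2. Proof. by rewrite /m /l; field; rewrite gt_eqF. Qed.
Let lL : l + l = L. Proof. by rewrite /l; lra. Qed.

Let s_add x y : s (x + y) = s x * c y + c x * s y.
Proof. by rewrite /s /c mulrDr sinD. Qed.
Let c_add x y : c (x + y) = c x * c y - 1 * (s x * s y).
Proof. by rewrite /s /c mulrDr cosD mul1r. Qed.
Let s_odd x : s (- x) = - s x. Proof. by rewrite /s mulrN sinN. Qed.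
Let c_even x : c (- x) = c x. Proof. by rewrite /c mulrN cosN. Qed.
Let cs1 x : c x ^+ 2 + 1 * s x ^+ 2 = 1. Proof. by rewrite mul1r cos2Dsin2. Qed.

Let dm x : is_derive x 1 (fun z => m * z) m.
Proof. by apply: (isd_eq (isdZ m (isd_id x))); rewrite mulr1. Qed.
Let ds x : is_derive x 1 s (m * c x).
Proof. by apply: (isd_eq (isd_comp (dm x) (is_derive_sin _))); rewrite mulrC. Qed.
Let dc x : is_derive x 1 c (- (1 * m * s x)).
Proof. by apply: (isd_eq (isd_comp (dm x) (is_derive_cos _))); rewrite mul1r mulNr mulrC. Qed.

Let c_ge0 x : 0 <= x <= l -> 0 <= c x.
Proof.
move=> /andP[x0 xl]; have h := pi_gt0 R; apply: cos_ge0_pihalf.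
have h1 : 0 <= m * x by rewrite mulr_ge0// ltW.
have h2 : m * x <= pi / 2 by rewrite -ml ler_wpM2l// ltW.
by rewrite h2 andbT; lra.
Qed.

Let s_low x : 0 <= x <= l -> m / 2 * x <= s x.
Proof.
move=> /andP[x0 xl].
have -> : m / 2 * x = m * x / 2 by rewrite mulrAC.
apply: sin_ge_half; rewrite mulr_ge0//=; last exact: ltW.
by rewrite -ml ler_wpM2l// ltW.
Qed.

Let s_per z : s (z + 2 * l) = - s z.
Proof.
have -> : 2 * l = L by rewrite -lL; ring.
have -> : s (z + L) = sin (m * z + pi) by rewrite /s mulrDr; congr (sin (_ + _)); rewrite /m divfK// gt_eqF.
by rewrite sinDpi.
Qed.

Let s_abs v : `|v| <= l -> m / 2 * `|v| <= `|s v|.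
Proof.
move=> vl; have [v0|/ltW v0] := leP 0 v.
  by rewrite (ger0_norm v0) in vl *; apply: le_trans (ler_norm _); apply: s_low; rewrite v0.
rewrite (ler0_norm v0) in vl *; rewrite -normrN -s_odd; apply: le_trans (ler_norm _).
by apply: s_low; rewrite oppr_ge0 v0.
Qed.

Let s_zeros z : `|z| <= 3 * l -> [\/ m / 2 * `|z - 0| <= `|s z|,
  m / 2 * `|z - 2 * l| <= `|s z| | m / 2 * `|z - - (2 * l)| <= `|s z|].
Proof.
rewrite ler_norml => /andP[z1 z2].
have [zl|zl] := leP z l; last first.
  apply: Or32; have -> : `|s z| = `|s (z - 2 * l)|.
    by rewrite -[RHS]normrN -s_per; congr (`|s _|); ring.
  by apply: s_abs; rewrite ler_norml; apply/andP; split; lra.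
have [zl'|zl'] := leP (- l) z.
  by apply: Or31; rewrite subr0; apply: s_abs; rewrite ler_norml zl'.
apply: Or33; have -> : `|s z| = `|s (z - - (2 * l))|.
  by rewrite opprK s_per normrN.
by apply: s_abs; rewrite ler_norml; apply/andP; split; lra.
Qed.

Let s_bound z : `|z| <= 3 * l -> `|s z| <= 1.
Proof.
move=> _; have h : s z ^+ 2 <= 1 by rewrite -(cs1 z) mul1r lerDr sqr_ge0.
by rewrite -(ler_pXn2r (ltn0Sn 1)) ?nnegrE// real_normK ?num_real// expr1n.
Qed.

(** g is 1 - cos(2 pi x / L), with minimum 0 at 0. The data put this minimum at l because
    translation by l carries the integration window [-l, l] onto [0, L], the window of
    [velocity_periodic]. *)
Let g x : R := 2 * (s x * s x).
Let theta0 x := g (x - l).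

Let dg x : is_derive x 1 g (4 * (s x * (m * c x))).
Proof. by apply: (isd_eq (isdZ 2 (isdM (ds x) (ds x)))); ring. Qed.

Let Ck1_theta0 n : Ck1 n theta0.
Proof.
have Cl : Ck1 n (fun x => m * (x + - l)).
  by apply: Ck1M; [exact: Ck1_cst|apply: Ck1D; [exact: Ck1_id|exact: Ck1_cst]].
have Cs : Ck1 n (fun x => s (x - l)) := Ck1_comp Cl (Ck1_sin_cos n).1.
by apply: Ck1M; [exact: Ck1_cst|exact: Ck1M].
Qed.

Let velocityE (omega : R -> R -> R) t x : continuous (omega ^~ t) ->
  velocity_periodic L omega (l + x) t =
  vel l (sker s) (fun y => omega (l + y) t) x.
Proof.
move=> co; rewrite /velocity_periodic /vel; congr (_ * _).
pose f y := omega y t * ln `|s (l + x - y)|.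
have mf : measurable_fun setT (f : measurableTypeR R -> R).
  apply: measurable_funM; first exact: continuous_measurable_fun.
  apply: measurableT_comp; first exact: measurable_ln.
  apply: measurableT_comp; first exact: normr_measurable.
  apply: continuous_measurable_fun => y.
  exact: is_derive_continuous (isd_comp (isdB (isd_cst y (l + x)) (isd_id y)) (ds _)).
have := Rintegral_shift l (- l) l mf; rewrite subrr lL /f => ->.
rewrite /rint; apply: eq_Rintegral => y _; congr (_ * _).
by rewrite /sker; congr (ln `|s _|); ring.
Qed.

Lemma periodic_blowup : exists theta0 omega0 : R -> R,
  [/\ smooth1 theta0 /\ smooth1 omega0, periodic theta0 L /\ periodic omega0 L &
   ~ exists theta omega : R -> R -> R,
     global_solution_periodic L theta0 omega0 theta omega].
Proof.
exists theta0, (fun=> 0); split.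
- split; first exact: Ck1_smooth Ck1_theta0.
  by apply: Ck1_smooth => n; exact: Ck1_cst.
- split=> // x; rewrite /theta0 /g.
  have -> : x + L - l = x - l + 2 * l by rewrite -lL; ring.
  by rewrite s_per mulrNN.
move=> [theta [omega [[sth som] per sys ini]]].
have g0 : g 0 = 0 by rewrite /g /s mulr0 sin0; ring.
have sp x : 0 < x -> x <= l -> 0 < s x.
  move=> x0 xl; apply: lt_le_trans (s_low _); last by rewrite (ltW x0).
  by rewrite mulr_gt0// divr_gt0.
have sp0 x : 0 <= x -> x <= l -> 0 <= s x.
  move=> x0 xl; apply: le_trans (s_low _); last by rewrite x0.
  by rewrite mulr_ge0// divr_ge0// ltW.
have sm x : `|s x| <= m * `|x|.
  have cs : {within `[- `|x|, `|x|], continuous s}.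
    by apply: cts_within => t _; exact: is_derive_continuous (ds t).
  have := @MVT_bound R _ _ s (fun x => m * c x) m cs (fun t _ => ds t) _ x 0.
  have -> : s 0 = 0 by rewrite /s mulr0 sin0.
  rewrite !subr0; apply; last by rewrite oppr_le0 normr_ge0.
    move=> t _; rewrite normrM (gtr0_norm m0) ler_piMr ?(ltW m0)//.
    have h : c t ^+ 2 <= 1 by rewrite -(cs1 t) lerDl mul1r sqr_ge0.
    by rewrite -(ler_pXn2r (ltn0Sn 1)) ?nnegrE// real_normK ?num_real// expr1n.
  by rewrite -ler_norml.
have gm x y : 0 <= x -> x <= y -> y <= l -> g x <= g y.
  apply: (nondecreasing_within (s := 0) (T := l) (df := fun x => 4 * (s x * (m * c x)))) => //.
    by apply: cts_within => t _; exact: is_derive_continuous (dg t).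
  move=> t /andP[/ltW t0 /ltW tl]; rewrite mulr_ge0// mulr_ge0 ?sp0// mulr_ge0 ?c_ge0 ?t0//.
  exact: ltW.
pose A0 := rint 0 l (fun x => g x * cot s c x).
have A00 : 0 < A0.
  apply: (@initial_moment_gt0 R s c m 1 l (m / 2) l0 m0 ler01 (divr_gt0 m0 (ltr0n _ 2))
    s_add c_add s_odd c_even cs1 ds dc c_ge0 s_low l (2 * m ^+ 2) g) => //.
  - by rewrite l0 lexx.
  - by rewrite mulr_ge0// sqr_ge0.
  - by move=> x _; exact: is_derive_continuous (dg x).
  - move=> x _; rewrite /g normrM normrM ger0_norm// -mulrA; apply: ler_wpM2l => //.
    by rewrite -exprMn -expr2 lerXn2r ?nnegrE// mulr_ge0// ltW.
  - by rewrite /g mulr_gt0// mulr_gt0// sp// ?divr_gt0//; have := l0; lra.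
  rewrite /c; apply: cos_gt0_pihalf; have -> : m * (l / 2) = pi / 4 by rewrite mulrA ml; lra.
  by have := pi_gt0 R; move=> ?; apply/andP; split; lra.
pose th x t := theta (l + x) t; pose om x t := omega (l + x) t.
have dxE x t : dx th x t = dx theta (l + x) t by exact: (derive1_translate l (theta ^~ t)).
have dxoE x t : dx om x t = dx omega (l + x) t by exact: (derive1_translate l (omega ^~ t)).
have thx x : th x 0 = g x by rewrite /th (ini _).1 /theta0; congr g; ring.
have thg : th ^~ 0 = g by apply/funext; exact: thx.
have zeE x : dx th x 0 = 4 * (s x * (m * c x)).
  by rewrite /dx thg (derive1_isd dg).
(* Here m0 = l: theta increases over the whole half period. A global solution exists up to this T,
   which is all the contradiction needs. *)
pose T := 4 * Num.sqrt (3 / (pi^-1 * (m / (2 * l)) * A0)).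
apply: (@no_solution R s c m 1 l (m / 2) 1 l0 m0 ler01 (divr_gt0 m0 (ltr0n _ 2))
    s_add c_add s_odd c_even cs1 ds dc c_ge0 s_low s_zeros s_bound true T l A0 th om) => //.
- by rewrite l0 lexx.
- exact: Ck_translate (sth 2%N).
- exact: Ck_translate (som 1%N).
- move=> x t /andP[/ltW t0 _]; have [e1 e2] := sys (l + x) t t0.
  have co : continuous (omega ^~ t).
    by have [h _ _ _ _] := som 1%N; exact: C0_slicex.
  by rewrite dxE dxoE -velocityE.
- by move=> _ z; rewrite s_per normrN.
- move=> t /andP[/ltW t0 _]; split=> // _.
  (* The ends l and -l of the window become the points l + l and l - l, one period apart. *)
  have [p1 p2] := per t t0; have e : l + l = L + (l - l) by rewrite lL subrr addr0.
  split; first by rewrite /om e addrC; exact: p2.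
  rewrite !dxE e /dx -(derive1_translate L (theta ^~ t)).
  have -> // : (fun y => theta (L + y) t) = theta ^~ t.
  by apply/funext => y; rewrite addrC; exact: p1.
- by move=> x; exact: (ini _).2.
- by move=> x; rewrite !zeE s_odd c_even; ring.
- move=> x xI; rewrite zeE; have /andP[x0 xl] := xI.
  by rewrite mulr_ge0// mulr_ge0 ?sp0// mulr_ge0 ?c_ge0// ltW.
(* As m0 = l, the support condition concerns the single point l, where the cosine factor of theta_x
   vanishes. *)
- move=> x xI; have -> : x = l by apply/eqP; rewrite eq_le andbC.
  by rewrite zeE /c ml cos_pihalf !mulr0.
- by rewrite thx.
- by rewrite (@eq_rint R 0 l _ (fun x => g x * cot s c x)) // => x _; rewrite thx.
Qed.

End periodic_case.

(** * The line *)

Section line_case.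
Context {R : realType}.
Implicit Types x y z t : R.
Let s z : R := z.
Let c z : R := 1.

Let s_add x y : s (x + y) = s x * c y + c x * s y.
Proof. by rewrite /s /c mulr1 mul1r. Qed.
Let c_add x y : c (x + y) = c x * c y - 0 * (s x * s y).
Proof. by rewrite /c mul0r subr0 mulr1. Qed.
Let s_odd x : s (- x) = - s x. Proof. by []. Qed.
Let c_even x : c (- x) = c x. Proof. by []. Qed.
Let cs1 x : c x ^+ 2 + 0 * s x ^+ 2 = 1. Proof. by rewrite mul0r addr0 expr1n. Qed.
Let ds x : is_derive x 1 s (1 * c x).
Proof. by apply: (isd_eq (isd_id x)); rewrite mul1r. Qed.
Let dc x : is_derive x 1 c (- (0 * 1 * s x)).
Proof. by apply: (isd_eq (isd_cst x 1)); rewrite !mul0r oppr0. Qed.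
Let c_ge0 (l : R) x : 0 <= x <= l -> 0 <= c x. Proof. by rewrite /c. Qed.
Let s_low (l : R) x : 0 <= x <= l -> 1 * x <= s x. Proof. by rewrite mul1r. Qed.
Let s_zeros (l : R) z : `|z| <= 3 * l -> [\/ 1 * `|z - 0| <= `|s z|,
  1 * `|z - 2 * l| <= `|s z| | 1 * `|z - - (2 * l)| <= `|s z|].
Proof. by move=> _; apply: Or31; rewrite mul1r subr0. Qed.
Let s_bound (l : R) z : `|z| <= 3 * l -> `|s z| <= 3 * l. Proof. by []. Qed.

(** Equal to 1/e - exp(-1 / (1 - x^2)) on ]-1, 1[ and to the constant 1/e outside: a smooth well
    with minimum 0 at the origin and slope supported in [-1, 1]. *)
Let theta0 x : R := flat 0 1 - flat 0 (1 - x * x).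

Let dtheta0 x : is_derive x 1 theta0 (2 * x * flat 2 (1 - x * x)).
Proof.
have d1 := isdB (isd_cst x 1) (isdM (isd_id x) (isd_id x)).
apply: (isd_eq (isdB (isd_cst x (flat 0 1)) (isd_comp d1 (flat_derive 0 (1 - x * x))))).
by rewrite mul0r subr0; ring.
Qed.

Let Ck1_theta0 n : Ck1 n theta0.
Proof.
have C1 : Ck1 n (fun x : R => 1 + -1 * (x * x)).
  by apply: Ck1D; [|apply: Ck1M; [|apply: Ck1M]]; (try exact: Ck1_cst); exact: Ck1_id.
have C2 := Ck1M (Ck1_cst n (-1)) (Ck1_comp C1 (Ck1_flat n 0)).
have := Ck1D (Ck1_cst n (flat 0 1)) C2; congr Ck1.
by apply/funext => x; rewrite /theta0 !mulN1r.
Qed.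

Let flat0 j t : t <= 0 -> flat j t = 0.
Proof. by move=> t0; rewrite /flat ltNge t0. Qed.

Let theta0_quadratic : exists2 D, 0 <= D &
  forall x, - 1 <= x <= 1 -> `|theta0 x| <= D * `|x| ^+ 2.
Proof.
have [C C0 HC] := @flat_bound R 2; exists (2 * C); first by rewrite mulr_ge0.
move=> x; rewrite -ler_norml => x1.
have ct : {within `[- `|x|, `|x|], continuous theta0}.
  by apply: cts_within => t _; exact: is_derive_continuous (dtheta0 t).
have := @MVT_bound R _ _ theta0 _ (2 * C * `|x|) ct (fun t _ => dtheta0 t) _ x 0.
have -> : theta0 0 = 0 by rewrite /theta0 mulr0 subr0 subrr.
have -> : 2 * C * `|x| ^+ 2 = 2 * C * `|x| * `|x| by ring.
rewrite !subr0; apply.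
- move=> t /andP[t1 t2]; have tx : `|t| <= `|x| by rewrite ler_norml !ltW.
  rewrite !normrM (ger0_norm (ler0n _ 2)) (ger0_norm (flat_ge0 _ _)) -!mulrA.
  apply: ler_wpM2l => //; rewrite mulrC; apply: ler_pM => //; first exact: flat_ge0.
  apply: le_trans (HC _) _; rewrite -[leRHS]mulr1; apply: ler_wpM2l => //.
  have tt : 0 <= t * t <= 1.
    by rewrite -expr2 sqr_ge0 -(real_normK (num_real t)) exprn_ile1// (le_trans tx).
  by move: tt => /andP[? ?]; apply: exprn_ile1; lra.
- by rewrite -ler_norml.
by rewrite oppr_le0 normr_ge0.
Qed.

Let theta0_mono x y : 0 <= x -> x <= y -> y <= 1 -> theta0 x <= theta0 y.
Proof.
apply: (nondecreasing_within (s := 0) (T := 1) (df := fun x => 2 * x * flat 2 (1 - x * x))) => //.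
  by apply: cts_within => t _; exact: is_derive_continuous (dtheta0 t).
by move=> t /andP[/ltW t0 _]; rewrite mulr_ge0 ?flat_ge0// mulr_ge0.
Qed.

(** With m0 = 1 and weight 1/x this moment is fixed before any truncation length is chosen. *)
Let A0 := rint 0 1 (fun x => theta0 x * cot s c x).

Let A00 : 0 < A0.
Proof.
have [D D0 HD] := theta0_quadratic.
apply: (@initial_moment_gt0 R s c 1 0 1 1 ltr01 ltr01 (lexx 0) ltr01
    s_add c_add s_odd c_even cs1 ds dc (@c_ge0 1) (@s_low 1) 1 D theta0) => //.
- by rewrite ltr01 lexx.
- by move=> x _; exact: is_derive_continuous (dtheta0 x).
- rewrite subr_gt0 /flat; rewrite !ifT ?ltr01//; last by lra.
  rewrite !expr0 !mul1r ltr_expR ltrN2 ltf_pV2 ?posrE//; lra.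
Qed.

Let velocityE (l : R) (omega : R -> R -> R) t x :
  (forall y, ~ (- l <= y <= l) -> omega y t = 0) ->
  velocity_line omega x t = vel l (sker s) (omega ^~ t) x.
Proof.
move=> o0; rewrite /velocity_line /vel; congr (_ * _).
rewrite /rint [RHS]Rintegral_mkcond; congr Rintegral; apply/funext => y.
rewrite patchE; case: ifPn => // /negP yI.
rewrite o0 ?mul0r// => h; apply: yI; rewrite inE/= in_itv/=; exact: h.
Qed.

Lemma line_blowup : exists theta0 omega0 : R -> R,
  [/\ smooth1 theta0 /\ smooth1 omega0,
   compact (supp (derive1 theta0)) /\ compact (supp omega0) &
   ~ exists theta omega : R -> R -> R, global_solution_line theta0 omega0 theta omega].
Proof.
exists theta0, (fun=> 0); split.
- split; first exact: Ck1_smooth Ck1_theta0.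
  by apply: Ck1_smooth => n; exact: Ck1_cst.
- split.
    apply: (@subclosed_compact _ _ `[(-1 : R), 1]%classic);
      [exact: closed_closure|exact: segment_compact|].
    have h : [set x | derive1 theta0 x != 0] `<=` `[(-1 : R), 1]%classic.
      move=> x /=; rewrite (derive1_isd dtheta0) in_itv/=; apply: contraR => xI.
      rewrite flat0 ?mulr0// subr_le0.
      have x1 : 1 < `|x| by rewrite ltNge ler_norml.
      by rewrite -expr2 -(real_normK (num_real x)) exprn_ege1// ltW.
    have := closure_subset h; by rewrite -(closure_id `[(-1 : R), 1]%classic).1//; exact: itv_closed.
  rewrite /supp; have -> : [set x : R | (0 : R) != 0] = set0.
    by apply/seteqP; split => x //=; rewrite eqxx.
  by rewrite closure0; exact: compact0.
move=> [theta [omega [[sth som] cpt sys ini]]].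
(* The order of choices is essential: T depends on A0 alone, the compact set on T, and l on the
   compact set. *)
pose T := 4 * Num.sqrt (3 / (pi^-1 * (1 / (2 * 1)) * A0)).
have T0 : 0 < T.
  rewrite mulr_gt0// sqrtr_gt0 divr_gt0// mulr_gt0// mulr_gt0 ?divr_gt0//.
  by rewrite invr_gt0 pi_gt0.
have [K cK HK] := cpt T T0.
have [M [_ MK]] := compact_bounded cK.
(* Points of K satisfy |x| <= M + 1, so the extra 1 puts the supports strictly inside ]-l, l[; the
   maximum with 1 ensures m0 = 1 <= l. *)
pose l := Num.max (M + 1) 1 + 1.
have Ml : Num.max (M + 1) 1 < l by rewrite /l ltrDl.
have M1 : M < Num.max (M + 1) 1 by rewrite lt_max ltrDl ltr01.
have l1 : 1 <= l by apply: ltW; apply: le_lt_trans Ml; rewrite le_max lexx orbT.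
have l0 : 0 < l by exact: lt_le_trans l1.
have Kl x : K x -> `|x| < l.
  by move=> Kx; apply: le_lt_trans Ml; exact: MK.
have out (f : R -> R) y : supp f `<=` K -> l <= `|y| -> f y = 0.
  move=> fK ly; apply: contrapT => /eqP fy.
  have := Kl y (fK y (@subset_closure _ [set x | f x != 0] y fy)).
  by rewrite ltNge ly.
have zeE x : dx theta x 0 = 2 * x * flat 2 (1 - x * x).
  rewrite /dx; have -> : theta ^~ 0 = theta0 by apply/funext => y; exact: (ini y).1.
  by rewrite (derive1_isd dtheta0).
have tcl t : 0 < t < T -> 0 <= t <= T by move=> /andP[/ltW -> /ltW ->].
have ll : `|l| = l by rewrite gtr0_norm.
have llN : `|- l| = l by rewrite normrN.
apply: (@no_solution R s c 1 0 l 1 (3 * l) l0 ltr01 (lexx 0) ltr01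
    s_add c_add s_odd c_even cs1 ds dc (@c_ge0 l) (@s_low l) (@s_zeros l) (@s_bound l)
    false T 1 A0 theta omega) => //.
- by rewrite ltr01.
- move=> x t tI; have /andP[t0 _] := tcl t tI; have [h1 h2] := sys x t t0.
  have [oK _] := HK t (tcl t tI).
  rewrite -(@velocityE l)// => y yI; apply: (out (omega ^~ t)) => //.
  by rewrite leNgt; apply/negP => yl; apply: yI; rewrite -ler_norml ltW.
- move=> t tI; split=> // _; have [oK zK] := HK t (tcl t tI).
  by split; [apply: (out (omega ^~ t))|apply: (out (omega ^~ t))
    |apply: (out (dx theta ^~ t))|apply: (out (dx theta ^~ t))]; rewrite ?ll ?llN.
- by move=> x; exact: (ini x).2.
- by move=> x; rewrite !zeE mulrNN mulrN mulNr.
- by move=> x /andP[x0 _]; rewrite zeE mulr_ge0 ?flat_ge0// mulr_ge0.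
- move=> x /andP[x1 _]; rewrite zeE flat0 ?mulr0// subr_le0 -expr2.
  by rewrite exprn_ege1.
- by rewrite (ini 0).1 /theta0 mulr0 subr0 subrr.
by rewrite (@eq_rint R 0 1 _ (fun x => theta0 x * cot s c x)) // => x _; rewrite (ini x).1.
Qed.

End line_case.

Theorem theorem2p1 (R : realType) :
  (forall L : R, 0 < L ->
     exists theta0 omega0 : R -> R,
       [/\ smooth1 theta0 /\ smooth1 omega0,
           periodic theta0 L /\ periodic omega0 L &
           ~ exists theta omega : R -> R -> R,
               global_solution_periodic L theta0 omega0 theta omega])
  /\
  (exists theta0 omega0 : R -> R,
     [/\ smooth1 theta0 /\ smooth1 omega0,
         compact (supp (derive1 theta0)) /\ compact (supp omega0) &
         ~ exists theta omega : R -> R -> R,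
             global_solution_line theta0 omega0 theta omega]).
Proof. by split; [exact: periodic_blowup|exact: line_blowup]. Qed.
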